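(* Let $\alpha\in(0,2)$, $\alpha\ne 1$, and let $W_j\sim\mathcal{N}(0,\sigma_W^2)$ with $\sigma_W>0$. With $a=\alpha/2$, $\eta=(1-a)/a$, $\bar\gamma(a)$, $\bar g$, $K(a)$ and $Z_{(c,\infty)}$ as in the context, and $Z\sim\mathcal{N}(0,1)$, for every $c>1$ the Kolmogorov distance $\Delta(Z_{(c,\infty)},Z):=\sup_{x\in\mathbb{R}}|\mathbb{P}(Z_{(c,\infty)}\le x)-\mathbb{P}(Z\le x)|$ is bounded above by $$B_1(c,\alpha):=\frac{cK(a)}{c-1}\left[\frac{1}{(c-1)\bar g^2}+\left(\frac1{\bar g}-\frac{1}{(c-1)\bar g^2}\right)e^{(c-1)\bar g}+\frac{(c-1)\,e^{(c-1)(1-e^{-1})}}{a\,[(c-1)\bar\gamma(a)]^{2/a}}\,\Gamma\!\left(\tfrac2a,(c-1)\bar\gamma(a)\right)\right].$$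
   Context: Lower and upper incomplete gamma functions: $\gamma(s,x)=\int_0^x t^{s-1}e^{-t}\,dt$ and $\Gamma(s,x)=\int_x^\infty t^{s-1}e^{-t}\,dt$. Set $a=\alpha/2$, $\eta=(1-a)/a$, $g(w):=1-e^{-w}-w^a\gamma(1-a,w)$ for $w\ge0$, $\bar\gamma(a):=\gamma(1-a,1)$, $\bar g:=g(1)$, and $$K(a):=\frac1\pi\left[\frac{a}{2(2-a)}+\frac1{\eta^2}\right].$$ Let $\{\Gamma_j\}_{j\ge1}$ be the successive arrival times of a unit rate Poisson process on $(0,\infty)$ and let $\{W_j\}_{j\ge1}$ be i.i.d. $\mathcal{N}(0,\sigma_W^2)$ independent of $\{\Gamma_j\}$. For $c>0$, $R_{(c,\infty)}$ is the limit in distribution, as $d\to\infty$, of $R_{(c,d)}:=\sum_{j:\Gamma_j\in(c,d)}W_j\Gamma_j^{-1/\alpha}$ (this limit exists); $S^2_{(c,\infty)}:=\sigma_W^2\frac{\alpha}{2-\alpha}c^{(\alpha-2)/\alpha}$; and $Z_{(c,\infty)}:=R_{(c,\infty)}/S_{(c,\infty)}$. *)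

(* Defs.v *)
From HB Require Import structures.
From mathcomp Require Import all_boot all_order all_algebra finmap.
From mathcomp Require Import all_classical all_reals all_analysis measurable_realfun.

Set Implicit Arguments.
Unset Strict Implicit.
Unset Printing Implicit Defensive.

Import Order.TTheory GRing.Theory Num.Theory.
Import numFieldNormedType.Exports.

Local Open Scope classical_set_scope.
Local Open Scope ring_scope.

Section special_functions.
Context {R : realType}.
Implicit Types (s x a w c alpha sigma : R).

Let mu := @lebesgue_measure R.

Definition lower_gamma s x : R :=
  \int[mu]_(t in `]0, x]) (t `^ (s - 1) * expR (- t)).

Definition upper_gamma s x : R :=
  \int[mu]_(t in `[x, +oo[) (t `^ (s - 1) * expR (- t)).

Definition eta a : R := (1 - a) / a.

Definition gfun a w : R := 1 - expR (- w) - w `^ a * lower_gamma (1 - a) w.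

Definition gamma_bar a : R := lower_gamma (1 - a) 1.

Definition g_bar a : R := gfun a 1.

Definition Kconst a : R := pi^-1 * (a / (2 * (2 - a)) + (eta a ^+ 2)^-1).

Definition B1 c alpha : R :=
  let a := alpha / 2 in
  let gb := g_bar a in
  c * Kconst a / (c - 1) *
  (((c - 1) * gb ^+ 2)^-1
   + (gb^-1 - ((c - 1) * gb ^+ 2)^-1) * expR ((c - 1) * gb)
   + (c - 1) * expR ((c - 1) * (1 - expR (- 1)))
       / (a * ((c - 1) * gamma_bar a) `^ (2 / a))
     * upper_gamma (2 / a) ((c - 1) * gamma_bar a)).

Definition S_tail sigma alpha c : R :=
  Num.sqrt (sigma ^+ 2 * (alpha / (2 - alpha)) * c `^ ((alpha - 2) / alpha)).

End special_functions.

Section probability_notions.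
Context d (T : measurableType d) (R : realType) (P : probability T R).

Definition mutual_independence (I : choiceType) d' (E : measurableType d')
    (X : I -> T -> E) : Prop :=
  forall (J : {fset I}) (B : I -> set E), (forall i, measurable (B i)) ->
    P (\bigcap_(i in [set` J]) (X i @^-1` B i)) =
    (\prod_(i <- J) P (X i @^-1` B i))%E.

Definition family_sigma_algebra (I : Type) d' (E : measurableType d')
    (X : I -> T -> E) : set (set T) :=
  <<s \bigcup_i preimage_set_system setT (X i) measurable >>.

Definition independent_families (I I' : Type) d' (E : measurableType d')
    d'' (E' : measurableType d'') (X : I -> T -> E) (Y : I' -> T -> E') : Prop :=
  forall A B, family_sigma_algebra X A -> family_sigma_algebra Y B ->
    P (A `&` B) = (P A * P B)%E.

(* Only times t >= 0 matter; the values of N at negative times are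
   unconstrained. *)
Record is_poisson_process (rate : R) (N : R -> {RV P >-> nat}) : Prop := {
  poisson_start : forall w, N 0 w = 0%N;
  poisson_nondecreasing : forall w s t, 0 <= s -> s <= t -> (N s w <= N t w)%N;
  poisson_right_continuous : forall w t, 0 <= t ->
    \forall s \near t^'+, N s w = N t w;
  poisson_independent_increments : forall t : nat -> R, 0 <= t 0%N ->
    {homo t : i j / (i <= j)%N >-> i <= j} ->
    mutual_independence (fun i w => (N (t i.+1) w - N (t i) w)%N);
  poisson_increment_law : forall s t, 0 <= s -> s < t -> forall k,
    P [set w | (N t w - N s w)%N = k] = (poisson_pmf (rate * (t - s)) k)%:E }.

(* 0-indexed: arrival_time N j is the time of the (j+1)-st arrival.  On the
   null event that fewer than j+1 arrivals occur the set is empty, its inf is 0,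
   and no point is thereby added to any interval (c, D) with 0 <= c. *)
Definition arrival_time (N : R -> T -> nat) (j : nat) (w : T) : R :=
  inf [set t | 0 <= t /\ (j < N t w)%N].

End probability_notions.

Section random_sums.
Context d (T : measurableType d) (R : realType).

Lemma measurable_fsbig_setT (F : nat -> T -> R) :
  (forall j, measurable_fun setT (F j)) ->
  measurable_fun setT (fun w => \sum_(j \in setT) F j w).
Proof.
move=> mF.
pose fin := [set w | exists n, forall j, (n <= j)%N -> F j w = 0].
have finE : fin = \bigcup_n \bigcap_j
    (if (n <= j)%N then F j @^-1` [set 0] else setT).
  apply/seteqP; split => w [n].
    by move=> h; exists n => // j _; case: ifPn => // nj; exact: h.
  by move=> _ h; exists n => j nj; have := h j I; rewrite nj.
have mfin : measurable fin.
  rewrite finE; apply: bigcup_measurable => n _.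
  apply: bigcap_measurable => [|j _]; first by exists 0%N.
  by case: ifPn => // _; rewrite -[X in measurable X]setTI; exact: mF.
pose G n w := \1_fin w * \sum_(0 <= j < n) F j w.
apply/measurable_EFinP.
apply: (@emeasurable_fun_cvg _ _ _ setT (fun n w => (G n w)%:E)).
  move=> n; apply/measurable_EFinP/measurable_funM => //.
  exact: measurable_sum.
move=> w _; apply: cvg_EFin; first by near=> n.
rewrite (_ : _ \o _ = G ^~ w)// /G indicE.
have [/set_mem [n hn]|nfin] := boolP (w \in fin).
  apply: cvg_near_cst; exists n => // m /= nm; rewrite mul1r.
  rewrite (@fsbigE _ _ _ _ setT (index_iota 0 m)) ?iota_uniq//.
    by apply: eq_bigl => j; rewrite in_setT.
  move=> j _; rewrite mem_index_iota /= -leqNgt => mj.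
  exact/hn/(leq_trans nm).
rewrite fsbig_dflt; first by under eq_fun do rewrite mul0r; exact: cvg_cst.
rewrite setTI => /finite_fsetP[X XE]; move/negP: nfin; apply; apply/mem_set.
exists (\max_(x <- X) x).+1 => j; apply: contraPP => Fj.
have : [set` X] j by rewrite -XE.
by move=> /= jX; apply/negP; rewrite -leqNgt; exact: leq_bigmax_seq.
Unshelve. all: by end_near.
Qed.

(* The index set is finite as soon as the points Gam j do not accumulate in
   (c, D), which holds for the arrival times of a Poisson process. *)
Definition Rsum (alpha c D : R) (Gam W : nat -> {mfun T >-> R}) (w : T) : R :=
  \sum_(j \in [set j | c < Gam j w < D]) W j w * Gam j w `^ (- alpha^-1).

Lemma measurable_Rsum alpha c D Gam W :
  measurable_fun setT (Rsum alpha c D Gam W).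
Proof.
rewrite /Rsum; under eq_fun do rewrite fsbig_mkcond.
apply: measurable_fsbig_setT => j.
rewrite (_ : (fun w => _) = fun w => \1_(Gam j @^-1` `]c, D[) w *
    (W j w * Gam j w `^ (- alpha^-1))).
  apply: measurable_funM.
    apply: measurable_indic; rewrite -[X in measurable X]setTI.
    exact: measurable_funP.
  apply: measurable_funM => //.
  exact: (measurableT_comp (measurable_powR _) (measurable_funPT (Gam j))).
apply/funext => w; rewrite /patch indicE.
have -> : (j \in [set j | c < Gam j w < D]) = (w \in Gam j @^-1` `]c, D[).
  by apply/idP/idP => /set_mem /= h; apply/mem_set => //=; rewrite ?in_itv/= in h *.
by case: ifPn; rewrite ?mul1r ?mul0r.
Qed.

HB.instance Definition _ alpha c D Gam W :=
  isMeasurableFun.Build _ _ _ _ (Rsum alpha c D Gam W)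
    (measurable_Rsum alpha c D Gam W).

End random_sums.

Section distances.
Context (R : realType).

Definition cvg_in_distribution d (T : measurableType d) (P : probability T R)
    d' (T' : measurableType d') (Q : probability T' R)
    (I : Type) (F : set_system I) (X : I -> {RV P >-> R}) (Y : {RV Q >-> R}) :
    Prop :=
  forall x, {for x, continuous (cdf Y)} -> cdf (X i) x @[i --> F] --> cdf Y x.

Definition kolmogorov_distance d (T : measurableType d) (P : probability T R)
    d' (T' : measurableType d') (Q : probability T' R)
    (X : {RV P >-> R}) (Y : {RV Q >-> R}) : \bar R :=
  ereal_sup [set `|cdf X x - cdf Y x|%E | x in [set: R]].

End distances.

(* Main.v *)
(* Given the arrival times, the truncated sum is a centred Gaussian variable, so
   its characteristic function is a Laplace transform of the shot noise
   [\sum_j Gamma_j^(-1/a)].  Slicing [(c, D)] into small intervals and using the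
   independence of the Poisson increments, this transform is squeezed onto
   [exp (- Psi lambda)], with
   [Psi lambda = \int_c^oo (1 - exp (- lambda x^(-1/a))) dx].
   Bounding [1 - e^(-y)] between [y - y^2/2] and [y] shows that [exp (- Psi)]
   exceeds the Gaussian characteristic function by at most the second-order term
   times [exp (- Psi)].  With [lambda = w c^(1/a)], the factor [exp (- Psi)] is
   controlled through [Psi >= w * Psi (c^(1/a))] (concavity) for [w <= 1] and
   through a layer-cake computation, which brings in the incomplete gamma
   function, for [w > 1]; integrating these two majorants gives [B1].
   Characteristic functions are turned into distribution functions without any
   assumption on densities: the indicator is replaced by the distribution
   function of a normal law of scale [e], written as a sine integral, and [e] is
   sent to [0] at the end together with the shifts it causes. *)

Require Import Defs.
From mathcomp Require Import all_boot all_order all_algebra finmap.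
From mathcomp Require Import all_classical all_reals all_analysis measurable_realfun.
From mathcomp Require Import ring lra.

Set Implicit Arguments.
Unset Strict Implicit.
Unset Printing Implicit Defensive.

Import Order.TTheory GRing.Theory Num.Theory.
Import numFieldNormedType.Exports.

Local Open Scope classical_set_scope.
Local Open Scope ring_scope.

(** Both sides of the comparison are symmetric, so one real function [phi] with E sin(y - u X) =
    sin(y) phi(u) plays the part of the characteristic function. The Fourier step wants an
    integrable variable, and integrability of [Rinf] is not known. It is therefore carried out on
    sums with a fixed number of terms; only distribution functions and Laplace transforms are taken
    to the limit, first in the number of terms, then in [D]. At each stage the transform stays above
    exp(-Psi), hence above the Gaussian one. The difference thus has a sign, and monotonicity of the
    transform in u makes it measurable. The final bound does not depend on the smoothing scale [e]:
    the Gaussian weight is bounded by 1, and dr/r is invariant under the rescaling that absorbs [e].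
    At lambda = c^(1/a) the layer-cake bound reads Psi >= - c g_bar; the strict negativity of
    [g_bar] is what makes the majorant decay for small w. *)

Lemma measurable_sin (R : realType) : measurable_fun setT (@sin R).
Proof. by apply: continuous_measurable_fun; exact: continuous_sin. Qed.

Lemma measurable_cos (R : realType) : measurable_fun setT (@cos R).
Proof. by apply: continuous_measurable_fun; exact: continuous_cos. Qed.

(** * Integration tools and the normal law *)

Section bounded_integral.
Context d (T : measurableType d) (R : realType) (P : probability T R).

Lemma bounded_integrable (f : T -> R) (M : R) : measurable_fun setT f ->
  (forall w, `|f w| <= M) -> P.-integrable setT (EFin \o f).
Proof.
move=> mf fM; apply: measurable_bounded_integrable => //.
  by have : (P setT < +oo)%E by rewrite probability_setT ltry.
exists M; split; first exact: num_real.
by move=> x Mx w _ /=; exact: le_trans (fM w) (ltW Mx).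
Qed.

Lemma le_norm_bounded_Rintegral (f : T -> R) (M : R) : measurable_fun setT f ->
  (forall w, `|f w| <= M) -> `|\int[P]_w f w| <= M.
Proof.
move=> mf fM; have intf := bounded_integrable mf fM.
apply: le_trans (le_normr_Rintegral measurableT intf) _.
have PT : P setT = 1%E by rewrite probability_setT.
have -> : M = \int[P]_w M.
  rewrite Rintegral_cst// -[LHS]mulr1; congr (_ * _).
  by rewrite -[LHS]/(fine 1%E); congr fine; exact/esym.
apply: le_Rintegral => //; first exact: integrable_norm intf.
by apply: (@bounded_integrable _ `|M|).
Qed.

End bounded_integral.

Section dominated_Rintegral.
Context d (T : measurableType d) (R : realType) (mu : {measure set T -> \bar R}).
Variables (D : set T) (mD : measurable D).

Lemma dominated_cvg_Rintegral (f_ : nat -> T -> R) (f g : T -> R) :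
  (forall n, measurable_fun D (f_ n)) -> mu.-integrable D (EFin \o g) ->
  (forall x, D x -> f_ n x @[n --> \oo] --> f x) ->
  (forall n x, D x -> `|f_ n x| <= g x) ->
  \int[mu]_(x in D) f_ n x @[n --> \oo] --> \int[mu]_(x in D) f x.
Proof.
move=> mf_ ig f_f f_g.
have mf : measurable_fun D f.
  apply/measurable_EFinP.
  apply: (@emeasurable_fun_cvg _ _ _ _ (fun n x => (f_ n x)%:E)).
    by move=> n; exact/measurable_EFinP.
  by move=> x Dx; apply: cvg_EFin; [exact: nearW|exact: f_f].
have [intf _ cvgf] : [/\ mu.-integrable D (EFin \o f),
    [sequence \int[mu]_(x in D) `|(f_ n x)%:E - (f x)%:E|]_n @ \oo --> 0%E &
    [sequence \int[mu]_(x in D) (f_ n x)%:E]_n @ \oo --> \int[mu]_(x in D) (f x)%:E]%E.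
  apply: (@dominated_convergence _ _ _ mu D mD (fun n x => (f_ n x)%:E) _ (EFin \o g)) => //.
  - by move=> n; exact/measurable_EFinP.
  - exact/measurable_EFinP.
  - by apply: aeW => x Dx; apply: cvg_EFin; [exact: nearW|exact: f_f].
  - by apply: aeW => x Dx n; rewrite lee_fin f_g.
apply: fine_cvg; rewrite fineK//.
exact: integrable_fin_num.
Qed.

Lemma dominated_integrable_EFin (f g : T -> R) : measurable_fun D f ->
  mu.-integrable D (EFin \o g) -> (forall x, D x -> `|f x| <= g x) ->
  mu.-integrable D (EFin \o f).
Proof.
move=> mf ig fg; apply: le_integrable ig => //; first exact/measurable_EFinP.
by move=> x Dx /=; rewrite lee_fin (le_trans (fg x Dx))// ler_norm.
Qed.

Lemma integrable_EFinZl (k : R) (f : T -> R) :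
  mu.-integrable D (EFin \o f) -> mu.-integrable D (EFin \o (fun x => k * f x)).
Proof.
move=> /(integrableZl mD k); exact: eq_integrable.
Qed.

(** Dominated convergence with [|f|] as dominating function: each point lies in all but finitely
    many of the sets. *)
Lemma cvg_Rintegral_bigcup (f : T -> R) (D_ : nat -> set T) :
  (forall n, measurable (D_ n)) -> (forall n, D_ n `<=` D) ->
  (forall x, D x -> \forall n \near \oo, D_ n x) ->
  mu.-integrable D (EFin \o f) ->
  \int[mu]_(x in D_ n) f x @[n --> \oo] --> \int[mu]_(x in D) f x.
Proof.
move=> mD_ D_D DnD intf.
have mf : measurable_fun D f by apply/measurable_EFinP; exact: measurable_int intf.
under eq_fun do rewrite -(setIidr (D_D _)) Rintegral_mkcondr.
apply: (@dominated_cvg_Rintegral _ _ (fun x => `|f x|)).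
- move=> n; apply/measurable_restrict => //.
  by apply: measurable_funS mf => //; exact: subIsetl.
- exact: integrable_norm.
- move=> x Dx; apply: cvg_near_cst; near=> n.
  by rewrite patchE mem_set//; near: n; exact: DnD.
- by move=> n x Dx; rewrite patchE; case: ifP => //; rewrite normr0.
Unshelve. all: by end_near. Qed.

End dominated_Rintegral.

Section normal_law.
Context {R : realType}.
Local Notation mu := (@lebesgue_measure R).
Local Open Scope ereal_scope.

(** The Radon-Nikodym derivative is characterised only through its integrals, so it is replaced by
    [normal_pdf] almost everywhere. *)
Lemma integral_normal_prob (s : R) (f : R -> \bar R) : measurable_fun setT f ->
  \int[normal_prob 0 s]_x `|f x| < +oo ->
  \int[normal_prob 0 s]_x f x = \int[mu]_x (f x * (normal_pdf 0 s x)%:E).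
Proof.
move=> mf finf.
rewrite -(Radon_Nikodym_change_of_variables (normal_prob_dominates 0 s))//=; last first.
  by apply/integrableP; split.
have mpdf := measurable_normal_pdf 0 s.
apply: ae_eq_integral => //.
- apply: emeasurable_funM => //; apply: (measurable_int mu).
  by apply: Radon_Nikodym_integrable; exact: normal_prob_dominates.
- by apply: emeasurable_funM => //=; apply/measurableT_comp.
- apply: ae_eqe_mul2l => /=.
  rewrite Radon_NikodymE//=; first exact: normal_prob_dominates.
  move=> abmu; case: cid => /= h [h1 h2 h3].
  apply: integral_ae_eq => //=; first by apply/measurableT_comp.
  by move=> E E01 mE; rewrite -h3.
Qed.

Context d (T : measurableType d) (P : probability T R).
Variables (Y : {RV P >-> R}) (s : R).
Hypothesis Ylaw : distribution P Y = normal_prob 0 s.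

(* [lebesgue_measure], hence [normal_prob], lives on [measurableTypeR R], whose
   measurable structure is convertible to, but distinct from, that of [R]. *)
Let mY : measurable_fun [set: T] (Y : T -> measurableTypeR R).
Proof. exact (@measurable_funPT _ _ _ _ Y). Qed.

Let Y' : {RV P >-> measurableTypeR R} :=
  @mfun_Sub _ _ T (measurableTypeR R) _ (mem_set mY).

Lemma integral_normal_law (f : R -> \bar R) : measurable_fun setT f ->
  P.-integrable setT (f \o Y) ->
  \int[P]_w f (Y w) = \int[normal_prob 0 s]_y f y.
Proof.
move=> mf intf.
rewrite -(@integral_distribution _ _ _ _ _ P Y' f)//.
by apply: eq_measure_integral => A _ _; exact (congr1 (fun m => m A) Ylaw).
Qed.

Lemma ge0_integral_normal_law (f : R -> \bar R) : measurable_fun setT f ->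
  (forall y, 0 <= f y) ->
  \int[P]_w f (Y w) = \int[normal_prob 0 s]_y f y.
Proof.
move=> mf f0.
rewrite -(@ge0_integral_distribution _ _ _ _ _ P Y' f)//.
by apply: eq_measure_integral => A _ _; exact (congr1 (fun m => m A) Ylaw).
Qed.

End normal_law.

Lemma derivable_continuous (R : realType) (f : R -> R) :
  (forall x, derivable f x 1) -> continuous f.
Proof. by move=> df x; apply: differentiable_continuous; exact/derivable1_diffP. Qed.

(** * Fourier transform of the Gaussian *)

Section gaussian_fourier.
Context {R : realType}.
Local Notation mu := (@lebesgue_measure R).
Variables (v y : R).
Hypothesis v0 : 0 < v.

Definition gauss v (w : R) : R := expR (- (w ^+ 2 / (2 * v))).

Lemma gauss_ge0 w : 0 <= gauss v w. Proof. exact: expR_ge0. Qed.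

Lemma gauss_le1 w : gauss v w <= 1.
Proof. by rewrite -expR0 ler_expR oppr_le0 divr_ge0 ?sqr_ge0 ?mulr_ge0 ?ltW. Qed.

Lemma continuous_gauss : continuous (gauss v).
Proof.
move=> w; apply: continuous_comp; last exact: continuous_expR.
apply: continuousN; apply: cvgMr_tmp.
exact: exprn_continuous.
Qed.

Lemma measurable_gauss : measurable_fun setT (gauss v).
Proof. by apply: continuous_measurable_fun; exact: continuous_gauss. Qed.

(** The first factor is the inverse of the expected Fourier transform, so the claim to prove becomes
    that the integral over [w] is constant in [t]. *)
Definition tilt (t w : R) : R := expR (v * t ^+ 2 / 2) * sin (y - t * w) * gauss v w.

Definition dtilt (t w : R) : R :=
  expR (v * t ^+ 2 / 2) * gauss v w * (v * t * sin (y - t * w) - w * cos (y - t * w)).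

Lemma is_derive_tilt (t w : R) : is_derive t 1 (tilt ^~ w) (dtilt t w).
Proof.
rewrite /tilt /dtilt; apply: is_derive_eq.
rewrite !scaler1 /= ?scale0r ?scaler0 ?add0r ?addr0 /GRing.scale/=.
by field.
Qed.

(* Both partial derivatives are total: the same function is the derivative in
   [t] of the integrand and the derivative in [w] of a boundary term. *)
Lemma is_derive_boundary (t w : R) :
  is_derive w 1 (fun w => v * expR (v * t ^+ 2 / 2) * (gauss v w * cos (y - t * w)))
    (dtilt t w).
Proof.
rewrite /gauss /dtilt; apply: is_derive_eq.
rewrite !scaler1 /= ?scale0r ?scaler0 ?add0r ?addr0 /GRing.scale/= /gauss.
by field; rewrite lt0r_neq0.
Qed.

Lemma continuous_tilt t : continuous (tilt t).
Proof.
apply: derivable_continuous => w; rewrite /tilt /gauss.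
exact: ex_derive.
Qed.

Lemma continuous_dtilt t : continuous (dtilt t).
Proof.
apply: derivable_continuous => w; rewrite /dtilt /gauss.
exact: ex_derive.
Qed.

Lemma integrable_itv_continuous (a b : R) (f : R -> R) : continuous f ->
  mu.-integrable `[a, b] (EFin \o f).
Proof.
move=> cf; apply: continuous_compact_integrable; first exact: segment_compact.
exact: continuous_subspaceT.
Qed.

Lemma dtilt_bound a b m t w : a <= w <= b -> `|t| <= m ->
  `|dtilt t w| <= expR (v * m ^+ 2 / 2) * (v * m + Order.max `|a| `|b|).
Proof.
move=> /andP[aw wb] tm; rewrite /dtilt normrM; apply: ler_pM => //.
  rewrite normrM (ger0_norm (gauss_ge0 _)) (ger0_norm (expR_ge0 _)) -[leRHS]mulr1.
  apply: ler_pM (expR_ge0 _) (gauss_ge0 _) _ (gauss_le1 _).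
  rewrite ler_expR ler_pM2r// ler_pM2l//.
  by rewrite -real_normK ?num_real// lerXn2r// nnegrE// (le_trans _ tm).
apply: le_trans (ler_normB _ _) _; apply: lerD.
  rewrite !normrM (gtr0_norm v0) -mulrA; apply: ler_pM => //; first exact: ltW.
  rewrite -[leRHS]mulr1; apply: ler_pM => //.
  by rewrite ler_norml sin_geN1 sin_le1.
rewrite normrM -[leRHS]mulr1; apply: ler_pM => //.
  rewrite le_max; have [w0|w0] := leP 0 w.
    by rewrite (ger0_norm w0) (ger0_norm (le_trans w0 wb)) wb orbT.
  by rewrite (ltr0_norm w0) (ltr0_norm (le_lt_trans aw w0)) lerN2 aw.
by rewrite ler_norml cos_geN1 cos_le1.
Qed.

Let boundary t w := v * expR (v * t ^+ 2 / 2) * (gauss v w * cos (y - t * w)).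

(** On a compact interval a constant dominates [dtilt], which allows differentiation under the
    integral; the resulting integral is a difference of boundary values. *)
Lemma is_derive_int_tilt (a b t : R) : a < b ->
  is_derive t 1 (fun t => \int[mu]_(w in `[a, b]) tilt t w) (boundary t b - boundary t a).
Proof.
move=> ab.
pose m := `|t| + 1.
have tI : `]t - 1, t + 1[%classic t by rewrite /= in_itv/=; lra.
have Im x : `]t - 1, t + 1[%classic x -> `|x| <= m.
  rewrite /= in_itv/= /m => /andP[x1 x2].
  have -> : x = t + (x - t) by ring.
  apply: le_trans (ler_normD _ _) _; rewrite lerD2l ler_norml; lra.
have d1E x w : partial1of2 tilt x w = dtilt x w.
  by rewrite partial1of2E; apply: derive_val; exact: is_derive_tilt.
pose M := expR (v * m ^+ 2 / 2) * (v * m + Order.max `|a| `|b|).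
have M0 : 0 <= M.
  by rewrite mulr_ge0 ?expR_ge0// addr_ge0 ?mulr_ge0 ?addr_ge0 ?(ltW v0)// le_max normr_ge0.
have h1 x : `]t - 1, t + 1[%classic x -> mu.-integrable `[a, b] (EFin \o tilt x).
  by move=> _; apply: integrable_itv_continuous; exact: continuous_tilt.
have h2 x w : `]t - 1, t + 1[%classic x -> `[a, b]%classic w -> derivable (tilt ^~ w) x 1.
  by move=> _ _; apply: ex_derive; exact: is_derive_tilt.
have h3 : mu.-integrable `[a, b] (EFin \o cst M).
  by apply: integrable_itv_continuous; exact: cst_continuous.
have h4 x w : `]t - 1, t + 1[%classic x -> `[a, b]%classic w -> `|partial1of2 tilt x w| <= cst M w.
  by move=> xI; rewrite d1E /= in_itv/= => wab; apply: dtilt_bound => //; exact: Im.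
have dI := @derivable_under_integral _ _ _ mu tilt `[a, b] (measurable_itv _) t
  (t - 1) (t + 1) tI h1 h2 (cst M) (fun _ => M0) h3 h4.
have DI := @differentiation_under_integral _ _ _ mu tilt `[a, b] (measurable_itv _) t
  (t - 1) (t + 1) tI h1 h2 (cst M) (fun _ => M0) h3 h4.
apply: DeriveDef; first exact: dI.
rewrite -derive1E DI.
under eq_Rintegral do rewrite d1E.
rewrite /Rintegral (@continuous_FTC2 _ (dtilt t) (boundary t))//.
- by apply: continuous_subspaceT; exact: continuous_dtilt.
- have db w : derivable (boundary t) w 1.
    by apply: ex_derive; exact: is_derive_boundary.
  have cb := derivable_continuous db.
  split => //.
  + by apply: cvg_at_right_filter; exact: cb.
  + by apply: cvg_at_left_filter; exact: cb.
- move=> w _; rewrite derive1E; apply: derive_val; exact: is_derive_boundary.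
Qed.

Lemma int_tilt_bound (a b t K : R) : a < b -> 0 <= t ->
  (forall u, `|boundary u b - boundary u a| <= v * expR (v * u ^+ 2 / 2) * K) ->
  `|\int[mu]_(w in `[a, b]) tilt t w - \int[mu]_(w in `[a, b]) tilt 0 w|
    <= t * (v * expR (v * t ^+ 2 / 2) * K).
Proof.
move=> ab t0 bK.
have K0 : 0 <= K.
  by have := le_trans (normr_ge0 _) (bK 0); rewrite pmulr_rge0// mulr_gt0// expR_gt0.
pose I u := \int[mu]_(w in `[a, b]) tilt u w.
have dI (u : R) : is_derive u 1 I (boundary u b - boundary u a) by exact: is_derive_int_tilt.
have [u /[!in_itv]/= /andP[u0 ut] ->] := @MVT_segment _ I _ 0 t t0 (fun x _ => dI x)
   (continuous_subspaceT (derivable_continuous (fun x => @ex_derive _ _ _ _ _ _ _ (dI x)))).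
rewrite subr0 normrM (ger0_norm t0) mulrC ler_wpM2l//.
apply: le_trans (bK u) _; rewrite ler_wpM2r// ler_pM2l// ler_expR ler_pM2r// ler_pM2l//.
by rewrite lerXn2r// nnegrE.
Qed.

Lemma gauss_normal_fun (w : R) : gauss v w = normal_fun 0 (Num.sqrt v) w.
Proof.
rewrite /gauss /normal_fun subr0 sqr_sqrtr; last exact: ltW.
by congr expR; rewrite mulNr -[v *+ 2]mulr_natl.
Qed.

Lemma integrable_gauss : mu.-integrable setT (EFin \o gauss v).
Proof.
have sv0 : Num.sqrt v != 0 by rewrite gt_eqF// sqrtr_gt0.
have := integrable_normal_pdf 0 (Num.sqrt v).
rewrite normal_pdfE// => /(integrableZl measurableT (normal_peak (Num.sqrt v))^-1).
apply: eq_integrable => // w _ /=.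
rewrite -EFinM gauss_normal_fun mulKf//.
by rewrite gt_eqF// normal_peak_gt0.
Qed.

Lemma measurable_tilt t : measurable_fun setT (tilt t).
Proof. by apply: continuous_measurable_fun; exact: continuous_tilt. Qed.

Lemma integrable_tilt t : mu.-integrable setT (EFin \o tilt t).
Proof.
have ig := integrable_EFinZl measurableT (expR (v * t ^+ 2 / 2)) integrable_gauss.
apply: (dominated_integrable_EFin measurableT _ ig); first exact: measurable_tilt.
move=> w _.
rewrite /tilt !normrM (ger0_norm (expR_ge0 _)) (ger0_norm (gauss_ge0 _)).
apply: ler_wpM2r; first exact: gauss_ge0.
by apply: ler_piMr; [exact: expR_ge0|rewrite ler_norml sin_geN1 sin_le1].
Qed.

Lemma cvg_gaussS : gauss v n.+1%:R @[n --> \oo] --> 0.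
Proof.
apply: (@squeeze_cvgr _ _ _ _ (cst 0) (fun n => 2 * v * n.+1%:R^-1)).
- apply: nearW => n; rewrite gauss_ge0/= /gauss expRN.
  have n0 : 0 < n.+1%:R :> R by rewrite ltr0n.
  have n1 : 1 <= n.+1%:R :> R by rewrite ler1n.
  rewrite -[leRHS]invrK lef_pV2 ?posrE ?expR_gt0 ?invr_gt0 ?mulr_gt0 ?invr_gt0//.
  apply: le_trans (expR_ge1Dx _); rewrite invfM invrK mulrC.
  apply: (@le_trans _ _ (n.+1%:R ^+ 2 / (2 * v))); last by rewrite lerDr.
  by rewrite ler_pM2r ?invr_gt0 ?mulr_gt0// expr2 ler_peMr.
- exact: cvg_cst.
- rewrite -[X in _ --> X](mulr0 (2 * v)); apply: cvgMl_tmp; exact: cvg_harmonic.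
Qed.

(** The sequence [lo] lets one exhaustion argument serve both the whole line and the half-line. *)
Lemma int_tilt_eq (t C : R) (D : set R) (lo : nat -> R) : 0 <= t -> measurable (D : set (measurableTypeR R)) ->
  (forall n, `[lo n, n.+1%:R] `<=` D) ->
  (forall x, D x -> \forall n \near \oo, `[lo n, n.+1%:R]%classic x) ->
  (forall n, lo n < n.+1%:R) ->
  (forall n u, `|boundary u n.+1%:R - boundary u (lo n)| <=
     v * expR (v * u ^+ 2 / 2) * (C * gauss v n.+1%:R)) ->
  \int[mu]_(w in D) tilt t w = \int[mu]_(w in D) tilt 0 w.
Proof.
move=> t0 mD DD nearD lon bK.
have cvgI u := cvg_Rintegral_bigcup mD (fun n => measurable_itv `[lo n, n.+1%:R]) DD nearD
  (integrableS measurableT mD (@subsetT _ _) (integrable_tilt u)).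
apply/eqP; rewrite -subr_eq0 -normr_eq0; apply/eqP.
have c1 : `|\int[mu]_(w in `[lo n, n.+1%:R]) tilt t w -
            \int[mu]_(w in `[lo n, n.+1%:R]) tilt 0 w| @[n --> \oo] -->
          `|\int[mu]_(w in D) tilt t w - \int[mu]_(w in D) tilt 0 w|.
  by apply: cvg_norm; apply: cvgB; exact: cvgI.
have c2 : `|\int[mu]_(w in `[lo n, n.+1%:R]) tilt t w -
            \int[mu]_(w in `[lo n, n.+1%:R]) tilt 0 w| @[n --> \oo] --> 0.
  apply: (@squeeze_cvgr _ _ _ _ (cst 0)
    (fun n => t * (v * expR (v * t ^+ 2 / 2) * C) * gauss v n.+1%:R)).
  - apply: nearW => n; rewrite normr_ge0/=.
    by apply: le_trans (int_tilt_bound (lon n) t0 (bK n)) _; rewrite !mulrA.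
  - exact: cvg_cst.
  - by rewrite -[X in _ --> X](mulr0 (t * (v * expR (v * t ^+ 2 / 2) * C)));
      apply: cvgMl_tmp; exact: cvg_gaussS.
exact: (cvg_unique _ c1 c2).
Qed.

Lemma gaussN (w : R) : gauss v (- w) = gauss v w.
Proof. by rewrite /gauss sqrrN. Qed.

Lemma int_tilt_setT (t : R) : 0 <= t -> \int[mu]_w tilt t w = \int[mu]_w tilt 0 w.
Proof.
move=> t0; apply: (@int_tilt_eq t 2 setT (fun n => - n.+1%:R)) => //.
- move=> x _; near=> n; rewrite /= in_itv/= -ler_norml.
  rewrite (@le_trans _ _ n%:R) ?ler_nat//.
    by near: n; exact: nbhs_infty_ger.
- by move=> n; rewrite (@lt_trans _ _ 0)// ?oppr_lt0 ltr0n.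
move=> n u; rewrite /boundary -mulrBr normrM ger0_norm; last first.
  by rewrite mulr_ge0 ?expR_ge0// ltW.
rewrite ler_pM2l ?mulr_gt0 ?expR_gt0// gaussN -mulrBr normrM (ger0_norm (gauss_ge0 _)).
rewrite mulrC ler_wpM2r ?gauss_ge0//; apply: le_trans (ler_normB _ _) _.
by apply: (@le_trans _ _ (1 + 1)) => //; apply: lerD; rewrite ler_norml cos_geN1 cos_le1.
Unshelve. all: by end_near. Qed.

End gaussian_fourier.

Section gaussian_fourier_consequences.
Context {R : realType}.
Local Notation mu := (@lebesgue_measure R).

Lemma Rintegral_gauss_sin (v y t : R) : 0 < v ->
  \int[mu]_w (sin (y - t * w) * gauss v w) =
  sin y * expR (- (v * t ^+ 2 / 2)) * \int[mu]_w gauss v w.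
Proof.
wlog t0 : y t / 0 <= t => [wlg|] v0.
  have [|t0] := leP 0 t; first by move=> t0; exact: wlg.
  transitivity (\int[mu]_w (- 1 * (sin (- y - (- t) * w) * gauss v w))).
    apply: eq_Rintegral => w _; rewrite mulrA; congr (_ * _).
    by rewrite mulN1r -sinN; congr sin; ring.
  rewrite RintegralZl//.
    by rewrite wlg// ?oppr_ge0 ?(ltW t0)// sinN sqrrN; ring.
  have := integrable_tilt (- y) v0 (- t).
  move/(integrableZl measurableT (expR (- (v * t ^+ 2 / 2)))).
  apply: eq_integrable => // w _ /=.
  by rewrite -EFinM /tilt sqrrN !mulrA -expRD addNr expR0 mul1r.
have := int_tilt_setT y v0 t0.
have -> : \int[mu]_w tilt v y 0 w = sin y * \int[mu]_w gauss v w.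
  rewrite -RintegralZl//; last exact: integrable_gauss.
  by apply: eq_Rintegral => w _; rewrite /tilt expr0n/= mulr0 mul0r expR0 mul1r mul0r subr0.
move=> E; rewrite mulrAC -E -RintegralZr//; last exact: integrable_tilt.
apply: eq_Rintegral => w _; rewrite /tilt.
by rewrite [RHS]mulrC !mulrA -expRD addNr expR0 mul1r.
Qed.

(** Taking the phase [y = pi / 2] turns the sine into a cosine and also kills the boundary term at
    0, since cos(pi/2) = 0. *)
Lemma Rintegral_gauss_cos0y (v t : R) : 0 < v -> 0 <= t ->
  \int[mu]_(w in `[0, +oo[) (cos (t * w) * gauss v w) =
  expR (- (v * t ^+ 2 / 2)) * \int[mu]_(w in `[0, +oo[) gauss v w.
Proof.
move=> v0 t0.
have E : \int[mu]_(w in `[0, +oo[) tilt v (pi / 2) t w =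
         \int[mu]_(w in `[0, +oo[) tilt v (pi / 2) 0 w.
  apply: (@int_tilt_eq _ _ _ v0 t 1 _ (fun n => 0)) => //.
  - by move=> n x /=; rewrite !in_itv/= => /andP[->].
  - move=> x /=; rewrite in_itv/= andbT => x0; near=> n; rewrite in_itv/= x0/=.
    rewrite (@le_trans _ _ n%:R) ?ler_nat//.
    by near: n; exact: nbhs_infty_ger.
  move=> n u; rewrite mulr0 subr0 cos_pihalf mulr0 mulr0 subr0 mul1r.
  rewrite normrM ger0_norm; last by rewrite mulr_ge0 ?expR_ge0// ltW.
  rewrite ler_pM2l ?mulr_gt0 ?expR_gt0// normrM (ger0_norm (gauss_ge0 _ _)).
  by rewrite ler_piMr ?gauss_ge0// ler_norml cos_geN1 cos_le1.
have i0 u : mu.-integrable `[0, +oo[ (EFin \o tilt v (pi / 2) u).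
  by apply: integrableS (integrable_tilt _ v0 u).
have tE u w : tilt v (pi / 2) u w = expR (v * u ^+ 2 / 2) * (cos (u * w) * gauss v w).
  by rewrite /tilt -mulrA; congr (_ * (_ * _)); rewrite sinB sin_pihalf cos_pihalf mul1r mul0r subr0.
transitivity (expR (- (v * t ^+ 2 / 2)) * \int[mu]_(w in `[0, +oo[) tilt v (pi / 2) t w).
  rewrite -RintegralZl//; apply: eq_Rintegral => w _.
  by rewrite tE mulrA -expRD addNr expR0 mul1r.
rewrite E; congr (_ * _); apply: eq_Rintegral => w _.
by rewrite tE expr0n/= mulr0 !mul0r expR0 cos0 !mul1r.
Unshelve. all: by end_near. Qed.

Lemma normal_pdf_gauss (s w : R) : s != 0 ->
  normal_pdf 0 s w = normal_peak s * gauss (s ^+ 2) w.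
Proof.
move=> s0; rewrite normal_pdfE// /normal_fun /gauss subr0 mulNr.
by congr (_ * expR (- (_ / _))); rewrite mulr_natl.
Qed.

Lemma integrable_bounded_normal (s : R) (f : R -> R) (M : R) :
  measurable_fun setT f -> (forall x, `|f x| <= M) ->
  (normal_prob 0 s).-integrable setT (EFin \o f).
Proof. by move=> mf fM; exact: (@bounded_integrable _ _ _ (normal_prob 0 s) f M). Qed.

Lemma Rintegral_normal_sin (s a h : R) : s != 0 ->
  \int[normal_prob 0 s]_y sin (a - h * y) = sin a * expR (- (h * s) ^+ 2 / 2).
Proof.
move=> s0; have s20 : 0 < s ^+ 2 by rewrite exprn_even_gt0.
have msin : measurable_fun setT (fun y : R => sin (a - h * y)).
  by apply: measurableT_comp; [exact: measurable_sin|apply: measurable_funB].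
have isin : (normal_prob 0 s).-integrable setT (EFin \o (fun y : R => sin (a - h * y))).
  apply: (@integrable_bounded_normal s _ 1) => // x.
  by rewrite ler_norml sin_geN1 sin_le1.
rewrite /Rintegral integral_normal_prob//; last 2 first.
- exact/measurable_EFinP.
- by have /integrableP[] := isin.
have nE : normal_peak s * \int[mu]_w gauss (s ^+ 2) w = 1.
  rewrite -RintegralZl//; last exact: integrable_gauss.
  rewrite -[RHS]/(fine 1%E) -(integral_normal_pdf 0 s); congr fine.
  by apply: eq_integral => w _; rewrite normal_pdf_gauss.
under eq_integral do rewrite normal_pdf_gauss// -EFinM mulrCA.
rewrite -/(Rintegral mu setT (fun w => normal_peak s * (sin (a - h * w) * gauss (s ^+ 2) w))).
rewrite RintegralZl//; last first.
  have ig := integrable_gauss s20.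
  apply: (dominated_integrable_EFin measurableT _ ig) => //.
    by apply: measurable_funM => //; exact: measurable_gauss.
  move=> w _; rewrite normrM (ger0_norm (gauss_ge0 _ _)).
  by rewrite ler_piMl ?gauss_ge0// ler_norml sin_geN1 sin_le1.
rewrite Rintegral_gauss_sin// mulrCA nE mulr1.
by congr (_ * expR _); rewrite exprMn; ring.
Qed.

(** Nonnegativity replaces the finiteness assumption of [integral_normal_prob]; this version is the
    one that can establish integrability. *)
Lemma ge0_integral_normal_prob (s : R) (f : R -> \bar R) :
  measurable_fun setT f -> (forall x, 0 <= f x)%E ->
  (\int[normal_prob 0 s]_x f x = \int[mu]_x (f x * (normal_pdf 0 s x)%:E))%E.
Proof.
move=> mf f0.
have dom := normal_prob_dominates 0 s.
rewrite -(Radon_Nikodym_SigmaFinite.change_of_variables dom)//.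
have mpdf := measurable_normal_pdf 0 s.
have mRN := measurable_int mu (Radon_Nikodym_SigmaFinite.f_integrable dom).
apply: ae_eq_integral => //.
- exact: emeasurable_funM.
- by apply: emeasurable_funM => //=; apply/measurableT_comp.
- apply: ae_eqe_mul2l => /=.
  apply: integral_ae_eq => //=.
  + exact: Radon_Nikodym_SigmaFinite.f_integrable.
  + by apply/measurableT_comp.
  + by move=> E E01 mE; rewrite -Radon_Nikodym_SigmaFinite.f_integral.
Qed.

(** Half of the Gaussian exponent absorbs the factor [|w|]: [gauss v] is the square of
    [gauss (2 * v)], and exp(z) >= 1 + z handles one of the two factors. *)
Lemma normM_gauss_le (v w : R) : 0 < v ->
  `|w| * gauss v w <= (1 + 4 * v) * gauss (2 * v) w.
Proof.
move=> v0.
have -> : gauss v w = gauss (2 * v) w * gauss (2 * v) w.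
  rewrite /gauss -expRD; congr expR; field; rewrite lt0r_neq0//.
rewrite mulrA ler_wpM2r ?gauss_ge0//.
rewrite {1}/gauss expRN ler_pdivrMr ?expR_gt0//.
apply: (@le_trans _ _ ((1 + 4 * v) * (1 + w ^+ 2 / (2 * (2 * v))))); last first.
  by rewrite ler_wpM2l ?expR_ge1Dx// addr_ge0 ?mulr_ge0// ltW.
have -> : (1 + 4 * v) * (1 + w ^+ 2 / (2 * (2 * v))) =
    1 + w ^+ 2 + (4 * v + w ^+ 2 / (2 * (2 * v))).
  by field; rewrite lt0r_neq0.
rewrite -[w ^+ 2]real_normK ?num_real//.
have : 0 <= 4 * v + `|w| ^+ 2 / (2 * (2 * v)).
  by rewrite addr_ge0 ?divr_ge0 ?mulr_ge0 ?sqr_ge0// ltW.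
by have := sqr_ge0 (`|w| - 1); nra.
Qed.

Lemma integrable_normal_id (s : R) : s != 0 ->
  (normal_prob 0 s).-integrable setT (EFin : R -> \bar R).
Proof.
move=> s0; have s20 : 0 < s ^+ 2 by rewrite exprn_even_gt0.
have mid : measurable_fun setT (@EFin R) by exact/measurable_EFinP.
apply/integrableP; split => //.
rewrite ge0_integral_normal_prob//; last exact: measurableT_comp.
have s22 : 0 < 2 * s ^+ 2 by rewrite mulr_gt0.
have ig := integrable_EFinZl measurableT
  (normal_peak s * (1 + 4 * s ^+ 2)) (integrable_gauss s22).
have /integrableP[_] := ig; apply: le_lt_trans.
apply: ge0_le_integral => //.
- by move=> x _; rewrite mule_ge0// lee_fin normal_pdf_ge0.
- by apply: emeasurable_funM; [exact: measurableT_comp|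
    apply/measurable_EFinP; exact: measurable_normal_pdf].
- by apply: measurableT_comp => //; have /integrableP[] := ig.
- move=> w _; rewrite /= -EFinM lee_fin normal_pdf_gauss//.
  apply: le_trans (ler_norm _); rewrite mulrCA -mulrA ler_wpM2l ?normal_peak_ge0//.
  exact: normM_gauss_le.
Qed.

End gaussian_fourier_consequences.

(** * The normal distribution function as a sine integral *)

Section sine_kernel.
Context {R : realType}.
Local Notation mu := (@lebesgue_measure R).
Let v1 : 0 < 1 :> R := ltr01.

Let moy : measurable (`]0, +oo[%classic : set (measurableTypeR R)).
Proof. exact: measurable_itv. Qed.

Definition sinint_fun (x r : R) : R := sin (r * x) / r * gauss 1 r.

(* [sinint x = \int_0^x e^{-t^2/2} dt / sqrt (2 pi)]; hence [1/2 + sinint] is the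
   standard normal distribution function. *)
Definition sinint (x : R) : R := pi^-1 * \int[mu]_(r in `]0, +oo[) sinint_fun x r.

Definition half_gauss : R := \int[mu]_(r in `[0, +oo[) gauss 1 r.

Lemma integrable_gauss_oy : mu.-integrable `]0, +oo[ (EFin \o gauss (1 : R)).
Proof. by apply: integrableS (integrable_gauss v1). Qed.

(** By symmetry [half_gauss] is half the normalising mass of the normal density. This value is what
    makes [sinint] tend to 1/2. *)
Lemma half_gauss_sqr : half_gauss ^+ 2 = pi / 2.
Proof.
have hE : half_gauss = Num.sqrt (pi / 2).
  rewrite /half_gauss.
  have := ge0_symfun_integralT (fun x : R => gauss_ge0 1 x) (@continuous_gauss R 1)
    (fun x : R => esym (gaussN 1 x)).
  rewrite -set_itvcy.
  have := integral_normal_pdf (0 : R) 1.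
  under eq_integral do rewrite normal_pdf_gauss ?oner_eq0// expr1n EFinM.
  rewrite integralZl//; last exact: integrable_gauss.
  have fin : (\int[mu]_(x in `[0%R, +oo[) (gauss 1 x)%:E)%E \is a fin_num.
    by apply: integrable_fin_num => //; apply: integrableS (integrable_gauss v1).
  move=> + E; rewrite E -(fineK fin) -/(Rintegral mu `[0, +oo[ (gauss 1)) -!EFinM => -[].
  rewrite /normal_peak expr1n mul1r.
  set J := \int[mu]_(x in _) _; move=> JE.
  have p0 : 0 < Num.sqrt (pi *+ 2 : R) by rewrite sqrtr_gt0 pmulrn_lgt0// pi_gt0.
  have -> : J = Num.sqrt (pi *+ 2) / 2.
    move: p0 JE; set q := Num.sqrt _ => p0 /(congr1 (fun z => z * q / 2)).
    by rewrite mul1r => <-; field; rewrite gt_eqF.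
  rewrite -[pi *+ 2]mulr_natr (_ : pi * 2 = pi / 2 * 4); last by field.
  rewrite sqrtrM ?divr_ge0 ?pi_ge0// (_ : 4 = 2 ^+ 2); last by ring.
  by rewrite sqrtr_sqr ger0_norm// mulfK.
by rewrite hE sqr_sqrtr// divr_ge0 ?pi_ge0.
Qed.

Lemma measurable_sinint_fun x : measurable_fun (`]0, +oo[%classic : set R) (sinint_fun x).
Proof.
apply: open_continuous_measurable_fun; first exact: interval_open.
move=> r; rewrite inE/= in_itv/= andbT => r0.
apply: cvgM; last exact: continuous_gauss.
apply: cvgM; last by apply: cvgV; [rewrite gt_eqF|exact: cvg_id].
apply: continuous_comp; last exact: continuous_sin.
by apply: cvgMr_tmp; exact: cvg_id.
Qed.

Lemma sin_le_norm (x : R) : `|sin x| <= `|x|.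
Proof.
wlog x0 : x / 0 <= x => [wlg|].
  have [|x0] := leP 0 x; first exact: wlg.
  by rewrite -(normrN (sin x)) -sinN -(normrN x) wlg// oppr_ge0 ltW.
have [c _] := @MVT_segment _ sin cos 0 x x0 (fun x _ => is_derive_sin x)
  (continuous_subspaceT (@continuous_sin R)).
rewrite sin0 !subr0 => ->; rewrite normrM ler_piMl//.
by rewrite ler_norml cos_geN1 cos_le1.
Qed.

Lemma sinint_fun_bound x r : `|sinint_fun x r| <= `|x| * gauss 1 r.
Proof.
rewrite /sinint_fun normrM (ger0_norm (gauss_ge0 _ _)) ler_wpM2r ?gauss_ge0//.
have [->|r0] := eqVneq r 0; first by rewrite invr0 mulr0 normr0.
rewrite normrM normfV ler_pdivrMr ?normr_gt0//.
by rewrite (le_trans (sin_le_norm _))// normrM mulrC.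
Qed.

Lemma integrable_sinint_fun x : mu.-integrable `]0, +oo[ (EFin \o sinint_fun x).
Proof.
have ig := integrable_EFinZl moy `|x| integrable_gauss_oy.
apply: (dominated_integrable_EFin moy _ ig) => //.
  exact: measurable_sinint_fun.
by move=> r _; exact: sinint_fun_bound.
Qed.

(** Differentiating in [x] cancels the division by [r] and leaves the Gaussian cosine transform on
    the half-line. Negative arguments are reached through oddness. *)
Lemma is_derive_sinint (x : R) : 0 <= x ->
  is_derive x 1 sinint (pi^-1 * (half_gauss * gauss 1 x)).
Proof.
move=> x0.
have tI : `]x - 1, x + 1[%classic x by rewrite /= in_itv/=; lra.
have dE (z r : R) : 0 < r -> is_derive z 1 (sinint_fun ^~ r) (cos (r * z) * gauss 1 r).
  move=> r0; rewrite /sinint_fun; apply: is_derive_eq.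
  rewrite ?scaler1 /= ?scale0r ?scaler0 ?add0r ?addr0 /GRing.scale/=.
  by field; rewrite gt_eqF.
have h1 z : `]x - 1, x + 1[%classic z -> mu.-integrable `]0, +oo[ (EFin \o sinint_fun z).
  by move=> _; exact: integrable_sinint_fun.
have h2 z r : `]x - 1, x + 1[%classic z -> `]0, +oo[%classic r -> derivable (sinint_fun ^~ r) z 1.
  by move=> _ /=; rewrite in_itv/= andbT => r0; apply: ex_derive; exact: dE.
have d1E z r : 0 < r -> partial1of2 sinint_fun z r = cos (r * z) * gauss 1 r.
  by move=> r0; rewrite partial1of2E; apply: derive_val; exact: dE.
have h4 z r : `]x - 1, x + 1[%classic z -> `]0, +oo[%classic r ->
    `|partial1of2 sinint_fun z r| <= gauss 1 r.
  move=> _ /=; rewrite in_itv/= andbT => r0; rewrite d1E// normrM (ger0_norm (gauss_ge0 _ _)).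
  by rewrite ler_piMl ?gauss_ge0// ler_norml cos_geN1 cos_le1.
have dI := @derivable_under_integral _ _ _ mu sinint_fun `]0, +oo[ (measurable_itv _) x
  (x - 1) (x + 1) tI h1 h2 (gauss 1) (gauss_ge0 1) integrable_gauss_oy h4.
have DI := @differentiation_under_integral _ _ _ mu sinint_fun `]0, +oo[ (measurable_itv _) x
  (x - 1) (x + 1) tI h1 h2 (gauss 1) (gauss_ge0 1) integrable_gauss_oy h4.
have dJ : is_derive x 1 (fun x => \int[mu]_(r in `]0, +oo[) sinint_fun x r)
    (half_gauss * gauss 1 x).
  apply: DeriveDef; first exact: dI.
  rewrite -derive1E DI.
  transitivity (\int[mu]_(r in `]0, +oo[) (cos (x * r) * gauss 1 r)).
    apply: eq_Rintegral => r; rewrite inE/= in_itv/= andbT => r0.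
    by rewrite d1E// (mulrC r).
  rewrite Rintegral_itv_obnd_cbnd; last first.
    apply: (dominated_integrable_EFin moy _ integrable_gauss_oy).
      apply: measurable_funTS; apply: measurable_funM; last exact: measurable_gauss.
      by apply: measurableT_comp; [exact: measurable_cos|exact: measurable_funM].
    move=> r _; rewrite normrM (ger0_norm (gauss_ge0 _ _)).
    by rewrite ler_piMl ?gauss_ge0// ler_norml cos_geN1 cos_le1.
  rewrite Rintegral_gauss_cos0y// mulrC; congr (_ * _).
  by rewrite /gauss mul1r mulr1.
rewrite /sinint; apply: is_derive_eq.
by rewrite /GRing.scale/= ?mul0r ?mulr0 ?addr0 ?add0r.
Qed.

Lemma sinintN x : sinint (- x) = - sinint x.
Proof.
rewrite /sinint -mulrN; congr (_ * _).
rewrite -mulN1r -RintegralZl//; last exact: integrable_sinint_fun.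
by apply: eq_Rintegral => r _; rewrite /sinint_fun mulrN sinN mulN1r !mulNr.
Qed.

Lemma sinint0 : sinint 0 = 0.
Proof.
rewrite /sinint (@eq_Rintegral _ _ _ mu _ (cst 0)) ?Rintegral_cst ?mul0r ?mulr0//.
by move=> r _; rewrite /sinint_fun mulr0 sin0 !mul0r.
Qed.

Lemma half_gauss_ge0 : 0 <= half_gauss.
Proof. by apply: Rintegral_ge0 => r _; exact: gauss_ge0. Qed.

Lemma sinint_homo x y : 0 <= x -> x <= y -> sinint x <= sinint y.
Proof.
move=> x0 xy; rewrite -subr_ge0.
have dS z : z \in `]x, y[ -> is_derive z 1 sinint (pi^-1 * (half_gauss * gauss 1 z)).
  by rewrite in_itv/= => /andP[xz _]; apply: is_derive_sinint; rewrite (le_trans x0)// ltW.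
have cS : {within `[x, y], continuous sinint}.
  apply: derivable_within_continuous => z; rewrite in_itv/= => /andP[xz _].
  by apply: ex_derive; apply: is_derive_sinint; rewrite (le_trans x0).
have [z _ ->] := MVT_segment xy dS cS.
by rewrite !mulr_ge0 ?invr_ge0 ?pi_ge0 ?half_gauss_ge0 ?gauss_ge0 ?subr_ge0.
Qed.

Lemma sinintE x : 0 < x ->
  sinint x = pi^-1 * half_gauss * \int[mu]_(t in `[0, x]) gauss 1 t.
Proof.
move=> x0.
have dS z : 0 <= z -> derivable sinint z 1.
  by move=> z0; apply: ex_derive; exact: is_derive_sinint.
have cS z : 0 <= z -> {for z, continuous sinint}.
  by move=> z0; apply: differentiable_continuous; exact/derivable1_diffP/dS.
rewrite -RintegralZl//; last by apply: integrable_itv_continuous; exact: continuous_gauss.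
rewrite /Rintegral (@continuous_FTC2 _ _ sinint)//.
- by rewrite sinint0 sube0.
- by apply: continuous_subspaceT => z; apply: cvgMl_tmp; exact: continuous_gauss.
- split.
  + by move=> z; rewrite in_itv/= => /andP[z0 _]; apply: dS; exact: ltW.
  + by apply: cvg_at_right_filter; exact: cS.
  + by apply: cvg_at_left_filter; apply: cS; exact: ltW.
- move=> z; rewrite in_itv/= => /andP[z0 _]; rewrite derive1E -mulrA.
  by apply: derive_val; apply: is_derive_sinint; exact: ltW.
Qed.

Lemma cvg_sinintS : sinint n.+1%:R @[n --> \oo] --> (2^-1 : R).
Proof.
under eq_fun do rewrite sinintE ?ltr0n//.
have -> : 2^-1 = pi^-1 * half_gauss * half_gauss :> R.
  by rewrite -mulrA -expr2 half_gauss_sqr mulKf// gt_eqF// pi_gt0.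
apply: cvgMl_tmp.
apply: (cvg_Rintegral_bigcup (mu := mu) (D := `[0%R, +oo[%classic)) => //.
- by move=> n x /=; rewrite !in_itv/= => /andP[->].
- move=> x /=; rewrite in_itv/= andbT => x0; near=> n; rewrite in_itv/= x0/=.
  rewrite (@le_trans _ _ n%:R) ?ler_nat//.
  by near: n; exact: nbhs_infty_ger.
- by apply: integrableS (integrable_gauss v1).
Unshelve. all: by end_near. Qed.

Lemma sinint_ge0 x : 0 <= x -> 0 <= sinint x.
Proof. by move=> x0; rewrite -sinint0 sinint_homo. Qed.

Lemma sinint_le x : sinint x <= 2^-1.
Proof.
have [x0|x0] := leP 0 x; last first.
  rewrite (@le_trans _ _ 0)// -oppr_ge0 -sinintN sinint_ge0// oppr_ge0 ltW//.
apply: (cvgr_to_ge cvg_sinintS).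
near=> n; apply: sinint_homo => //.
rewrite (@le_trans _ _ n%:R) ?ler_nat//.
by near: n; exact: nbhs_infty_ger.
Unshelve. all: by end_near. Qed.

Lemma sinint_geN x : - 2^-1 <= sinint x.
Proof. by rewrite lerNl -sinintN sinint_le. Qed.

Lemma sinint_near_half (e : R) : 0 < e -> exists2 y, 0 < y & forall x, y <= x -> 2^-1 - e <= sinint x.
Proof.
move=> e0.
have /cvgrPdist_le /(_ e e0) [n _ /(_ n (leqnn n)) /= h] := cvg_sinintS.
exists n.+1%:R; first by rewrite ltr0n.
move=> x nx; apply: le_trans (sinint_homo _ nx); last by rewrite ler0n.
by move: h; rewrite ler_norml => /andP[_]; lra.
Qed.

End sine_kernel.

(** * Conditioning on an independent family *)

Section freezing.
Context d (T : measurableType d) (R : realType) (P : probability T R).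
Context d1 d2 (T1 : measurableType d1) (T2 : measurableType d2).

(** Independence makes the joint law of [(X, Y)] the product of the two laws; the claim is then
    Fubini's theorem. *)
Lemma freezing (X : {RV P >-> T1}) (Y : {RV P >-> T2}) (f : T1 * T2 -> R) (M : R) :
  (forall A B, measurable A -> measurable B ->
     P (X @^-1` A `&` Y @^-1` B) = (P (X @^-1` A) * P (Y @^-1` B))%E) ->
  measurable_fun setT f -> (forall z, `|f z| <= M) ->
  \int[P]_w f (X w, Y w) = \int[P]_w \int[distribution P Y]_y f (X w, y).
Proof.
move=> indep mf fM.
have mXY : measurable_fun setT (fun w => (X w, Y w)) by exact: measurable_fun_pair.
pose XY : {RV P >-> (T1 * T2)%type} := mfun_Sub (mem_set mXY).
have XYE A : measurable A ->
    (product_measure1 (distribution P X) (distribution P Y)) A = distribution P XY A.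
  apply: product_measure_unique => A1 A2 mA1 mA2.
  by rewrite -indep.
have intXY : (product_measure1 (distribution P X) (distribution P Y)).-integrable setT (EFin \o f).
  apply: measurable_bounded_integrable => //.
    apply: le_lt_trans (ltry 1); rewrite [leLHS]XYE//.
    exact: probability_le1.
  exists M; split; first exact: num_real.
  by move=> x Mx z _ /=; exact: le_trans (fM z) (ltW Mx).
congr fine.
transitivity (\int[distribution P XY]_z (f z)%:E)%E.
  rewrite integral_distribution//; first exact/measurable_EFinP.
  apply: (@bounded_integrable _ _ _ P _ M) => //; exact: measurableT_comp.
transitivity (\int[product_measure1 (distribution P X) (distribution P Y)]_z (f z)%:E)%E.
  by apply: eq_measure_integral => A mA _; exact/esym/XYE.
rewrite -(integral12_prod_meas1 intXY).
have intF := integrable_fubini_F intXY.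
rewrite integral_distribution//; first last.
- have := intF; rewrite /fubini_F => /integrableP[mF Foo].
  apply/integrableP; split; first exact: measurableT_comp.
  rewrite -(@ge0_integral_distribution _ _ _ _ _ P X (fun y => `|\int[distribution P Y]_y0 (f (y, y0))%:E|%E))//.
  exact: measurableT_comp.
- by have /integrableP[] := intF.
apply: eq_integral => w _ /=; rewrite /Rintegral fineK//.
apply: integrable_fin_num => //.
apply: (@bounded_integrable _ _ _ (distribution P Y) _ M) => //.
exact: measurableT_comp.
Qed.

End freezing.

Section past.
Context d (T : measurableType d) (R : realType) (P : probability T R).
Context d' (E : measurableType d') (Y : nat -> {RV P >-> E}).
Variable A0 : set_system T.
Hypothesis mA0 : A0 `<=` measurable.
Hypothesis A0T : A0 setT.
Hypothesis A0I : setI_closed A0.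
Hypothesis indepY : forall n A (B : nat -> set E), A0 A ->
  (forall i, measurable (B i)) ->
  P (A `&` \bigcap_(i in `I_n) (Y i @^-1` B i)) =
  (P A * \prod_(0 <= i < n) P (Y i @^-1` B i))%E.

(** A pi-system for the events known from [A0] and the [Y i] with [i < n]. Turning the sigma-algebra
    it generates into the measurable type [past n] makes the usual measurability lemmas available
    for functions of the past. *)
Definition cylinder n : set_system T := [set C | exists A (B : nat -> set E),
  [/\ A0 A, forall i, measurable (B i) &
      C = A `&` \bigcap_(i in `I_n) (Y i @^-1` B i)]].

Definition past n := g_sigma_algebraType (cylinder n).

Lemma measurable_cylinder n : cylinder n `<=` measurable.
Proof.
move=> _ [A [B [AA mB ->]]]; apply: measurableI; first exact: mA0.
apply: bigcap_measurableType => i _.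
by rewrite -[X in measurable X]setTI; exact: measurable_funP.
Qed.

Lemma cylinder_setI n : setI_closed (cylinder n).
Proof.
move=> _ _ [A [B [AA mB ->]]] [A' [B' [AA' mB' ->]]].
exists (A `&` A'), (fun i => B i `&` B' i); split.
- exact: A0I.
- by move=> i; exact: measurableI.
rewrite setIACA -bigcapI; congr (_ `&` _).
Qed.

(** As functions of [C], the two sides are finite measures that agree on a pi-system, hence on the
    generated sigma-algebra. *)
Lemma indep_past n C B : <<s cylinder n >> C -> measurable B ->
  P (C `&` Y n @^-1` B) = (P C * P (Y n @^-1` B))%E.
Proof.
move=> sC mB.
have mYB : measurable (Y n @^-1` B).
  by rewrite -[X in measurable X]setTI; exact: measurable_funP.
have fP : P (Y n @^-1` B) \is a fin_num by exact: fin_num_measure.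
have p0 : 0 <= fine (P (Y n @^-1` B)) by exact: fine_ge0.
rewrite muleC -(fineK fP).
pose p : {nonneg R} := NngNum p0.
rewrite -[LHS]/(mrestr P mYB C) -[RHS]/(mscale p P C).
apply: (g_sigma_algebra_measure_unique (cylinder n) _ (fun=> setT)) => //.
- exact: measurable_cylinder.
- move=> i; exists setT, (fun=> setT); split => //.
  by rewrite setTI; apply/esym; rewrite -subTset => t _ i' _.
- by apply/seteqP; split => // t _; exists 0%N.
- exact: cylinder_setI.
- move=> _ [A [B' [AA mB' ->]]].
  change (P ((A `&` \bigcap_(i in `I_n) (Y i @^-1` B' i)) `&` Y n @^-1` B) =
    (fine (P (Y n @^-1` B)))%:E * P (A `&` \bigcap_(i in `I_n) (Y i @^-1` B' i)))%E.
  rewrite fineK// -setIA.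
  (* The event on [Y n] becomes the coordinate of index [n] of a longer cylinder, to which the
     assumed product formula applies. *)
  rewrite -[X in P (_ `&` X)](_ : \bigcap_(i in `I_n.+1)
      (Y i @^-1` (if (i < n)%N then B' i else B)) = _); last first.
    apply/seteqP; split => t.
      move=> h; split; last by have := h n; rewrite /= ltnn; apply.
      by move=> i /= ilt; have := h i; rewrite /= ilt; apply; exact: ltnW.
    move=> [h1 h2] i /=; rewrite ltnS leq_eqVlt => /predU1P[->|ilt].
      by rewrite ltnn.
    by rewrite ilt; exact: h1.
  rewrite (indepY _ AA (B := fun i => if (i < n)%N then B' i else B)); last first.
    by move=> i; case: ifPn.
  rewrite (indepY _ AA mB') big_nat_recr//= ltnn muleA muleC; congr (_ * (_ * _))%E.
  by apply: eq_big_nat => i /andP[_ ->].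
- move=> i; change (P (setT `&` Y n @^-1` B) < +oo)%E; apply: le_lt_trans (probability_le1 _ _) (ltry 1).
  exact: measurableI.
Qed.

Lemma past_base n A : A0 A -> measurable (A : set (past n)).
Proof.
move=> AA; apply: sub_sigma_algebra; exists A, (fun=> setT); split => //.
by rewrite [X in _ `&` X](_ : _ = setT) ?setIT//; apply/seteqP; split.
Qed.

Lemma measurable_past n i : (i < n)%N ->
  measurable_fun [set: past n] (Y i : past n -> E).
Proof.
move=> ilt _ B mB; rewrite setTI; apply: sub_sigma_algebra.
exists setT, (fun j => if j == i then B else setT); split => //.
  by move=> j; case: ifPn.
rewrite setTI; apply/seteqP; split => t /=.
  by move=> YB j /= jn; case: ifPn => // /eqP ->.
by move=> /(_ i ilt); rewrite eqxx.
Qed.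

Lemma past_measurable n d1 (T1 : measurableType d1) (X : T -> T1) :
  measurable_fun [set: past n] (X : past n -> T1) -> measurable_fun [set: T] X.
Proof.
move=> mX _ B mB; have := mX measurableT B mB; rewrite !setTI.
apply: smallest_sub; first exact: sigma_algebra_measurable.
exact: measurable_cylinder.
Qed.

Lemma freezing_past n d1 (T1 : measurableType d1) (X : T -> T1)
    (f : T1 * E -> R) (M : R) :
  measurable_fun [set: past n] (X : past n -> T1) ->
  measurable_fun setT f -> (forall z, `|f z| <= M) ->
  \int[P]_w f (X w, Y n w) = \int[P]_w \int[distribution P (Y n)]_y f (X w, y).
Proof.
move=> mX mf fM.
pose X' : {RV P >-> T1} := mfun_Sub (mem_set (past_measurable mX)).
apply: (@freezing _ _ _ _ _ _ _ _ X' (Y n) f M) => // A B mA mB.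
apply: indep_past => //.
by have := mX measurableT A mA; rewrite setTI.
Qed.

End past.

Section mutual_independence_nat.
Context d (T : measurableType d) (R : realType) (P : probability T R).
Context d' (E : measurableType d').

Lemma mutual_independence_nat (Y : nat -> T -> E) n (B : nat -> set E) :
  mutual_independence P Y -> (forall i, measurable (B i)) ->
  P (\bigcap_(i in `I_n) (Y i @^-1` B i)) = (\prod_(0 <= i < n) P (Y i @^-1` B i))%E.
Proof.
move=> /(_ [fset i | i in iota 0 n]%fset B) + mB => /(_ mB).
rewrite (_ : [set` _] = `I_n); last first.
  by apply/seteqP; split => i /=; rewrite !inE mem_iota.
move=> ->; apply: perm_big; apply: uniq_perm => //; first exact: iota_uniq.
by move=> i; rewrite !inE mem_index_iota mem_iota.
Qed.

End mutual_independence_nat.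

Lemma mulr_norm_le1 (R : realDomainType) (x y : R) :
  `|x| <= 1 -> `|y| <= 1 -> `|x * y| <= 1.
Proof. by move=> x1 y1; rewrite normrM mulr_ile1. Qed.

Section clamp.
Context {R : realType}.

Definition clamp (z : R) : R := Order.max (-1) (Order.min z 1).

Lemma clamp_norm z : `|clamp z| <= 1.
Proof. by rewrite ler_norml le_max lexx/= ge_max ge_min lexx orbT andbT; lra. Qed.

Lemma clamp_id z : `|z| <= 1 -> clamp z = z.
Proof.
by rewrite ler_norml /clamp => /andP[z1 z2]; rewrite min_l ?max_r.
Qed.

Lemma measurable_clamp : measurable_fun setT clamp.
Proof. by apply: measurable_maxr => //; exact: measurable_minr. Qed.

End clamp.

Section expectation_prod.
Context d (T : measurableType d) (R : realType) (P : probability T R).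
Context d' (E : measurableType d').

Lemma Rintegral_prod_indep (Y : nat -> {RV P >-> E}) (f : nat -> E -> R) n :
  mutual_independence P (fun i => Y i : T -> E) ->
  (forall i, measurable_fun setT (f i)) -> (forall i y, `|f i y| <= 1) ->
  \int[P]_w (\prod_(0 <= i < n) f i (Y i w)) =
  \prod_(0 <= i < n) \int[P]_w f i (Y i w).
Proof.
move=> indepY mf f1.
(* With a trivial base, the past is generated by the earlier [Y i] alone. *)
pose A0 : set_system T := [set setT].
have mA0 : A0 `<=` measurable by move=> _ ->.
have A0I : setI_closed A0 by move=> _ _ -> ->; rewrite setTI.
have indep m (A : set T) (B : nat -> set E) : A0 A -> (forall i, measurable (B i)) ->
    P (A `&` \bigcap_(i in `I_m) (Y i @^-1` B i)) =
    (P A * \prod_(0 <= i < m) P (Y i @^-1` B i))%E.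
  move=> -> mB; rewrite setTI probability_setT mul1e.
  exact: (mutual_independence_nat m indepY).
elim: n => [|n IHn].
  by rewrite big_geq//; under eq_Rintegral do rewrite big_geq//;
    rewrite /Rintegral integral_cst//= -[RHS]/(fine 1%E); congr fine; rewrite mul1e; exact: probability_setT.
rewrite big_nat_recr//= -IHn.
pose X w := \prod_(0 <= i < n) f i (Y i w).
have mX : measurable_fun [set: past Y A0 n] (X : past Y A0 n -> R).
  rewrite /X; apply: measurable_prod => i.
  rewrite mem_index_iota => /andP[_ ilt].
  apply: (measurableT_comp (mf i)); exact: measurable_past.
have X1 w : `|X w| <= 1.
  rewrite /X; elim/big_ind : _ => //; first by rewrite normr1.
  exact: mulr_norm_le1.
pose g (z : R * E) := clamp z.1 * f n z.2.
have mg : measurable_fun setT g.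
  apply: measurable_funM.
    by apply: (measurableT_comp measurable_clamp).
  exact: measurableT_comp (mf n) _.
have g1 z : `|g z| <= 1 by apply: mulr_norm_le1 => //; exact: clamp_norm.
have gE w y : g (X w, y) = X w * f n y by rewrite /g/= clamp_id.
transitivity (\int[P]_w g (X w, Y n w)).
  by apply: eq_Rintegral => w _; rewrite gE big_nat_recr.
rewrite (freezing_past mA0 _ A0I indep mX mg g1)//.
under eq_Rintegral.
  move=> w _; under eq_Rintegral do rewrite gE.
  rewrite RintegralZl//; last first.
    apply: (@bounded_integrable _ _ _ _ _ 1) => //.
  over.
rewrite RintegralZr//; last first.
  apply: (@bounded_integrable _ _ _ _ _ 1) => //.
  exact: past_measurable mX.
congr (_ * _); congr fine.
rewrite integral_distribution//; first exact/measurable_EFinP.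
apply: (@bounded_integrable _ _ _ _ _ 1) => //.
exact: measurableT_comp.
Qed.

End expectation_prod.

(** * Poisson generating function and conditionally Gaussian sums *)

Section poisson_pgf.
Context d (T : measurableType d) (R : realType) (P : probability T R).

Lemma sum_poisson_pmf (rate : R) : 0 < rate ->
  (\sum_(k <oo) (poisson_pmf rate k)%:E = 1)%E.
Proof.
move=> rate0.
have /= <- := @probability_setT _ _ _ (poisson_prob rate 0%N).
rewrite /poisson_prob rate0 nneseries_esumT// => n.
by rewrite lee_fin poisson_pmf_ge0.
Qed.

(** Multiplying the Poisson weights by q^k gives, up to the constant on the right, the Poisson
    weights of parameter [rate * q], whose sum is 1. *)
Lemma poisson_pgf (K : {RV P >-> nat}) (rate q : R) : 0 < rate -> 0 < q ->
  (forall k, P [set w | K w = k] = (poisson_pmf rate k)%:E) ->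
  \int[P]_w (q ^+ K w) = expR (- (rate * (1 - q))).
Proof.
move=> rate0 q0 PK; have rq0 : 0 < rate * q by rewrite mulr_gt0.
have f0 k : (0 <= (q ^+ k)%:E)%E by rewrite lee_fin exprn_ge0// ltW.
rewrite /Rintegral -[RHS]/(fine (expR _)%:E); congr fine.
rewrite -(@ge0_integral_distribution _ _ _ _ _ P K (fun k => (q ^+ k)%:E))//.
have {1}<- : \bigcup_k [set k] = [set: nat].
  by apply/seteqP; split => // k _; exists k.
rewrite ge0_integral_bigcup//; last by move=> i j _ _ [x [/= -> ->]].
transitivity (\sum_(k <oo) ((expR (- (rate * (1 - q))))%:E *
    (poisson_pmf (rate * q) k)%:E))%E.
  apply: eq_eseriesr => k _.
  rewrite (eq_integral (fun=> (q ^+ k)%:E)); last by move=> i /set_mem /= ->.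
  rewrite integral_cst//= [X in (_ * X)%E](PK k) -!EFinM; congr EFin.
  rewrite /poisson_pmf rate0 rq0 exprMn.
  rewrite (_ : - rate = - (rate * (1 - q)) + - (rate * q)); last by ring.
  by rewrite expRD; ring.
rewrite nneseriesZl; last by move=> k _; rewrite lee_fin poisson_pmf_ge0.
by rewrite sum_poisson_pmf// mule1.
Qed.

End poisson_pgf.

Section family_sigma_algebra.
Context d (T : measurableType d) (R : realType) (P : probability T R).
Context d' (E : measurableType d') (X : nat -> {RV P >-> E}).

Let F := family_sigma_algebra (fun j => X j : T -> E).

(** Reading the family as the measurable sets of a measurable type gives access to its closure
    properties. *)
Lemma family_sigma_algebraE :
  F = measurable :> set (set (g_sigma_algebraType
    (\bigcup_i preimage_set_system setT (X i : T -> E) measurable))).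
Proof. by []. Qed.

Lemma family_sigma_algebra_measurable : F `<=` measurable.
Proof.
apply: smallest_sub; first exact: sigma_algebra_measurable.
move=> _ [i _ [B mB <-]].
exact: measurable_funP.
Qed.

Lemma family_sigma_algebra_preimage i B : measurable B -> F (X i @^-1` B).
Proof. by move=> mB; apply: sub_sigma_algebra; exists i => //; exists B => //; rewrite setTI. Qed.

Lemma family_sigma_algebra_bigcap n (B : nat -> set E) :
  (forall i, measurable (B i)) -> F (\bigcap_(i in `I_n) (X i @^-1` B i)).
Proof.
move=> mB; rewrite family_sigma_algebraE.
apply: bigcap_measurableType => i _.
by rewrite -family_sigma_algebraE; exact: family_sigma_algebra_preimage.
Qed.

End family_sigma_algebra.

Section conditionally_gaussian_sum.
Context d (T : measurableType d) (R : realType) (P : probability T R).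
Variables (Gam W : nat -> {RV P >-> R}) (sigma : R) (h : R -> R).
Hypothesis sigma0 : sigma != 0.
Hypothesis Wlaw : forall j, distribution P (W j) = normal_prob 0 sigma.
Hypothesis Wind : mutual_independence P (fun j => W j : T -> R).
Hypothesis WGam : independent_families P (fun j => Gam j : T -> R) (fun j => W j : T -> R).
Hypothesis mh : measurable_fun setT h.

Let G0 := \bigcup_i preimage_set_system setT (Gam i : T -> R) measurable.
(** The base contains every event determined by the [Gam j], so freezing along [past W A0 n] amounts
    to conditioning on all arrival times and the earlier weights. *)
Let A0 : set_system T := family_sigma_algebra (fun j => Gam j : T -> R).

Definition gsum n (w : T) : R := \sum_(0 <= j < n) W j w * h (Gam j w).
(** Up to the factor [sigma ^+ 2], the variance of [gsum n] given the [Gam j]. *)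
Definition gvar n (w : T) : R := \sum_(0 <= j < n) h (Gam j w) ^+ 2.

Let mA0 : A0 `<=` measurable.
Proof. exact: family_sigma_algebra_measurable. Qed.

Let A0T : A0 setT.
Proof. by rewrite /A0 family_sigma_algebraE. Qed.

Let A0I : setI_closed A0.
Proof. by move=> A B; rewrite /A0 family_sigma_algebraE; exact: measurableI. Qed.

Let indep n A (B : nat -> set R) : A0 A -> (forall i, measurable (B i)) ->
  P (A `&` \bigcap_(i in `I_n) (W i @^-1` B i)) =
  (P A * \prod_(0 <= i < n) P (W i @^-1` B i))%E.
Proof.
move=> AA mB; rewrite WGam//; last exact: family_sigma_algebra_bigcap.
by congr (_ * _)%E; exact: mutual_independence_nat.
Qed.

Let measurable_weight n (Z : T -> R) :
  measurable_fun [set: g_sigma_algebraType G0] Z ->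
  measurable_fun [set: past W A0 n] (Z : past W A0 n -> R).
Proof.
move=> mZ _ B mB; have := mZ measurableT B mB; rewrite !setTI => ZB.
exact: past_base.
Qed.

Let measurable_Gam j : measurable_fun [set: g_sigma_algebraType G0]
  (Gam j : g_sigma_algebraType G0 -> R).
Proof.
by move=> _ B mB; rewrite setTI; apply: sub_sigma_algebra; exists j => //; exists B => //; rewrite setTI.
Qed.

Let measurable_gsum_past n : measurable_fun [set: past W A0 n]
  (gsum n : past W A0 n -> R).
Proof.
rewrite (_ : gsum n = fun w => \sum_(j < n) W j w * h (Gam j w)); last first.
  by apply/funext => w; rewrite /gsum big_mkord.
apply: measurable_sum => j.
apply: measurable_funM; first exact: measurable_past.
by apply: measurable_weight; exact: (measurableT_comp mh).
Qed.

Lemma measurable_gsum n : measurable_fun setT (gsum n).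
Proof. exact: past_measurable (@measurable_gsum_past n). Qed.

Lemma measurable_gvar n : measurable_fun setT (gvar n).
Proof.
apply: measurable_sum => j; apply: measurable_funX.
by apply: (measurableT_comp mh).
Qed.

Lemma gvar_ge0 n w : 0 <= gvar n w.
Proof. by apply: sumr_ge0 => j _; rewrite sqr_ge0. Qed.

(** The weight [Z] carries the induction: integrating out [W n] leaves a Gaussian factor in [Gam n],
    which is absorbed into a new weight that is again a function of the [Gam j] bounded by 1. *)
Lemma Rintegral_sin_gsum_weight (n : nat) (Z : T -> R) (y u : R) :
  measurable_fun [set: g_sigma_algebraType G0] Z -> (forall w, `|Z w| <= 1) ->
  \int[P]_w (sin (y - u * gsum n w) * Z w) =
  \int[P]_w (sin y * expR (- (u * sigma) ^+ 2 / 2 * gvar n w) * Z w).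
Proof.
elim: n Z => [|n IHn] Z mZ Z1.
  apply: eq_Rintegral => w _.
  by rewrite /gsum /gvar !big_geq// !mulr0 subr0 expR0 mulr1.
(* All three components are measurable for the past: they involve the [Gam j] and only the [W j]
   with [j < n]. *)
pose X w := (y - u * gsum n w, (u * h (Gam n w), Z w)).
pose f (z : (R * (R * R)) * R) := sin (z.1.1 - z.1.2.1 * z.2) * clamp z.1.2.2.
have mX : measurable_fun [set: past W A0 n] (X : past W A0 n -> R * (R * R)).
  apply: measurable_fun_pair.
    by apply: measurable_funB => //; apply: measurable_funM.
  apply: measurable_fun_pair; last exact: measurable_weight.
  apply: measurable_funM => //.
  by apply: measurable_weight; exact: (measurableT_comp mh).
have mf : measurable_fun setT f.
  apply: measurable_funM.
    apply: measurableT_comp; first exact: measurable_sin.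
    apply: measurable_funB; first exact: measurableT_comp.
    apply: measurable_funM => //.
    by apply: measurableT_comp => //; exact: measurableT_comp.
  apply: (measurableT_comp measurable_clamp).
  by apply: measurableT_comp => //; exact: measurableT_comp.
have f1 z : `|f z| <= 1.
  apply: mulr_norm_le1; last exact: clamp_norm.
  by rewrite ler_norml sin_geN1 sin_le1.
have mZT := past_measurable mA0 (measurable_weight (n := n) mZ).
transitivity (\int[P]_w f (X w, W n w)).
  apply: eq_Rintegral => w _; rewrite /f/= clamp_id//; congr (sin _ * _).
  by rewrite /gsum big_nat_recr//=; ring.
rewrite (freezing_past mA0 A0T A0I indep mX mf f1).
pose Z' w := expR (- (u * h (Gam n w) * sigma) ^+ 2 / 2) * Z w.
have mZ' : measurable_fun [set: g_sigma_algebraType G0] Z'.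
  apply: measurable_funM => //; apply: measurableT_comp => //.
  apply: measurable_funM => //; apply: measurableT_comp => //.
  apply: measurable_funX; apply: measurable_funM => //.
  by apply: measurable_funM => //; exact: (measurableT_comp mh).
have Z'1 w : `|Z' w| <= 1.
  apply: mulr_norm_le1 => //; rewrite ger0_norm ?expR_ge0//.
  by rewrite -expR0 ler_expR mulNr oppr_le0 divr_ge0 ?sqr_ge0.
transitivity (\int[P]_w (sin (y - u * gsum n w) * Z' w)).
  apply: eq_Rintegral => w _; rewrite /f/= clamp_id//.
  have mS : measurable_fun setT (fun v => sin (y - u * gsum n w - u * h (Gam n w) * v)).
    apply: measurableT_comp; first exact: measurable_sin.
    by apply: measurable_funB => //; exact: measurable_funM.
  have S1 v : `|sin (y - u * gsum n w - u * h (Gam n w) * v)| <= 1.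
    by rewrite ler_norml sin_geN1 sin_le1.
  have mSE := iffRL (measurable_EFinP _ _) mS.
  have iS : P.-integrable setT
      ((fun v => (sin (y - u * gsum n w - u * h (Gam n w) * v))%:E) \o W n).
    apply: (@bounded_integrable _ _ _ P _ 1) => //.
    exact: (measurableT_comp mS).
  rewrite RintegralZr//; last exact: (@bounded_integrable _ _ _ (distribution P (W n)) _ 1).
  rewrite [X in X * _]/Rintegral integral_distribution//.
  rewrite /comp (integral_normal_law (Wlaw n) mSE)//.
  rewrite -/(Rintegral (normal_prob 0 sigma) setT (fun v => sin (y - u * gsum n w - u * h (Gam n w) * v))).
  by rewrite Rintegral_normal_sin// /Z' !mulrA.
rewrite IHn//; apply: eq_Rintegral => w _.
rewrite /Z' /gvar big_nat_recr//= -/(gvar n w) [in RHS]mulrDr expRD !mulrA.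
congr (_ * _ * expR _ * _); by field.
Qed.

Lemma Rintegral_sin_gsum (n : nat) (y u : R) :
  \int[P]_w sin (y - u * gsum n w) =
  sin y * \int[P]_w expR (- (u * sigma) ^+ 2 / 2 * gvar n w).
Proof.
have := @Rintegral_sin_gsum_weight n (cst 1) y u.
under eq_Rintegral do rewrite mulr1.
move=> ->//; last by move=> w; rewrite normr1.
under eq_Rintegral do rewrite mulr1.
rewrite RintegralZl//.
apply: (@bounded_integrable _ _ _ _ _ 1).
  apply: measurableT_comp => //; apply: measurable_funM => //.
  exact: measurable_gvar.
move=> w; rewrite ger0_norm ?expR_ge0// -expR0 ler_expR.
by rewrite mulr_le0_ge0 ?gvar_ge0// mulNr oppr_le0 divr_ge0 ?sqr_ge0.
Qed.

Lemma integrable_gsum n : (forall x, `|h x| <= 1) ->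
  P.-integrable setT (EFin \o gsum n).
Proof.
move=> h1; rewrite (_ : _ \o _ =
    fun w => (\sum_(0 <= j < n) (W j w * h (Gam j w))%:E)%E); last first.
  by apply/funext => w; rewrite sumEFin.
apply: integrable_sum => //= j _.
have intW : P.-integrable setT (EFin \o W j).
  have /integrableP[_ Wfin] := integrable_normal_id sigma0.
  apply/integrableP; split; first exact/measurable_EFinP.
  rewrite (ge0_integral_normal_law (Wlaw j) (f := fun y => `|y%:E|%E))//.
  by apply/measurableT_comp => //; exact/measurable_EFinP.
apply: (@le_integrable _ _ _ _ _ _ _ (EFin \o W j)) => //.
  apply/measurable_EFinP/measurable_funM => //.
  exact: (measurableT_comp mh).
move=> w _; rewrite /= lee_fin normrM ler_piMr//.
Qed.

End conditionally_gaussian_sum.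

(** * Poisson shot noise *)

Section counting_path.
Context {R : realType}.
Variable N : R -> nat.
Hypothesis N_homo : forall s t, 0 <= s -> s <= t -> (N s <= N t)%N.
Hypothesis N_rc : forall t, 0 <= t -> \forall s \near t^'+, N s = N t.

Definition arrival (j : nat) : R := inf [set t | 0 <= t /\ (j < N t)%N].

Let lb j : has_lbound [set t | 0 <= t /\ (j < N t)%N].
Proof. by exists 0 => t []. Qed.

Lemma arrival_le j t : 0 <= t -> (j < N t)%N -> arrival j <= t.
Proof. by move=> t0 jt; apply: ge_inf => //; split. Qed.

Lemma arrival_ge0 j : 0 <= arrival j.
Proof.
rewrite /arrival; have [->|/set0P S0] := eqVneq [set t | 0 <= t /\ (j < N t)%N] set0.
  by rewrite inf0.
by apply: lb_le_inf => // t [].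
Qed.

(** Right continuity makes the infimum a minimum: elements of the set lie arbitrarily close to it on
    the right, where [N] already has the value it takes at [arrival j]. *)
Lemma arrival_attained j t : 0 <= t -> (j < N t)%N -> (j < N (arrival j))%N.
Proof.
move=> t0 jt; have := N_rc (arrival_ge0 j).
rewrite /at_right /within /= => -[e /= e0 Ne].
have [s [s0 js] se] := inf_adherent e0
  (conj (ex_intro _ t (conj t0 jt)) (lb j) : has_inf [set t | 0 <= t /\ (j < N t)%N]).
have : arrival j <= s by exact: arrival_le.
rewrite le_eqVlt => /predU1P[->//|as_].
by rewrite -(Ne s)//= /ball/= ltr_distlC; apply/andP; split; lra.
Qed.

Lemma arrival_gt j s t : 0 <= s -> (N s <= j)%N -> 0 <= t -> (j < N t)%N -> s < arrival j.
Proof.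
move=> s0 Ns t0 jt; rewrite ltNge; apply/negP => /(N_homo (arrival_ge0 j)).
by rewrite leqNgt (leq_ltn_trans Ns)// (arrival_attained t0 jt).
Qed.

Lemma lt_arrival j c : 0 <= c -> c < arrival j -> (N c <= j)%N.
Proof.
move=> c0; rewrite leqNgt; apply: contraTN => jc.
by rewrite -leNgt arrival_le.
Qed.

Lemma arrival_lt j D : 0 < arrival j -> arrival j < D -> (j < N D)%N.
Proof.
move=> a0 aD.
(* An empty set would have the default infimum 0, which positivity of the arrival rules out. *)
have [t [t0 jt]] : exists t, 0 <= t /\ (j < N t)%N.
  apply/not_existsP => h; move: a0; rewrite /arrival.
  rewrite (_ : [set t | _] = set0) ?inf0 ?ltxx//.
  by apply/seteqP; split => // t /h.
apply: leq_trans (arrival_attained t0 jt) _.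
by apply: N_homo; [exact: ltW|exact: ltW].
Qed.

Variables (phi : R -> R) (c : R).
Hypothesis c0 : 0 <= c.
Hypothesis phi_ge0 : forall x, 0 <= phi x.
Hypothesis phi_noninc : forall x y, c <= x -> x <= y -> phi y <= phi x.

Definition window (D x : R) : R := if c < x < D then phi x else 0.

Lemma window_ge0 D x : 0 <= window D x.
Proof. by rewrite /window; case: ifP. Qed.

Lemma window_le D x : window D x <= phi x.
Proof. by rewrite /window; case: ifP. Qed.

Lemma window_arrival0 D j : (N D <= j)%N -> window D (arrival j) = 0.
Proof.
rewrite /window => Dj; case: ifPn => // /andP[ca aD].
by move: Dj; rewrite leqNgt (arrival_lt (le_lt_trans c0 ca) aD).
Qed.

Lemma window_arrival_lt0 D j : (j < N c)%N -> window D (arrival j) = 0.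
Proof.
rewrite /window => jc; case: ifPn => // /andP[ca aD].
by have := lt_arrival c0 ca; rewrite leqNgt jc.
Qed.

(** Arrivals of index at least [N D] do not fall before [D], or have the default value 0; either way
    the window vanishes there. *)
Lemma sum_window_stable D n : (N D <= n)%N ->
  \sum_(0 <= j < n) window D (arrival j) = \sum_(0 <= j < N D) window D (arrival j).
Proof.
move=> Dn; rewrite (@big_cat_nat _ _ _ (N D))//= [X in _ + X]big1_seq ?addr0//.
by move=> j /andP[_]; rewrite mem_index_iota => /andP[Dj _]; exact: window_arrival0.
Qed.

Variable t : nat -> R.
Hypothesis t0 : t 0%N = c.
Hypothesis t_homo : {homo t : i j / (i <= j)%N >-> i <= j}.

Let tc i : c <= t i. Proof. by rewrite -t0 t_homo. Qed.

Let t_ge0 i : 0 <= t i. Proof. exact: le_trans (tc i). Qed.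

Let Nt i : (N (t i) <= N (t i.+1))%N.
Proof. by apply: N_homo => //; exact: t_homo. Qed.

Let N0t m : (N (t 0%N) <= N (t m))%N.
Proof. by apply: N_homo => //; exact: t_homo. Qed.

(** The indices from [N (t i)] up to [N (t i.+1)] are those of the arrivals after [t i] and not
    after [t i.+1], so [phi (t i)] bounds each of their terms. *)
Lemma sum_arrival_upper D m : \sum_(N (t 0%N) <= j < N (t m)) window D (arrival j) <=
  \sum_(0 <= i < m) phi (t i) * (N (t i.+1) - N (t i))%:R.
Proof.
elim: m => [|m IHm]; first by rewrite !big_geq.
rewrite (@big_cat_nat _ _ _ (N (t m)))//= big_nat_recr//=; apply: lerD => //.
rewrite mulr_natr -sumr_const_nat.
rewrite big_seq [leRHS]big_seq; apply: ler_sum => j; rewrite mem_index_iota => /andP[jm jm1].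
apply: le_trans (window_le _ _) _; apply: phi_noninc => //.
by apply: ltW; apply: (arrival_gt (t_ge0 m) jm (t_ge0 m.+1) jm1).
Qed.

Lemma sum_window_upper D m n : D <= t m ->
  \sum_(0 <= j < n) window D (arrival j) <=
  \sum_(0 <= i < m) phi (t i) * (N (t i.+1) - N (t i))%:R.
Proof.
move=> Dm; apply: le_trans (sum_arrival_upper D m).
have [D0|D0] := leP 0 D; last first.
  rewrite big1_seq ?sumr_ge0// => [j _|j _]; first exact: window_ge0.
  rewrite /window; case: ifPn => // /andP[ca aD].
  by have := lt_trans (le_lt_trans c0 ca) (lt_trans aD D0); rewrite ltxx.
have ND : (N D <= N (t m))%N by exact: N_homo.
apply: (@le_trans _ _ (\sum_(0 <= j < N (t m)) window D (arrival j))).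
  have [nt|tn] := leqP n (N (t m)).
    by rewrite [leRHS](@big_cat_nat _ _ _ n)//= lerDl sumr_ge0// => j _; exact: window_ge0.
  by rewrite sum_window_stable ?(leq_trans ND (ltnW tn))// sum_window_stable.
rewrite (@big_cat_nat _ _ _ (N (t 0%N)))//= [X in X + _]big1_seq ?add0r// => j.
by rewrite mem_index_iota t0 => /andP[_ /andP[_ jc]]; exact: window_arrival_lt0.
Qed.

(** The inequality is strict because an arrival may sit exactly at [t m], and the window is open at
    [D]. *)
Lemma sum_window_lower D m : t m < D ->
  \sum_(0 <= i < m) phi (t i.+1) * (N (t i.+1) - N (t i))%:R <=
  \sum_(0 <= j < N D) window D (arrival j).
Proof.
move=> mD; have ND : (N (t m) <= N D)%N by apply: N_homo => //; exact: ltW.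
rewrite [leRHS](@big_cat_nat _ _ _ (N (t m)))//=.
apply: (@le_trans _ _ (\sum_(0 <= j < N (t m)) window D (arrival j))); last first.
  by rewrite lerDl sumr_ge0// => j _; exact: window_ge0.
rewrite [leRHS](@big_cat_nat _ _ _ (N (t 0%N)))//=.
apply: (@le_trans _ _ (\sum_(N (t 0%N) <= j < N (t m)) window D (arrival j))); last first.
  by rewrite lerDr sumr_ge0// => j _; exact: window_ge0.
elim: m mD {ND} => [|m IHm] mD; first by rewrite !big_geq.
rewrite [leRHS](@big_cat_nat _ _ _ (N (t m)))//= big_nat_recr//=; apply: lerD.
  by apply: IHm; apply: le_lt_trans mD; exact: t_homo.
rewrite mulr_natr -sumr_const_nat.
rewrite big_seq [leRHS]big_seq; apply: ler_sum => j; rewrite mem_index_iota => /andP[jm jm1].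
have a1 := arrival_gt (t_ge0 m) jm (t_ge0 m.+1) jm1.
have a2 := arrival_le (t_ge0 m.+1) jm1.
rewrite /window (le_lt_trans (tc m) a1) (le_lt_trans a2 mD)/=.
by apply: phi_noninc => //; rewrite (le_trans (tc m))// ltW.
Qed.

End counting_path.

Section poisson_laplace.
Context d (T : measurableType d) (R : realType) (P : probability T R).
Variable N : R -> {RV P >-> nat}.
Hypothesis hN : is_poisson_process 1 N.

(** The exponential factors over the independent increments, and each factor is a Poisson generating
    function at exp(-f i). *)
Lemma laplace_increments (t f : nat -> R) m : 0 <= t 0%N ->
  (forall i, t i < t i.+1) -> (forall i, 0 <= f i) ->
  \int[P]_w expR (- \sum_(0 <= i < m) f i * (N (t i.+1) w - N (t i) w)%:R) =
  expR (- \sum_(0 <= i < m) (t i.+1 - t i) * (1 - expR (- f i))).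
Proof.
move=> t0 tS f0.
have thomo : {homo t : i j / (i <= j)%N >-> i <= j}.
  by apply: homo_leq => // [x y z|i]; [exact: le_trans|exact: ltW].
have tge0 i : 0 <= t i by rewrite (le_trans t0)// thomo.
have mY i : measurable_fun setT (fun w => (N (t i.+1) w - N (t i) w)%N).
  by apply: measurable_fun_subn.
pose Y i : {RV P >-> nat} := mfun_Sub (mem_set (mY i)).
have indep : mutual_independence P (fun i => Y i : T -> nat).
  exact: (poisson_independent_increments hN t0 thomo).
transitivity (\int[P]_w \prod_(0 <= i < m) (expR (- f i) ^+ Y i w)).
  apply: eq_Rintegral => w _; rewrite -sumrN expR_sum; apply: eq_bigr => i _.
  by rewrite -expRM_natr mulNr.
rewrite (@Rintegral_prod_indep _ _ _ _ _ _ Y (fun i k => expR (- f i) ^+ k))//; last first.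
  move=> i k; rewrite ger0_norm ?exprn_ge0 ?expR_ge0// exprn_ile1 ?expR_ge0//.
  by rewrite -expR0 ler_expR oppr_le0.
rewrite -sumrN expR_sum; apply: eq_bigr => i _.
rewrite (@poisson_pgf _ _ _ _ (Y i) (t i.+1 - t i)) ?subr_gt0 ?expR_gt0// => k.
by rewrite -[X in poisson_pmf X]mul1r; exact: (poisson_increment_law hN).
Qed.

Variable Gam : nat -> {RV P >-> R}.
Hypothesis hGam : forall j w, Gam j w = arrival_time N j w.
Variables (phi : R -> R) (c : R).
Hypothesis c0 : 0 <= c.
Hypothesis phi_ge0 : forall x, 0 <= phi x.
Hypothesis phi_noninc : forall x y, c <= x -> x <= y -> phi y <= phi x.
Hypothesis mphi : measurable_fun setT phi.
Variable D lambda : R.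
Hypothesis lambda0 : 0 <= lambda.

Let GamE j w : Gam j w = arrival (N ^~ w) j. Proof. exact: hGam. Qed.

Definition shot n w : R := \sum_(0 <= j < n) window phi c D (Gam j w).

Definition shot_all w : R := shot (N D w) w.

Lemma measurable_window : measurable_fun setT (window phi c D).
Proof.
rewrite (_ : window phi c D = fun x => \1_`]c, D[%classic x * phi x).
  by apply: measurable_funM => //; exact: measurable_indic.
apply/funext => x; rewrite /window indicE.
have [h|h] := boolP (c < x < D); first by rewrite mem_set ?mul1r//= in_itv.
by rewrite memNset ?mul0r//= in_itv/=; exact/negP.
Qed.

Lemma measurable_shot n : measurable_fun setT (shot n).
Proof.
by apply: measurable_sum => j; exact: (measurableT_comp measurable_window).
Qed.

Lemma shot_ge0 n w : 0 <= shot n w.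
Proof. by apply: sumr_ge0 => j _; exact: window_ge0. Qed.

Let pathN w s u : 0 <= s -> s <= u -> (N s w <= N u w)%N.
Proof. exact: (poisson_nondecreasing hN). Qed.

Let pathrc w u : 0 <= u -> \forall s \near u^'+, N s w = N u w.
Proof. exact: (poisson_right_continuous hN). Qed.

Lemma shot_stable n w : (N D w <= n)%N -> shot n w = shot_all w.
Proof.
move=> Dn; rewrite /shot_all /shot.
under eq_bigr do rewrite GamE; under [RHS]eq_bigr do rewrite GamE.
exact: (sum_window_stable (@pathN w) (@pathrc w)).
Qed.

Lemma cvg_shot w : shot n w @[n --> \oo] --> shot_all w.
Proof.
apply: cvg_near_cst; near=> n; apply: shot_stable.
by near: n; exact: nbhs_infty_ge.
Unshelve. all: by end_near. Qed.

Lemma expR_shot_norm n w : `|expR (- (lambda * shot n w))| <= 1.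
Proof.
by rewrite ger0_norm ?expR_ge0// -expR0 ler_expR oppr_le0 mulr_ge0 ?shot_ge0.
Qed.

Lemma measurable_expR_shot n : measurable_fun setT (fun w => expR (- (lambda * shot n w))).
Proof.
apply: measurableT_comp => //; apply: measurableT_comp => //.
by apply: measurable_funM => //; exact: measurable_shot.
Qed.

Lemma cvg_laplace_shot :
  \int[P]_w expR (- (lambda * shot n w)) @[n --> \oo] -->
  \int[P]_w expR (- (lambda * shot_all w)).
Proof.
apply: (@dominated_cvg_Rintegral _ _ _ _ _ _ _ _ (cst 1)) => //.
- by move=> n; exact: measurable_expR_shot.
- by apply: (@bounded_integrable _ _ _ _ _ 1) => // w; rewrite normr1.
- move=> w _; apply: continuous_cvg; first exact: continuous_expR.
  by apply: cvgN; apply: cvgMl_tmp; exact: cvg_shot.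
- by move=> n w _; exact: expR_shot_norm.
Qed.

Let psi x := 1 - expR (- (lambda * phi x)).

(** This holds for every [n]: leaving out nonnegative terms only increases the exponential. *)
Lemma laplace_shot_ge n delta m : 0 < delta -> D <= c + m%:R * delta ->
  expR (- \sum_(0 <= i < m) delta * psi (c + i%:R * delta)) <=
  \int[P]_w expR (- (lambda * shot n w)).
Proof.
move=> delta0 Dm.
pose t i := c + i%:R * delta.
have tS i : t i < t i.+1 by rewrite /t ltrD2l ltr_pM2r// ltr_nat.
have t0 : t 0%N = c by rewrite /t mul0r addr0.
have thomo : {homo t : i j / (i <= j)%N >-> i <= j}.
  by apply: homo_leq => // [x y z|i]; [exact: le_trans|exact: ltW].
have tge0 : 0 <= t 0%N by rewrite t0.
have := @laplace_increments t (fun i => lambda * phi (t i)) m tge0 tS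
  (fun i => mulr_ge0 lambda0 (phi_ge0 (t i))).
rewrite (_ : \sum_(0 <= i < m) (t i.+1 - t i) * _ =
  \sum_(0 <= i < m) delta * psi (c + i%:R * delta)); last first.
  apply: eq_bigr => i _; congr (_ * _).
  by rewrite /t -[i.+1]addn1 natrD; ring.
move=> <-; apply: le_Rintegral => //.
- apply: (@bounded_integrable _ _ _ _ _ 1).
    apply: measurableT_comp => //; apply: measurableT_comp => //.
    apply: measurable_sum => i; apply: measurable_funM => //.
    apply: (measurableT_comp (f := fun k : nat => k%:R : R)) => //.
    exact: measurable_fun_subn.
  move=> w; rewrite ger0_norm ?expR_ge0// -expR0 ler_expR oppr_le0.
  by apply: sumr_ge0 => i _; rewrite !mulr_ge0.
- apply: (@bounded_integrable _ _ _ _ _ 1); first exact: measurable_expR_shot.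
  exact: expR_shot_norm.
move=> w _; rewrite ler_expR lerN2.
under [leRHS]eq_bigr do rewrite -mulrA.
rewrite -mulr_sumr ler_wpM2l//.
rewrite /shot; under eq_bigr do rewrite GamE.
exact: (sum_window_upper (@pathN w) (@pathrc w)).
Qed.

(** Here the full sum is required, since a fixed number of terms may miss some of the arrivals
    counted by the slices. *)
Lemma laplace_shot_all_le delta m : 0 < delta -> c + m%:R * delta < D ->
  \int[P]_w expR (- (lambda * shot_all w)) <=
  expR (- \sum_(0 <= i < m) delta * psi (c + i.+1%:R * delta)).
Proof.
move=> delta0 Dm.
pose t i := c + i%:R * delta.
have tS i : t i < t i.+1 by rewrite /t ltrD2l ltr_pM2r// ltr_nat.
have t0 : t 0%N = c by rewrite /t mul0r addr0.
have thomo : {homo t : i j / (i <= j)%N >-> i <= j}.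
  by apply: homo_leq => // [x y z|i]; [exact: le_trans|exact: ltW].
have tge0 : 0 <= t 0%N by rewrite t0.
have := @laplace_increments t (fun i => lambda * phi (t i.+1)) m tge0 tS
  (fun i => mulr_ge0 lambda0 (phi_ge0 (t i.+1))).
rewrite (_ : \sum_(0 <= i < m) (t i.+1 - t i) * _ =
  \sum_(0 <= i < m) delta * psi (c + i.+1%:R * delta)); last first.
  apply: eq_bigr => i _; congr (_ * _).
  by rewrite /t -[i.+1]addn1 natrD; ring.
move=> <-; apply: le_Rintegral => //.
- apply: (@bounded_integrable _ _ _ _ _ 1); last by move=> w; exact: expR_shot_norm.
  (* [shot_all] has a random number of terms; measurability comes from its being the pointwise limit
     of [shot n]. *)
  apply: measurable_fun_cvg; first by move=> n; exact: measurable_expR_shot.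
  move=> w _; apply: continuous_cvg; first exact: continuous_expR.
  by apply: cvgN; apply: cvgMl_tmp; exact: cvg_shot.
- apply: (@bounded_integrable _ _ _ _ _ 1).
    apply: measurableT_comp => //; apply: measurableT_comp => //.
    apply: measurable_sum => i; apply: measurable_funM => //.
    apply: (measurableT_comp (f := fun k : nat => k%:R : R)) => //.
    exact: measurable_fun_subn.
  move=> w; rewrite ger0_norm ?expR_ge0// -expR0 ler_expR oppr_le0.
  by apply: sumr_ge0 => i _; rewrite !mulr_ge0.
move=> w _; rewrite ler_expR lerN2.
under eq_bigr do rewrite -mulrA.
rewrite -mulr_sumr ler_wpM2l//.
rewrite /shot_all /shot; under [leRHS]eq_bigr do rewrite GamE.
exact: (sum_window_lower (@pathN w) (@pathrc w)).
Qed.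

End poisson_laplace.

(** * Smoothing inequality *)

Section expect_sinint.
Context d (T : measurableType d) (R : realType) (P : probability T R).
Local Notation mu := (@lebesgue_measure R).
Variables (X : {RV P >-> R}) (phiX : R -> R).
Hypothesis iX : P.-integrable setT (EFin \o X).
Hypothesis phiXE : forall y u, \int[P]_w sin (y - u * X w) = sin y * phiX u.

Let moy : measurable (`]0, +oo[%classic : set (measurableTypeR R)).
Proof. exact: measurable_itv. Qed.

(** Extending by zero gives a function on the whole line, so that Fubini can be applied on the full
    product space. *)
Let ker : R -> R := (fun r => r^-1 * gauss 1 r) \_ `]0, +oo[%classic.

Let measurable_ker : measurable_fun setT ker.
Proof.
apply/(measurable_restrictT _ _).1 => //.
apply: open_continuous_measurable_fun; first exact: interval_open.
move=> r; rewrite inE/= in_itv/= andbT => r0.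
apply: cvgM; last exact: continuous_gauss.
by apply: cvgV; [rewrite gt_eqF|exact: cvg_id].
Qed.

Variables (x e : R).
Hypothesis e0 : 0 < e.

Let f (z : T * measurableTypeR R) : R := sin (z.2 * ((x - X z.1) / e)) * ker z.2.

Let mf : measurable_fun setT f.
Proof.
apply: measurable_funM; last first.
  exact: (measurableT_comp (measurable_ker : measurable_fun setT (ker : measurableTypeR R -> R))).
apply: measurableT_comp; first exact: measurable_sin.
apply: measurable_funM; first exact: measurable_snd.
apply: measurable_funM => //; apply: measurable_funB => //.
exact: measurableT_comp.
Qed.

Let fE w r : 0 < r -> f (w, r) = sinint_fun ((x - X w) / e) r.
Proof.
move=> r0; have rD : r \in (`]0, +oo[%classic : set R) by rewrite inE/= in_itv/= r0.
by rewrite /f /sinint_fun/= /ker patchE rD -[RHS]mulrA.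
Qed.

Let f0 w r : r <= 0 -> f (w, r) = 0.
Proof.
move=> r0; rewrite /f /= /ker patchE memNset/= ?mulr0// in_itv/= andbT.
by apply/negP; rewrite -leNgt.
Qed.

Let f_bound w r : `|f (w, r)| <= `|(x - X w) / e| * gauss 1 r.
Proof.
have [r0|r0] := ltP 0 r; first by rewrite fE// sinint_fun_bound.
by rewrite f0// normr0 mulr_ge0 ?gauss_ge0.
Qed.

Let iZ : P.-integrable setT (EFin \o (fun w => `|(x - X w) / e|)).
Proof.
have ix : P.-integrable setT (EFin \o cst x).
  by apply: (@bounded_integrable _ _ _ _ _ `|x|).
have iB : P.-integrable setT (EFin \o (fun w => x - X w)).
  have := integrableB measurableT ix iX.
  by apply: eq_integrable.
have := integrable_EFinZl measurableT e^-1 iB.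
move=> /integrable_norm; apply: eq_integrable => // w _ /=.
by rewrite mulrC.
Qed.

(** [f] is dominated by |x - X| / e times [gauss 1 r], a product of integrable functions;
    integrability of [X] compensates the singularity of [ker] at 0. *)
Let int_f : (product_measure1 P mu).-integrable setT (EFin \o f).
Proof.
apply/integrable12ltyP; first exact/measurable_EFinP.
have ig : mu.-integrable setT (EFin \o gauss (1 : R)) by exact: integrable_gauss.
have /integrableP[_ gfin] := ig.
have fing : (\int[mu]_r `|(EFin \o gauss (1 : R)) r| < +oo)%E by [].
have /integrableP[_] := integrable_EFinZl measurableT (\int[mu]_r gauss 1 r) iZ.
apply: le_lt_trans; apply: ge0_le_integral => //.
- by move=> w _; apply: integral_ge0.
- apply: (measurable_fun_fubini_tonelli_F (abse \o (EFin \o f))).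
    by apply: measurableT_comp => //; exact/measurable_EFinP.
  by move=> z; exact: abse_ge0.
- by apply: measurableT_comp => //; have /integrableP[] := integrable_EFinZl measurableT (\int[mu]_r gauss 1 r) iZ.
- move=> w _ /=.
  apply: (@le_trans _ _ (\int[mu]_r (`|(x - X w) / e| * gauss 1 r)%:E)%E).
    apply: ge0_le_integral => //.
    + apply/measurable_EFinP; apply: measurableT_comp => //.
      exact: (measurableT_comp mf).
    + by apply/measurable_EFinP; apply: measurable_funM => //; exact: measurable_gauss.
    + by move=> r _; rewrite lee_fin f_bound.
  under eq_integral do rewrite EFinM.
  rewrite integralZl// -[X in (_ * X)%E]fineK; last exact: integrable_fin_num.
  by rewrite -EFinM lee_fin mulrC ler_norm.
Qed.

Let Rintegral_f w : \int[mu]_r f (w, r) = pi * sinint ((x - X w) / e).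
Proof.
rewrite /sinint mulVKf ?gt_eqF ?pi_gt0// [RHS]Rintegral_mkcond.
apply: eq_Rintegral => r _; rewrite patchE.
case: ifPn => [|]; first by rewrite inE/= in_itv/= andbT => r0; exact: fE.
by rewrite notin_setE/= in_itv/= andbT => /negP; rewrite -leNgt => r0; exact: f0.
Qed.

Lemma measurable_sinint : measurable_fun setT (@sinint R).
Proof.
apply: nondecreasing_measurable => // a b ab.
have [a0|a0] := leP 0 a; first exact: sinint_homo.
have [b0|b0] := leP 0 b.
  apply: (@le_trans _ _ 0); last exact: sinint_ge0.
  by rewrite -oppr_ge0 -sinintN sinint_ge0// oppr_ge0 ltW.
by rewrite -lerN2 -!sinintN sinint_homo ?lerN2// oppr_ge0 ltW.
Qed.

Let Rintegral_fw r : \int[P]_w f (w, r) =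
  ((fun r => sin (r * (x / e)) * phiX (r / e) / r * gauss 1 r) \_ `]0, +oo[%classic) r.
Proof.
have msin : measurable_fun setT (fun w => sin (r * (x / e) - r / e * X w)).
  by apply: measurableT_comp; [exact: measurable_sin|apply: measurable_funB => //; exact: measurable_funM].
transitivity (ker r * \int[P]_w sin (r * (x / e) - r / e * X w)).
  rewrite -RintegralZl//; last first.
    apply: (@bounded_integrable _ _ _ _ _ 1) => // w.
    by rewrite ler_norml sin_geN1 sin_le1.
  apply: eq_Rintegral => w _; rewrite /f/= mulrC; congr (_ * sin _).
  by field; rewrite gt_eqF.
rewrite phiXE /ker !patchE; case: ifPn => _; last by rewrite mul0r.
by ring.
Qed.

Let int_fw r : P.-integrable setT (fun w => (f (w, r))%:E).
Proof.
apply: (@bounded_integrable _ _ _ _ _ `|ker r|).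
  exact: (measurableT_comp mf).
by move=> w; rewrite /f normrM ler_piMl// ler_norml sin_geN1 sin_le1.
Qed.

Lemma Rintegral_sinint_fourier :
  \int[P]_w sinint ((x - X w) / e) =
  pi^-1 * \int[mu]_(r in `]0, +oo[) (sin (r * (x / e)) * phiX (r / e) / r * gauss 1 r).
Proof.
have -> : \int[P]_w sinint ((x - X w) / e) = pi^-1 * \int[P]_w (\int[mu]_r f (w, r)).
  rewrite -RintegralZl//; last first.
    apply: (@bounded_integrable _ _ _ _ _ pi).
      under eq_fun do rewrite Rintegral_f; apply: measurable_funM => //.
      apply: (measurableT_comp measurable_sinint).
      by apply: measurable_funM => //; exact: measurable_funB.
    move=> w; rewrite Rintegral_f normrM ger0_norm ?pi_ge0// ler_piMr ?pi_ge0//.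
    by rewrite ler_norml; have := sinint_le ((x - X w) / e); have := sinint_geN ((x - X w) / e); lra.
  by apply: eq_Rintegral => w _; rewrite Rintegral_f mulKf// gt_eqF// pi_gt0.
congr (_ * _); rewrite [RHS]Rintegral_mkcond.
have fin1 w : (\int[mu]_r (f (w, r))%:E)%E = (\int[mu]_r f (w, r))%:E.
  rewrite /Rintegral fineK//; apply: integrable_fin_num => //.
  have ig := integrable_EFinZl measurableT `|(x - X w) / e| (integrable_gauss (@ltr01 R)).
  apply: (dominated_integrable_EFin measurableT _ ig) => [|r _]; last exact: f_bound.
  exact: (measurableT_comp mf).
transitivity (fine (\int[P]_w (\int[mu]_r (f (w, r))%:E)))%E.
  by rewrite /Rintegral; congr fine; apply: eq_integral => w _; rewrite fin1.
rewrite (Fubini int_f) [RHS]/Rintegral; congr fine; apply: eq_integral => r _.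
by rewrite -Rintegral_fw /Rintegral fineK//; apply: integrable_fin_num.
Qed.

Lemma integrable_sinint_fourier : mu.-integrable `]0, +oo[
  (EFin \o (fun r => sin (r * (x / e)) * phiX (r / e) / r * gauss 1 r)).
Proof.
apply/(integrable_mkcond _ moy).
suff : mu.-integrable setT (EFin \o (fun r => \int[P]_w f (w, r))).
  by apply: eq_integrable => // r _ /=; rewrite Rintegral_fw !patchE; case: ifP.
have ig := integrable_EFinZl measurableT (\int[P]_w `|(x - X w) / e|) (integrable_gauss (@ltr01 R)).
apply: (dominated_integrable_EFin measurableT _ ig) => [|r _].
  apply/measurable_EFinP; apply: eq_measurable_fun (measurable_fubini_G int_f) => r _.
  by rewrite /fubini_G /Rintegral/= fineK//; apply: integrable_fin_num.
apply: le_trans (le_normr_Rintegral measurableT (int_fw r)) _.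
rewrite -RintegralZr//; apply: le_Rintegral => //.
- exact: integrable_norm (int_fw r).
- have := integrable_EFinZl measurableT (gauss 1 r) iZ.
  by apply: eq_integrable => // w _ /=; rewrite mulrC.
Qed.

End expect_sinint.

Section smoothing_inequality.
Context d (T : measurableType d) (R : realType) (P : probability T R).
Context d' (T' : measurableType d') (Q : probability T' R).
Local Notation mu := (@lebesgue_measure R).
Variables (X : {RV P >-> R}) (Y : {RV Q >-> R}) (phiX phiY : R -> R).
Hypothesis iX : P.-integrable setT (EFin \o X).
Hypothesis iY : Q.-integrable setT (EFin \o Y).
Hypothesis phiXE : forall y u, \int[P]_w sin (y - u * X w) = sin y * phiX u.
Hypothesis phiYE : forall y u, \int[Q]_w sin (y - u * Y w) = sin y * phiY u.
Variables (e delta tau : R) (g : R -> R).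
Hypothesis e0 : 0 < e.
Hypothesis tau_tail : forall z, delta / e <= z -> 2^-1 - tau <= sinint z.
Hypothesis tau0 : 0 <= tau.
Hypothesis ig : mu.-integrable `]0, +oo[ (EFin \o g).
Hypothesis g_ub : forall r, 0 < r ->
  `|phiX (r / e) - phiY (r / e)| / r * gauss 1 r <= g r.

(** The smoothed distribution functions are compared at [x + delta]. One shift by [delta] leads
    there from the indicator for [X], another leads on to the indicator for [Y]; each costs [tau],
    which bounds the normal tail beyond [delta / e]. *)
Lemma smoothing_inequality x :
  fine (cdf X x) <= fine (cdf Y (x + 2 * delta)) + 2 * tau +
    pi^-1 * \int[mu]_(r in `]0, +oo[) g r.
Proof.
have bS (a b : R) : `|2^-1 + sinint a + b| <= 1 + `|b|.
  apply: le_trans (ler_normD _ _) _; rewrite lerD2r ler_norml.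
  by have := sinint_le a; have := sinint_geN a; lra.
have mS dd (U : measurableType dd) (Z : U -> R) (z b : R) : measurable_fun setT Z ->
    measurable_fun setT (fun w => 2^-1 + sinint ((z - Z w) / e) + b).
  move=> mZ; apply: measurable_funD => //; apply: measurable_funD => //.
  apply: (measurableT_comp (@measurable_sinint R)).
  by apply: measurable_funM => //; exact: measurable_funB.
have mS0 dd (U : measurableType dd) (Z : U -> R) (z : R) : measurable_fun setT Z ->
    measurable_fun setT (fun w => sinint ((z - Z w) / e)).
  move=> mZ; apply: (measurableT_comp (@measurable_sinint R)).
  by apply: measurable_funM => //; exact: measurable_funB.
have bS0 (a : R) : `|sinint a| <= 1.
  by rewrite ler_norml; have := sinint_le a; have := sinint_geN a; lra.
have iS dd (U : measurableType dd) (m : probability U R) (Z : {RV m >-> R}) (z b : R) :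
    m.-integrable setT (EFin \o (fun w => 2^-1 + sinint ((z - Z w) / e) + b)).
  by apply: (@bounded_integrable _ _ _ _ _ (1 + `|b|)) => //; exact: mS.
have ES dd (U : measurableType dd) (m : probability U R) (Z : {RV m >-> R}) (z b : R) :
    \int[m]_w (2^-1 + sinint ((z - Z w) / e) + b) =
    2^-1 + \int[m]_w sinint ((z - Z w) / e) + b.
  have m1 : fine (m setT) = 1 by rewrite probability_setT.
  have ic k : m.-integrable setT (EFin \o cst k).
    by apply: (@bounded_integrable _ _ _ _ _ `|k|).
  have is0 : m.-integrable setT (EFin \o (fun w => sinint ((z - Z w) / e))).
    by apply: (@bounded_integrable _ _ _ _ _ 1) => //; exact: mS0.
  have is1 : m.-integrable setT (EFin \o (fun w => 2^-1 + sinint ((z - Z w) / e))).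
    have := integrableD measurableT (ic 2^-1) is0.
    by apply: eq_integrable.
  rewrite RintegralD//; last exact: ic.
  rewrite RintegralD//; last exact: ic.
  by rewrite !Rintegral_cst// m1 !mulr1.
have cdfE dd (U : measurableType dd) (m : probability U R) (Z : {RV m >-> R}) (z : R) :
    fine (cdf Z z) = \int[m]_w \1_(Z @^-1` `]-oo, z]%classic) w.
  have mA : measurable (Z @^-1` `]-oo, z]%classic).
    by rewrite -[X in measurable X]setTI; exact: measurable_funP.
  by rewrite /Rintegral integral_indic// setIT.
have i1 dd (U : measurableType dd) (m : probability U R) (Z : {RV m >-> R}) (z : R) :
    m.-integrable setT (EFin \o (\1_(Z @^-1` `]-oo, z]%classic) : U -> R)).
  apply: (@bounded_integrable _ _ _ _ _ 1).
    apply: measurable_indic; rewrite -[X in measurable X]setTI.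
    exact: measurable_funP.
  by move=> w; rewrite indicE; case: (_ \in _); rewrite ?normr1 ?normr0.
have hX : fine (cdf X x) <= 2^-1 + \int[P]_w sinint ((x + delta - X w) / e) + tau.
  rewrite cdfE -ES.
  apply: (le_Rintegral measurableT (i1 _ _ _ _ _) (iS _ _ _ _ _ _)) => w _.
  rewrite indicE; have [/set_mem|_] := boolP (w \in _).
    rewrite /= in_itv/= => Xx; have : delta / e <= (x + delta - X w) / e by rewrite ler_pM2r ?invr_gt0//; lra.
    by move=> /tau_tail; rewrite mulr1n; lra.
  by have := sinint_geN ((x + delta - X w) / e); move: tau0; rewrite mulr0n; lra.
have hY : 2^-1 + \int[Q]_w sinint ((x + delta - Y w) / e) - tau <=
    fine (cdf Y (x + 2 * delta)).
  rewrite cdfE -ES.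
  apply: (le_Rintegral measurableT (iS _ _ _ _ _ _) (i1 _ _ _ _ _)) => w _.
  rewrite indicE; have [_|] := boolP (w \in _); last rewrite notin_setE/= in_itv/= => Yx.
    by have := sinint_le ((x + delta - Y w) / e); move: tau0; rewrite mulr1n; lra.
  have : delta / e <= - ((x + delta - Y w) / e).
    rewrite -mulNr ler_pM2r ?invr_gt0//; move/negP: Yx; rewrite -ltNge; lra.
  by move=> /tau_tail; rewrite sinintN mulr0n; lra.
have hXY : \int[P]_w sinint ((x + delta - X w) / e) -
    \int[Q]_w sinint ((x + delta - Y w) / e) <= pi^-1 * \int[mu]_(r in `]0, +oo[) g r.
  have iFX := integrable_sinint_fourier iX phiXE (x + delta) e0.
  have iFY := integrable_sinint_fourier iY phiYE (x + delta) e0.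
  rewrite (Rintegral_sinint_fourier iX phiXE)// (Rintegral_sinint_fourier iY phiYE)//.
  rewrite -mulrBr ler_pM2l ?invr_gt0 ?pi_gt0// -RintegralB//.
  apply: le_Rintegral => //.
    have moy : measurable (`]0, +oo[%classic : set (measurableTypeR R)) by exact: measurable_itv.
    have := integrableB moy iFX iFY.
    by apply: eq_integrable => //.
  move=> r /=; rewrite in_itv/= andbT => r0; apply: le_trans (g_ub r0).
  rewrite -mulrBl -mulrBl -mulrBr ler_wpM2r ?gauss_ge0// ler_pM2r ?invr_gt0//.
  apply: le_trans (ler_norm _) _; rewrite normrM ler_piMl//.
  by rewrite ler_norml sin_geN1 sin_le1.
by move: hX hY hXY; lra.
Qed.

End smoothing_inequality.

Lemma measurable_itv_lebesgue (R : realType) (i : interval R) :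
  measurable ([set` i] : set (measurableTypeR R)).
Proof. exact: measurable_itv. Qed.

(** * Laplace exponent *)

Section power_tail.
Context {R : realType}.
Local Notation mu := (@lebesgue_measure R).

Lemma cvg_powR_pinfty (p : R) : 0 < p -> x `^ (- p) @[x --> +oo%R] --> 0.
Proof.
move=> p0; under eq_fun do rewrite powRN.
apply/gtr0_cvgV0; first by near=> x; rewrite powR_gt0.
apply/cvgryPge => A; near=> x.
have x0 : 0 <= x by [].
have A0 : 0 <= `|A| by [].
have xA : `|A| `^ p^-1 <= x by [].
apply: le_trans (ler_norm A) _.
rewrite -[leLHS]powRr1// -(mulVf (lt0r_neq0 p0)) powRrM.
by apply: ge0_ler_powR => //; rewrite ?nnegrE ?powR_ge0 ?ltW.
Unshelve. all: end_near. Qed.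

Lemma integral_powR_tail (p c : R) : 1 < p -> 0 < c ->
  (\int[mu]_(x in `[c, +oo[) (x `^ (- p))%:E = (c `^ (1 - p) / (p - 1))%:E)%E.
Proof.
move=> p1 c0; have p10 : 0 < p - 1 by rewrite subr_gt0.
have dF (x : R) : 0 < x -> is_derive x 1 (fun x => x `^ (1 - p) / (1 - p)) (x `^ (- p)).
  move=> x0; have := is_derive1_powR (1 - p) x0; move=> ?.
  apply: is_derive_eq; rewrite /GRing.scale/= ?mulr0 ?add0r.
  rewrite (_ : 1 - p - 1 = - p); last by ring.
  by field; lra.
rewrite (@ge0_continuous_FTC2y _ _ (fun x => x `^ (1 - p) / (1 - p)) c 0).
- by rewrite sub0e -EFinN; congr EFin; field; lra.
- by move=> x _; exact: powR_ge0.
- apply: derivable_within_continuous => x; rewrite in_itv/= andbT => cx.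
  by apply: derivable_powR; rewrite in_itv/= andbT (lt_le_trans c0).
- rewrite -[X in _ --> X](mul0r (1 - p)^-1); apply: cvgMr_tmp.
  by rewrite (_ : 1 - p = - (p - 1)); [exact: cvg_powR_pinfty|ring].
- by move=> x cx; apply: ex_derive; apply: dF; exact: lt_trans cx.
- have cF : {for c, continuous (fun x => x `^ (1 - p) / (1 - p))}.
    apply: differentiable_continuous.
    by apply/derivable1_diffP; apply: ex_derive; exact: dF.
  exact: cvg_at_right_filter cF.
- move=> x; rewrite in_itv/= andbT => cx; rewrite derive1E.
  by apply: derive_val; apply: dF; exact: lt_trans cx.
Qed.

Lemma measurable_powR_cst (p : R) (D : set R) : measurable D ->
  measurable_fun D (@powR R ^~ p).
Proof. by move=> mD; apply: measurable_funTS; exact: measurable_powR. Qed.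

Lemma integrable_powR_tail (p c : R) : 1 < p -> 0 < c ->
  mu.-integrable `]c, +oo[ (EFin \o (fun x => x `^ (- p))).
Proof.
move=> p1 c0; apply/integrableP; split.
  by apply/measurable_EFinP; exact: measurable_powR_cst.
under eq_integral do rewrite /= ger0_norm ?powR_ge0//.
rewrite integral_itv_obnd_cbnd ?integral_powR_tail ?ltry//.
by apply/measurable_EFinP; exact: measurable_powR_cst.
Qed.

Lemma Rintegral_powR_tail (p c : R) : 1 < p -> 0 < c ->
  \int[mu]_(x in `]c, +oo[) (x `^ (- p)) = c `^ (1 - p) / (p - 1).
Proof.
move=> p1 c0; rewrite /Rintegral integral_itv_obnd_cbnd ?integral_powR_tail//.
by apply/measurable_EFinP; exact: measurable_powR_cst.
Qed.

End power_tail.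

Section exp_bounds.
Context {R : realType}.

Lemma onemexpRN_le (y : R) : 1 - expR (- y) <= y.
Proof. by have := expR_ge1Dx (- y); lra. Qed.

Lemma onemexpRN_ge (y : R) : 0 <= y -> y - y ^+ 2 / 2 <= 1 - expR (- y).
Proof.
move=> y0; rewrite -subr_ge0.
pose f (x : R) := 1 - expR (- x) - (x - x ^+ 2 / 2).
have df (x : R) : is_derive x 1 f (expR (- x) - 1 + x).
  rewrite /f; apply: is_derive_eq.
  by rewrite /GRing.scale/= ?scaler1 ?mulr0 ?mul0r; field.
have f0 : f 0 = 0 by rewrite /f oppr0 expR0 expr0n/=; ring.
rewrite -/(f y); have -> : f y = f y - f 0 by rewrite f0 subr0.
have cf := derivable_continuous (fun x => @ex_derive _ _ _ _ _ _ _ (df x)).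
have [z /[!in_itv]/= /andP[z0 _] ->] := @MVT_segment _ f _ 0 y y0 (fun x _ => df x)
  (continuous_subspaceT cf).
by rewrite subr0 mulr_ge0//; have := expR_ge1Dx (- z); lra.
Qed.

Lemma onemexpRN_concave (w z : R) : 0 <= w <= 1 -> 0 <= z ->
  w * (1 - expR (- z)) <= 1 - expR (- (w * z)).
Proof.
move=> /andP[w0 w1] z0; rewrite -subr_ge0.
pose f (x : R) := 1 - expR (- (w * x)) - w * (1 - expR (- x)).
have df (x : R) : is_derive x 1 f (w * (expR (- (w * x)) - expR (- x))).
  rewrite /f; apply: is_derive_eq.
  by rewrite /GRing.scale/= ?scaler1 ?mulr0 ?mul0r; field.
have f0 : f 0 = 0 by rewrite /f mulr0 oppr0 expR0; ring.
rewrite -/(f z); have -> : f z = f z - f 0 by rewrite f0 subr0.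
have cf := derivable_continuous (fun x => @ex_derive _ _ _ _ _ _ _ (df x)).
have [t /[!in_itv]/= /andP[t0 _] ->] := @MVT_segment _ f _ 0 z z0 (fun x _ => df x)
  (continuous_subspaceT cf).
rewrite subr0 !mulr_ge0// subr_ge0 ler_expR lerN2 ler_piMl//.
Qed.

(** The factor exp(-y) is kept: with [Psi] for [y] it supplies the decay without which the integral
    over w would diverge. *)
Lemma expRN_diff_le (x y : R) : y <= x -> expR (- y) - expR (- x) <= expR (- y) * (x - y).
Proof.
move=> yx; have -> : expR (- x) = expR (- y) * expR (- (x - y)).
  by rewrite -expRD; congr expR; ring.
by rewrite -{1}[expR (- y)]mulr1 -mulrBr ler_wpM2l ?expR_ge0// onemexpRN_le.
Qed.

End exp_bounds.

Section riemann_sums.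
Context {R : realType}.
Local Notation mu := (@lebesgue_measure R).
Variables (psi : R -> R) (c delta : R).
Hypothesis delta0 : 0 < delta.
Hypothesis psi_noninc : forall x y, c <= x -> x <= y -> psi y <= psi x.
Hypothesis int_psi : forall b, mu.-integrable `]c, b] (EFin \o psi).

Let t (i : nat) := c + i%:R * delta.

Let tS i : t i < t i.+1. Proof. by rewrite /t ltrD2l ltr_pM2r// ltr_nat. Qed.

Let tc i : c <= t i. Proof. by rewrite /t lerDl mulr_ge0// ltW. Qed.

Let tSE i : t i.+1 - t i = delta.
Proof. by rewrite /t -[i.+1]addn1 natrD; ring. Qed.

Let int_piece i : mu.-integrable `]t i, t i.+1] (EFin \o psi).
Proof.
apply: integrableS (int_psi (t i.+1)) => //.
by move=> x /=; rewrite !in_itv/= => /andP[x1 ->]; rewrite (le_lt_trans (tc i)).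
Qed.

Let int_cst i (k : R) : mu.-integrable `]t i, t i.+1] (EFin \o cst k).
Proof.
have : mu.-integrable `[t i, t i.+1] (EFin \o cst k).
  by apply: integrable_itv_continuous; exact: cst_continuous.
by apply: integrableS => //; apply: subset_itvr; rewrite bnd_simp.
Qed.

Let piece_cst i (k : R) : \int[mu]_(x in `]t i, t i.+1]) k = delta * k.
Proof.
rewrite Rintegral_cst//= lebesgue_measure_itv/= lte_fin tS -EFinB/= tSE.
by rewrite mulrC.
Qed.

Let split_piece m : \int[mu]_(x in `]c, t m.+1]) psi x =
  \int[mu]_(x in `]c, t m]) psi x + \int[mu]_(x in `]t m, t m.+1]) psi x.
Proof.
rewrite -(Rintegral_itvB (x := t m) (int_psi _)).
- by ring.
- by rewrite bnd_simp.
- by rewrite bnd_simp ltW.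
Qed.

Let t0 : t 0%N = c. Proof. by rewrite /t mul0r addr0. Qed.

Let int0 : \int[mu]_(x in `]c, t 0%N]) psi x = 0.
Proof. by rewrite t0 set_itv_ge ?Rintegral_set0// bnd_simp ltxx. Qed.

Lemma riemann_lower m : \sum_(0 <= i < m) delta * psi (t i.+1) <=
  \int[mu]_(x in `]c, t m]) psi x.
Proof.
elim: m => [|m IHm]; first by rewrite big_geq// int0.
rewrite big_nat_recr//= split_piece; apply: lerD => //.
rewrite -(piece_cst m); apply: le_Rintegral => //; first exact: int_cst.
move=> x /=; rewrite in_itv/= => /andP[x1 x2]; apply: psi_noninc => //.
by rewrite (le_trans (tc m))// ltW.
Qed.

Lemma riemann_upper m : \int[mu]_(x in `]c, t m]) psi x <=
  \sum_(0 <= i < m) delta * psi (t i).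
Proof.
elim: m => [|m IHm]; first by rewrite big_geq// int0.
rewrite big_nat_recr//= split_piece; apply: lerD => //.
rewrite -(piece_cst m); apply: le_Rintegral => //; first exact: int_cst.
by move=> x /=; rewrite in_itv/= => /andP[x1 x2]; apply: psi_noninc => //; exact: ltW.
Qed.

(** Left and right sums differ by a telescoping term of order [delta], so each approximates the
    integral up to the mesh. *)
Lemma riemann_shift m : \sum_(0 <= i < m) delta * psi (t i) =
  \sum_(0 <= i < m) delta * psi (t i.+1) + delta * (psi c - psi (t m)).
Proof.
elim: m => [|m IHm]; first by rewrite !big_geq// t0; ring.
by rewrite !big_nat_recr//= IHm; ring.
Qed.

End riemann_sums.

Lemma one_powR (R : realType) (p : R) : 1 `^ p = 1 :> R.
Proof. by rewrite powR1. Qed.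

Section laplace_exponent.
Context {R : realType}.
Local Notation mu := (@lebesgue_measure R).
Variables (a c : R).
Hypothesis a0 : 0 < a.
Hypothesis a1 : a < 1.
Hypothesis c0 : 0 < c.

Definition decay (x : R) : R := x `^ (- a^-1).

Definition dissip (lambda x : R) : R := 1 - expR (- (lambda * decay x)).

Definition Psi (lambda : R) : R := \int[mu]_(x in `]c, +oo[) dissip lambda x.

Let ai1 : 1 < a^-1. Proof. by rewrite invf_gt1. Qed.

Let moy := measurable_itv_lebesgue (`]c, +oo[ : interval R).

Lemma decay_ge0 x : 0 <= decay x. Proof. exact: powR_ge0. Qed.

Lemma decay_noninc x y : 0 < x -> x <= y -> decay y <= decay x.
Proof.
move=> x0 xy; rewrite /decay !powRN lef_pV2 ?posrE ?powR_gt0 ?(lt_le_trans x0)//.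
apply: ge0_ler_powR => //; rewrite ?nnegrE ?invr_ge0 ?ltW//.
exact: lt_le_trans xy.
Qed.

Lemma measurable_decay : measurable_fun setT decay.
Proof. exact: measurable_powR. Qed.

Lemma dissip_ge0 l x : 0 <= l -> 0 <= dissip l x.
Proof.
by move=> l0; rewrite subr_ge0 -expR0 ler_expR oppr_le0 mulr_ge0 ?decay_ge0.
Qed.

Lemma dissip_noninc l x y : 0 <= l -> 0 < x -> x <= y -> dissip l y <= dissip l x.
Proof.
move=> l0 x0 xy; rewrite /dissip lerD2l lerN2 ler_expR lerN2 ler_wpM2l//.
exact: decay_noninc.
Qed.

Lemma measurable_dissip l : measurable_fun setT (dissip l).
Proof.
apply: measurable_funB => //; do 2 apply: measurableT_comp => //.
by apply: measurable_funM => //; exact: measurable_decay.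
Qed.

Lemma integrable_decay : mu.-integrable `]c, +oo[ (EFin \o decay).
Proof. exact: integrable_powR_tail. Qed.

Lemma integrable_dissip l : 0 <= l -> mu.-integrable `]c, +oo[ (EFin \o dissip l).
Proof.
move=> l0; have ig := integrable_EFinZl moy l integrable_decay.
apply: (dominated_integrable_EFin moy _ ig).
  by apply: measurable_funTS; exact: measurable_dissip.
by move=> x _; rewrite ger0_norm ?dissip_ge0// onemexpRN_le.
Qed.

Lemma Psi_ge0 l : 0 <= l -> 0 <= Psi l.
Proof. by move=> l0; apply: Rintegral_ge0 => x _; exact: dissip_ge0. Qed.

Lemma Psi_le l : 0 <= l -> Psi l <= l * (c `^ (1 - a^-1) / (a^-1 - 1)).
Proof.
move=> l0; rewrite -Rintegral_powR_tail// -RintegralZl//; last exact: integrable_decay.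
apply: le_Rintegral => //.
- exact: integrable_dissip.
- exact: (integrable_EFinZl moy l integrable_decay).
- by move=> x _; exact: onemexpRN_le.
Qed.

Let decay2 x : decay x ^+ 2 = x `^ (- (2 / a)).
Proof.
rewrite /decay -powR_mulrn ?powR_ge0// -powRrM; congr (_ `^ _).
by rewrite mulNr mulrC.
Qed.

Let two_a : 1 < 2 / a. Proof. by rewrite ltr_pdivlMr// mul1r (lt_trans a1)// ltr1n. Qed.

Lemma Psi_defect l : 0 <= l ->
  l * (c `^ (1 - a^-1) / (a^-1 - 1)) - Psi l <=
  l ^+ 2 / 2 * (c `^ (1 - 2 / a) / (2 / a - 1)).
Proof.
move=> l0; rewrite -!Rintegral_powR_tail//.
have i1 := integrable_EFinZl moy l integrable_decay.
have i2 := integrable_EFinZl moy (l ^+ 2 / 2) (integrable_powR_tail two_a c0).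
rewrite -[X in _ <= X]RintegralZl//; last exact: integrable_powR_tail.
rewrite -[X in X - _]RintegralZl//; last exact: integrable_decay.
rewrite -RintegralB//; last exact: integrable_dissip.
apply: le_Rintegral => //.
- have := integrableB moy i1 (integrable_dissip l0).
  by apply: eq_integrable.
- move=> x _; rewrite -decay2 /dissip -/(decay x).
  have y0 : 0 <= l * decay x by rewrite mulr_ge0 ?decay_ge0.
  by have := onemexpRN_ge y0; rewrite exprMn; lra.
Qed.

Lemma Psi_concave w l : 0 <= w <= 1 -> 0 <= l -> w * Psi l <= Psi (w * l).
Proof.
move=> w01 l0; have w0 : 0 <= w by case/andP: w01.
rewrite /Psi -RintegralZl//; last exact: integrable_dissip.
apply: le_Rintegral => //.
- exact: (integrable_EFinZl moy w (integrable_dissip l0)).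
- by apply: integrable_dissip; rewrite mulr_ge0.
- move=> x _; rewrite /dissip -mulrA; apply: onemexpRN_concave => //.
  by rewrite mulr_ge0 ?decay_ge0.
Qed.

Lemma integral_expRN (b : R) : 0 <= b ->
  (\int[mu]_(t in `]0%R, b]) (expR (- t))%:E = (1 - expR (- b))%:E)%E.
Proof.
rewrite le_eqVlt => /predU1P[<-|b0].
  by rewrite set_itv_ge ?bnd_simp ?ltxx// integral_set0 oppr0 expR0 subrr.
have dF (x : R) : is_derive x 1 (fun x => - expR (- x)) (expR (- x)).
  by apply: is_derive_eq; rewrite /GRing.scale/= mulrN1 opprK.
have cF := derivable_continuous (fun x => @ex_derive _ _ _ _ _ _ _ (dF x)).
have cf : continuous (fun x : R => expR (- x)).
  by move=> x; apply: continuous_comp; [exact: continuousN|exact: continuous_expR].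
rewrite integral_itv_obnd_cbnd; last first.
  apply/measurable_EFinP; apply: measurable_funTS.
  exact: continuous_measurable_fun.
rewrite (@continuous_FTC2 _ _ (fun x => - expR (- x)))//.
- by rewrite oppr0 expR0 -EFinB; congr EFin; ring.
- exact: continuous_subspaceT.
- split; first by move=> x _; exact: ex_derive.
  + by apply: cvg_at_right_filter; exact: cF.
  + by apply: cvg_at_left_filter; exact: cF.
- by move=> x _; rewrite derive1E; exact: derive_val.
Qed.

(* Layer cake: [dissip l x] is the integral of [e^(-t)] over [0 < t <= l * decay x];
   only the part [t <= 1] is kept before exchanging the integrals in [x] and [t]. *)
Let layer (l : R) (z : measurableTypeR R * measurableTypeR R) : R :=
  \1_`]c, +oo[%classic z.1 * \1_`]0, 1]%classic z.2 *
  \1_`[0, +oo[%classic (l * decay z.1 - z.2) * expR (- z.2).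

Let layer_ge0 l z : 0 <= layer l z.
Proof. by rewrite /layer !mulr_ge0// expR_ge0. Qed.

Let mindic (i : interval R) : measurable_fun setT (\1_[set` i] : measurableTypeR R -> R).
Proof. by apply: measurable_indic; exact: measurable_itv. Qed.

Let measurable_layer l : measurable_fun setT (layer l).
Proof.
apply: measurable_funM.
  apply: measurable_funM.
    apply: measurable_funM.
      exact: (measurableT_comp (mindic _) measurable_fst).
    exact: (measurableT_comp (mindic _) measurable_snd).
  apply: (measurableT_comp (mindic _)).
  apply: measurable_funB; last exact: measurable_snd.
  apply: measurable_funM => //.
  exact: (measurableT_comp (measurable_decay : measurable_fun setT (decay : measurableTypeR R -> R)) measurable_fst).
do 2 apply: measurableT_comp => //.
Qed.

Let layer_t l x : 0 <= l -> (\int[mu]_t (layer l (x, t))%:E <=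
  ((fun x => (dissip l x)%:E) \_ `]c, +oo[%classic) x)%E.
Proof.
move=> l0; rewrite patchE; case: ifPn => [xc|xc]; last first.
  rewrite integral0_eq// => t _.
  by rewrite /layer/= indicE (negbTE xc) !mul0r.
have y0 : 0 <= l * decay x by rewrite mulr_ge0 ?decay_ge0.
apply: (@le_trans _ _ (\int[mu]_(t in `]0%R, (l * decay x)%R]) (expR (- t))%:E)%E); last first.
  by rewrite integral_expRN.
rewrite [leRHS]integral_mkcond; apply: ge0_le_integral => //.
- by move=> t _; rewrite lee_fin layer_ge0.
- by apply/measurable_EFinP; exact: (measurableT_comp (@measurable_layer l)).
- apply/(measurable_restrictT _ _).1 => //; apply/measurable_EFinP.
  by do 2 apply: measurableT_comp => //.
- move=> t _; rewrite /layer/= !indicE patchE.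
  have [t1|t1] := boolP (t \in `]0, 1]%classic); last first.
    by rewrite mulr0 !mul0r; case: ifP => // _; rewrite lee_fin expR_ge0.
  have [t2|t2] := boolP (_ \in `[0, +oo[%classic); last first.
    by rewrite mulr0 !mul0r; case: ifP => // _; rewrite lee_fin expR_ge0.
  rewrite xc !mul1r ifT//.
  move: t1 t2; rewrite !inE/= !in_itv/= andbT subr_ge0 => /andP[-> _] -> //.
Qed.

(** For 0 < t <= 1 the layer condition reads x <= (l/t)^a. The lower bound on [l] keeps this
    endpoint at or above [c], so the section has length exactly (l/t)^a - c. *)
Let layer_x l t : c `^ a^-1 <= l -> (\int[mu]_x (layer l (x, t))%:E =
  ((fun t => (l `^ a * (t `^ (1 - a - 1) * expR (- t)) - c * expR (- t))%:E) \_ `]0%R, 1%R]%classic) t)%E.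
Proof.
move=> lc; rewrite patchE; case: ifPn => [t01|t01]; last first.
  rewrite integral0_eq// => x _.
  by rewrite /layer/= [\1__ t]indicE (negbTE t01) mulr0 !mul0r.
move: (t01); rewrite inE/= in_itv/= => /andP[t0 t1].
have l0 : 0 < l by rewrite (lt_le_trans _ lc)// powR_gt0.
have lt0 : 0 < l / t by rewrite divr_gt0.
have cl : c <= (l / t) `^ a.
  rewrite -[leLHS]powRr1; last exact: ltW.
  rewrite -(mulVf (lt0r_neq0 a0)) powRrM.
  apply: ge0_ler_powR; [exact: ltW|by rewrite nnegrE powR_ge0|by rewrite nnegrE ltW|].
  by rewrite (le_trans lc)// ler_pdivlMr// ler_piMr// ltW.
transitivity (\int[mu]_x ((expR (- t))%:E * (\1_(`]c, (l / t) `^ a]%classic) x)%:E))%E.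
  apply: eq_integral => x _; rewrite /layer/= -EFinM; congr EFin; rewrite mulrC; congr (_ * _).
  rewrite [\1__ t]indicE t01 mulr1 !indicE -natrM mulnb; congr (nat_of_bool _)%:R.
  apply/idP/idP.
    move=> /andP[]; rewrite !inE/= !in_itv/= !andbT subr_ge0 => cx tl.
    rewrite cx/=; have x0 : 0 < x by exact: lt_trans cx.
    have : t * x `^ a^-1 <= l.
      by move: tl; rewrite /decay powRN ler_pdivlMr// powR_gt0.
    rewrite mulrC -ler_pdivlMr// => h.
    rewrite -[leLHS]powRr1; last exact: ltW.
    rewrite -(mulVf (lt0r_neq0 a0)) powRrM.
    by apply: ge0_ler_powR => //; rewrite ?nnegrE ?powR_ge0 ?ltW.
  move=> /set_mem/=; rewrite in_itv/= => /andP[cx xl].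
  have x0 : 0 < x by exact: lt_trans cx.
  apply/andP; split; apply/mem_set; rewrite /= in_itv/= ?andbT ?subr_ge0//.
  rewrite /decay powRN ler_pdivlMr ?powR_gt0// mulrC -ler_pdivlMr//.
  rewrite -[leRHS]powRr1; last exact: ltW.
  rewrite -(mulfV (lt0r_neq0 a0)) powRrM.
  by apply: ge0_ler_powR => //; rewrite ?nnegrE ?invr_ge0 ?powR_ge0 ?ltW.
rewrite ge0_integralZl//; last by apply/measurable_EFinP; exact: mindic.
rewrite integral_indic// setIT.
have h : @lebesgue_measure R `]c, (l / t) `^ a]%classic = ((l / t) `^ a - c)%:E.
  rewrite lebesgue_measure_itv/= lte_fin; case: ltP => // le.
  by congr EFin; apply/esym/eqP; rewrite subr_eq0 eq_le cl le.
have lta : (l / t) `^ a = l `^ a * t `^ (1 - a - 1).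
  rewrite powRM ?invr_ge0 ?(ltW t0) ?(ltW l0)//; congr (_ * _).
  by rewrite -powR_inv1 ?(ltW t0)// -powRrM; congr (_ `^ _); ring.
transitivity ((expR (- t))%:E * ((l / t) `^ a - c)%:E)%E; first by congr (_ * _)%E.
by rewrite -EFinM lta; congr EFin; ring.
Qed.

Let gint (t : R) := t `^ (1 - a - 1) * expR (- t).

Let m01 := measurable_itv_lebesgue (`]0, 1] : interval R).

Lemma integrable_expRN01 : mu.-integrable `]0, 1] (EFin \o (fun t : R => expR (- t))).
Proof.
have : mu.-integrable `[0, 1] (EFin \o (fun t : R => expR (- t))).
  apply: integrable_itv_continuous => x.
  by apply: continuous_comp; [exact: continuousN|exact: continuous_expR].
by apply: integrableS => //; apply: subset_itvr; rewrite bnd_simp.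
Qed.

(** Stated in the extended reals because integrability of the integrand on the left is a consequence
    of this very bound. *)
Let tonelli_le l : c `^ a^-1 <= l ->
  (\int[mu]_(t in `]0%R, 1%R]) (l `^ a * gint t - c * expR (- t))%:E <= (Psi l)%:E)%E.
Proof.
move=> lc; have l0 : 0 <= l by rewrite (le_trans _ lc)// powR_ge0.
rewrite integral_mkcond.
rewrite -(eq_integral _ _ (fun t _ => @layer_x l t lc)).
have ml : measurable_fun setT (EFin \o layer l) by exact/measurable_EFinP.
have := @fubini_tonelli _ _ _ _ _ mu mu (EFin \o layer l) ml
  (fun z => (layer_ge0 l z : (0 <= (EFin \o layer l) z)%E)).
move=> <-; apply: (@le_trans _ _ (\int[mu]_x ((fun x => (dissip l x)%:E) \_ `]c, +oo[%classic) x)%E).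
  apply: ge0_le_integral => //.
  - by move=> x _; apply: integral_ge0 => t _; rewrite lee_fin layer_ge0.
  - apply: (measurable_fun_fubini_tonelli_F (EFin \o layer l)) => //.
    by move=> z; rewrite lee_fin layer_ge0.
  - apply/(measurable_restrictT _ _).1 => //; apply/measurable_EFinP.
    by apply: measurable_funTS; exact: measurable_dissip.
  - by move=> x _; exact: layer_t.
rewrite -integral_mkcond /Psi /Rintegral fineK//.
by apply: integrable_fin_num => //; exact: integrable_dissip.
Qed.

Let measurable_gint : measurable_fun setT gint.
Proof.
apply: measurable_funM; first exact: measurable_powR.
by do 2 apply: measurableT_comp => //.
Qed.

Let gint_ge (t : R) : 0 < t <= 1 -> expR (- t) <= gint t.
Proof.
move=> /andP[t0 t1]; rewrite /gint ler_peMl ?expR_ge0//.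
rewrite (_ : 1 - a - 1 = - a); last by ring.
rewrite powRN invf_ge1 ?powR_gt0// -[leRHS](one_powR a).
by apply: ge0_ler_powR => //; rewrite ?nnegrE ?ltW.
Qed.

Let diff_ge0 l t : c `^ a^-1 <= l -> 0 < t <= 1 -> 0 <= l `^ a * gint t - c * expR (- t).
Proof.
move=> lc t01; rewrite subr_ge0; apply: ler_pM; rewrite ?expR_ge0 ?gint_ge// ?(ltW c0)//.
rewrite -[leLHS]powRr1; last exact: ltW.
rewrite -(mulVf (lt0r_neq0 a0)) powRrM; apply: ge0_ler_powR => //.
- exact: ltW.
- by rewrite nnegrE powR_ge0.
- by rewrite nnegrE (le_trans _ lc)// powR_ge0.
Qed.

Let integrable_diff l : c `^ a^-1 <= l ->
  mu.-integrable `]0, 1] (EFin \o (fun t => l `^ a * gint t - c * expR (- t))).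
Proof.
move=> lc; apply/integrableP; split.
  apply/measurable_EFinP; apply: measurable_funTS; apply: measurable_funB.
    exact: measurable_funM.
  by apply: measurable_funM => //; do 2 apply: measurableT_comp => //.
apply: le_lt_trans (ltry (Psi l)); apply: le_trans (tonelli_le lc).
rewrite le_eqVlt; apply/orP; left; apply/eqP; apply: eq_integral => t.
rewrite inE/= in_itv/= => t01; rewrite ger0_norm//; exact: diff_ge0.
Qed.

(** The singularity at 0 is handled through the Tonelli bound rather than a primitive: at l =
    c^(1/a), where l^a = c, [gint] is recovered from the integrable difference by adding the
    exponential term and dividing by [c]. *)
Lemma integrable_lower_gamma : mu.-integrable `]0, 1] (EFin \o gint).
Proof.
have lc := lexx (c `^ a^-1).
have i1 := integrableD m01 (integrable_diff lc) (integrable_EFinZl m01 c integrable_expRN01).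
have := integrable_EFinZl m01 c^-1 i1.
apply: eq_integrable => // t _ /=; congr EFin.
rewrite subrK -powRrM mulVf ?lt0r_neq0// powRr1 ?ltW// mulKf// lt0r_neq0//.
Qed.

Lemma Rintegral_expRN01 : \int[mu]_(t in `]0, 1]) expR (- t) = 1 - expR (- 1).
Proof. by rewrite /Rintegral integral_expRN. Qed.

Lemma Psi_ge l : c `^ a^-1 <= l ->
  l `^ a * gamma_bar a - c * (1 - expR (- 1)) <= Psi l.
Proof.
move=> lc; have := tonelli_le lc.
rewrite -[X in (X <= _)%E]fineK; last first.
  by apply: integrable_fin_num => //; exact: integrable_diff.
rewrite lee_fin => h; apply: le_trans h.
rewrite -/(Rintegral mu `]0, 1] (fun t => l `^ a * gint t - c * expR (- t))).
rewrite RintegralB//; last 2 first.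
- exact: (integrable_EFinZl m01 _ integrable_lower_gamma).
- exact: (integrable_EFinZl m01 _ integrable_expRN01).
rewrite RintegralZl//; last exact: integrable_lower_gamma.
rewrite RintegralZl//; last exact: integrable_expRN01.
by rewrite Rintegral_expRN01.
Qed.

(** The integrands satisfy exp(-t) <= [gint t]; strictness, which gives the sign of [g_bar], comes
    from a uniform gap on ]0, 1/2]. *)
Lemma gamma_bar_gt : 1 - expR (- 1) < gamma_bar a.
Proof.
rewrite -subr_gt0 -Rintegral_expRN01 /gamma_bar /lower_gamma -/gint.
rewrite -RintegralB//; [|exact: integrable_lower_gamma|exact: integrable_expRN01].
(* For t <= 1/2 one has t^(-a) >= 2^a and exp(-t) >= exp(-1), so [k] bounds the gap from below. *)
pose k : R := (2 `^ a - 1) * expR (- 1).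
have k0 : 0 < k.
  rewrite mulr_gt0 ?expR_gt0// subr_gt0 -[ltLHS](one_powR a).
  by apply: gt0_ltr_powR => //; rewrite ?nnegrE// ltr1n.
have ih : mu.-integrable `]0, 1] (EFin \o (\1_`]0, 2^-1]%classic : R -> R)).
  apply: (dominated_integrable_EFin m01 _ (integrable_EFinZl m01 (expR 1) integrable_expRN01)) => //.
  move=> t /=; rewrite in_itv/= => /andP[t0 t1].
  rewrite -expRD ger0_norm ?indicE ?ler0n//.
  apply: (@le_trans _ _ 1); first by case: (_ \in _).
  by rewrite -{1}expR0 ler_expR subr_ge0.
apply: (@lt_le_trans _ _ (\int[mu]_(t in `]0, 1]) (k * \1_`]0, 2^-1]%classic t))).
  have mh : measurable (`]0, 2^-1]%classic : set (measurableTypeR R)) by exact: measurable_itv.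
  rewrite RintegralZl// mulr_gt0// /Rintegral integral_indic//.
  rewrite (_ : _ `&` _ = `]0, 2^-1]%classic); last first.
    apply/setIidl => x /=; rewrite !in_itv/= => /andP[-> x2]/=.
    by rewrite (le_trans x2)// invf_le1// ler1n.
  have : 0 < fine (@lebesgue_measure R `]0, 2^-1]%classic).
    by rewrite lebesgue_measure_itv/= lte_fin invr_gt0 ltr0n/= oppr0 addr0 invr_gt0.
  by [].
apply: le_Rintegral => //.
- exact: (integrable_EFinZl m01 k ih).
- have := integrableB m01 integrable_lower_gamma integrable_expRN01.
  by apply: eq_integrable.
move=> t /=; rewrite in_itv/= => t01; have /andP[t0 t1] := t01.
rewrite indicE; have [/set_mem/=|_] := boolP (t \in _); last first.
  by rewrite mulr0 subr_ge0 gint_ge.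
rewrite in_itv/= mulr1 => /andP[_ t2].
rewrite /gint -{2}[expR (- t)]mul1r -mulrBl; apply: ler_pM.
- by rewrite -(pmulr_lge0 _ (expR_gt0 (- 1))) ltW.
- exact: expR_ge0.
- rewrite lerD2r (_ : 1 - a - 1 = - a); last by ring.
  rewrite powRN -[leLHS]invrK lef_pV2 ?posrE ?invr_gt0 ?powR_gt0//.
  rewrite -powRN -mulN1r powRrM powR_inv1//.
  by apply: ge0_ler_powR => //; rewrite ?nnegrE ?ltW.
- by rewrite ler_expR lerN2.
Qed.

Lemma g_bar_lt0 : g_bar a < 0.
Proof.
rewrite /g_bar /gfun one_powR mul1r -/(gamma_bar a) subr_lt0; exact: gamma_bar_gt.
Qed.

Lemma g_barE : g_bar a = 1 - expR (- 1) - gamma_bar a.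
Proof. by rewrite /g_bar /gfun one_powR mul1r. Qed.

Let powa (w : R) : 0 <= w -> (w * c `^ a^-1) `^ a = w `^ a * c.
Proof.
move=> w0; rewrite powRM ?powR_ge0// -powRrM mulVf ?lt0r_neq0// powRr1// ltW//.
Qed.

(* Majorant of [exp (- Psi lambda)] at [lambda = w * c `^ a^-1]. *)
Definition expPsi_ub (w : R) : R :=
  if w <= 1 then expR ((c - 1) * g_bar a * w)
  else expR ((c - 1) * (1 - expR (- 1))) * expR (- ((c - 1) * gamma_bar a * w `^ a)).

Hypothesis c1 : 1 < c.

(** Both regimes first produce [c] times a nonnegative quantity as a lower bound of [Psi]; lowering
    [c] to [c - 1] weakens it to the shape found in [B1]. *)
Lemma expPsi_le (w : R) : 0 < w -> expR (- Psi (w * c `^ a^-1)) <= expPsi_ub w.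
Proof.
move=> w0; rewrite /expPsi_ub; have g0 := g_bar_lt0; have c10 : 0 < c - 1 by rewrite subr_gt0.
have gb := gamma_bar_gt.
have P1 := Psi_ge (lexx (c `^ a^-1)).
have [w1|w1] := leP w 1.
  rewrite ler_expR lerNl.
  apply: le_trans (Psi_concave _ _); rewrite ?w1 ?(ltW w0) ?powR_ge0//.
  apply: (@le_trans _ _ (w * (c * - g_bar a))).
    rewrite (_ : - ((c - 1) * g_bar a * w) = w * ((c - 1) * - g_bar a)); last by ring.
    by rewrite ler_wpM2l ?(ltW w0)// ler_wpM2r ?oppr_ge0 ?(ltW g0)// gerBl.
  rewrite ler_wpM2l ?(ltW w0)//; apply: le_trans P1.
  rewrite -[X in X `^ a]mul1r powa// one_powR mul1r g_barE.
  by rewrite -mulrBr ler_wpM2l ?(ltW c0)//; lra.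
rewrite -expRD ler_expR lerNl.
have lc : c `^ a^-1 <= w * c `^ a^-1 by rewrite ler_peMl ?powR_ge0// ltW.
apply: le_trans (Psi_ge lc); rewrite powa ?(ltW w0)//.
have wa1 : 1 <= w `^ a.
  by rewrite -[leLHS](one_powR a); apply: ge0_ler_powR => //; rewrite ?nnegrE ?ltW.
rewrite (_ : - (_ + - _) = (c - 1) * (w `^ a * gamma_bar a - (1 - expR (- 1)))); last first.
  by rewrite opprB; ring.
rewrite (_ : w `^ a * c * _ - _ = c * (w `^ a * gamma_bar a - (1 - expR (- 1)))); last by ring.
rewrite ler_wpM2r ?gerBl//.
rewrite subr_ge0 (le_trans (ltW gb))// ler_peMl// (le_trans _ (ltW gb))//.
Qed.

Lemma expPsi_defect (w : R) : 0 < w ->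
  expR (- Psi (w * c `^ a^-1)) -
  expR (- (w * c `^ a^-1 * (c `^ (1 - a^-1) / (a^-1 - 1)))) <=
  c * (a / (2 * (2 - a))) * (w ^+ 2 * expPsi_ub w).
Proof.
move=> w0; have l0 : 0 <= w * c `^ a^-1 by rewrite mulr_ge0 ?powR_ge0// ltW.
apply: le_trans (expRN_diff_le (Psi_le l0)) _.
have -> : c * (a / (2 * (2 - a))) * (w ^+ 2 * expPsi_ub w) =
    expPsi_ub w * (c * (a / (2 * (2 - a))) * w ^+ 2) by ring.
apply: ler_pM; rewrite ?expR_ge0 ?subr_ge0 ?Psi_le ?expPsi_le//.
apply: le_trans (Psi_defect l0) _.
(* The powers of [c] from the squared argument and from [Psi_defect] have exponents adding up to 1,
   whence the single factor [c] in the bound. *)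
have ce : (c `^ a^-1) ^+ 2 * c `^ (1 - 2 / a) = c.
  rewrite -powR_mulrn ?powR_ge0// -powRrM -powRD ?lt0r_neq0 ?implybT//.
  by rewrite (_ : a^-1 * 2 + (1 - 2 / a) = 1) ?powRr1 ?ltW//; field; rewrite lt0r_neq0.
have a2 : 2 - a != 0 by rewrite lt0r_neq0// subr_gt0 (lt_trans a1)// ltr1n.
have ane : a != 0 by rewrite lt0r_neq0.
rewrite exprMn -[leLHS]/(_ * _ / 2 * _).
have -> : c * (a / (2 * (2 - a))) * w ^+ 2 =
    (c `^ a^-1) ^+ 2 * c `^ (1 - 2 / a) * (w ^+ 2 / (2 * (2 / a - 1))).
  rewrite ce; field.
  by rewrite ane mulN1r.
rewrite le_eqVlt; apply/orP; left; apply/eqP.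
field.
by rewrite ane mulN1r.
Qed.

End laplace_exponent.

Section gamma_tail.
Context {R : realType}.
Local Notation mu := (@lebesgue_measure R).

Lemma powR_continuous_pos (p x : R) : 0 < x -> {for x, continuous (@powR R ^~ p)}.
Proof.
move=> x0; apply: differentiable_continuous; apply/derivable1_diffP.
by apply: derivable_powR; rewrite in_itv/= x0.
Qed.

(** The right-hand side is the value at the maximiser v = q; the inequality is ln z <= z - 1 at z =
    v / q. *)
Lemma powR_expRN_le (q v : R) : 0 < q -> 0 < v ->
  v `^ q * expR (- v) <= expR (q * ln q - q).
Proof.
move=> q0 v0; rewrite /powR (gt_eqF v0) -expRD ler_expR.
have vq : 0 < v / q by rewrite divr_gt0.
have h : ln (v / q) <= v / q - 1.
  by rewrite -ler_expR lnK ?posrE//; have := expR_ge1Dx (v / q - 1); lra.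
rewrite ln_div ?posrE// in h.
have := ler_wpM2l (ltW q0) h.
by rewrite !mulrBr mulrCA mulfV ?lt0r_neq0//; lra.
Qed.

Lemma integrable_upper_gamma (p x : R) : 0 < p -> 0 < x ->
  mu.-integrable `[x, +oo[ (EFin \o (fun v : R => v `^ (p - 1) * expR (- v))).
Proof.
move=> p0 x0; have p1 : 0 < p + 1 by rewrite addr_gt0.
(* The power tail is integrable on an open ray; starting it at [x / 2] covers the closed ray from
   [x]. *)
have x20 : 0 < x / 2 by rewrite divr_gt0.
pose m2 := measurable_itv_lebesgue (`]x / 2, +oo[ : interval R).
suff : mu.-integrable `]x / 2, +oo[ (EFin \o (fun v : R => v `^ (p - 1) * expR (- v))).
  apply: integrableS => //.
  by apply: subset_itvr; rewrite bnd_simp; lra.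
have i2 : mu.-integrable `]x / 2, +oo[ (EFin \o (fun v : R => v `^ (- 2))).
  by apply: integrable_powR_tail => //; rewrite ltr1n.
(* Splitting v^(p-1) as v^(p+1) v^(-2) leaves the maximum of v^(p+1) exp(-v) as the constant. *)
apply: (dominated_integrable_EFin m2 _
  (integrable_EFinZl m2 (expR ((p + 1) * ln (p + 1) - (p + 1))) i2)).
  apply: measurable_funTS; apply: measurable_funM; first exact: measurable_powR.
  by do 2 apply: measurableT_comp => //.
move=> v /=; rewrite in_itv/= andbT => xv; have v0 : 0 < v := lt_trans x20 xv.
rewrite ger0_norm ?mulr_ge0 ?powR_ge0 ?expR_ge0//.
rewrite (_ : p - 1 = p + 1 + - 2); last by ring.
rewrite powRD ?(gt_eqF v0) ?implybT// mulrAC.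
by rewrite ler_wpM2r ?powR_ge0// powR_expRN_le.
Qed.

End gamma_tail.

(** * Integral of the majorant *)

Section majorant_integral.
Context {R : realType}.
Local Notation mu := (@lebesgue_measure R).
Variables (a c rho : R).
Hypothesis a0 : 0 < a.
Hypothesis a1 : a < 1.
Hypothesis c1 : 1 < c.
Hypothesis rho0 : 0 < rho.

(* The substitution is [w = rho * r ^+ 2]; [w = 1], where the two regimes of
   [expPsi_ub] meet, corresponds to [r = r0]. *)
Let b := (c - 1) * g_bar a.
Let G0 := (c - 1) * gamma_bar a.
Let r0 := (Num.sqrt rho)^-1.

Let c10 : 0 < c - 1. Proof. by rewrite subr_gt0. Qed.
Let c0 : 0 < c. Proof. exact: lt_trans c1. Qed.
Let b0 : b != 0.
Proof. by rewrite mulf_neq0// ?(gt_eqF c10)// (lt_eqF (g_bar_lt0 a0 a1 c0)). Qed.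
Let gamma_bar_gt0 : 0 < gamma_bar a.
Proof.
apply: lt_trans (gamma_bar_gt a0 a1 c0).
by rewrite subr_gt0 -expR0 ltr_expR oppr_lt0.
Qed.
Let G00 : 0 < G0. Proof. by rewrite mulr_gt0. Qed.
Let r00 : 0 < r0. Proof. by rewrite invr_gt0 sqrtr_gt0. Qed.
Let rho_r0 : rho * r0 ^+ 2 = 1.
Proof. by rewrite exprVn sqr_sqrtr ?mulfV ?lt0r_neq0// ltW. Qed.

Let head (r : R) := rho ^+ 2 * r ^+ 3 * expR (b * (rho * r ^+ 2)).

(** In the variable w, [head] integrates w exp(b w) dw / 2, and integration by parts gives this
    primitive. *)
Let prim (r : R) := (rho * r ^+ 2 / b - (b ^+ 2)^-1) / 2 * expR (b * (rho * r ^+ 2)).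

Let is_derive_prim (r : R) : is_derive r 1 prim (head r).
Proof.
rewrite /prim /head; apply: is_derive_eq; rewrite /GRing.scale/=.
by field.
Qed.

Let continuous_head : continuous head.
Proof.
by apply: derivable_continuous => r; exact: ex_derive.
Qed.

Lemma Rintegral_head : \int[mu]_(r in `[0, r0]) head r =
  ((b ^+ 2)^-1 + (b^-1 - (b ^+ 2)^-1) * expR b) / 2.
Proof.
have cF := derivable_continuous (fun x => @ex_derive _ _ _ _ _ _ _ (is_derive_prim x)).
rewrite /Rintegral (@continuous_FTC2 _ _ prim)//.
- by rewrite -EFinB/= /prim rho_r0 mulr1 expr0n/= !mulr0 expR0; field.
- exact: continuous_subspaceT.
- split; first by move=> x _; exact: ex_derive.
  + by apply: cvg_at_right_filter; exact: cF.
  + by apply: cvg_at_left_filter; exact: cF.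
- by move=> x _; rewrite derive1E; exact: derive_val.
Qed.

Let tail (r : R) := rho ^+ 2 * r ^+ 3 * expR (- (G0 * (rho * r ^+ 2) `^ a)).

(** The substitution v = G0 w^a, which sends [r0] to [G0] and turns [tail] into the integrand [G] of
    the upper gamma function. *)
Let F (r : R) := G0 * rho `^ a * r `^ (2 * a).
Let F' (r : R) := G0 * rho `^ a * (2 * a * r `^ (2 * a - 1)).
Let G (v : R) := v `^ (2 / a - 1) * expR (- v).
Let q0 : 0 < G0 * rho `^ a. Proof. by rewrite mulr_gt0// powR_gt0. Qed.

Let FE (r : R) : 0 < r -> F r = G0 * (rho * r ^+ 2) `^ a.
Proof.
move=> r_gt0; rewrite /F powRM ?exprn_ge0 ?ltW// mulrA; congr (_ * _).
by rewrite -powR_mulrn ?ltW// -powRrM.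
Qed.

Let is_derive_F (r : R) : 0 < r -> is_derive r 1 F (F' r).
Proof. move=> r_gt0.
exact: (is_deriveZ (G0 * rho `^ a) (is_derive1_powR (2 * a) r_gt0)). Qed.

Let derive1_F (r : R) : 0 < r -> derive1 F r = F' r.
Proof.
by move=> r_gt0; rewrite derive1E; have h := is_derive_F r_gt0; exact: derive_val.
Qed.

Let continuous_F' (r : R) : 0 < r -> {for r, continuous F'}.
Proof.
move=> r_gt0; apply: cvgM; first exact: cvg_cst.
by apply: cvgM; [exact: cvg_cst|exact: powR_continuous_pos].
Qed.

Let continuous_F (r : R) : 0 < r -> {for r, continuous F}.
Proof.
by move=> r_gt0; apply: cvgM; [exact: cvg_cst|exact: powR_continuous_pos].
Qed.

Let near_pos (r : R) : 0 < r -> \forall x \near r, 0 < x.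
Proof. by move=> r_gt0; exact: lt_nbhsr. Qed.

Let continuous_derive1_F (r : R) : 0 < r -> {for r, continuous (derive1 F)}.
Proof.
move=> r_gt0; rewrite /prop_for /continuous_at derive1_F//.
apply: cvg_trans (continuous_F' r_gt0).
by apply: near_eq_cvg; near=> x; rewrite derive1_F//; near: x; exact: near_pos.
Unshelve. all: by end_near. Qed.

Let continuous_G (v : R) : 0 < v -> {for v, continuous G}.
Proof.
move=> v_gt0; apply: cvgM; first exact: powR_continuous_pos.
by apply: continuous_comp; [exact: continuousN|exact: continuous_expR].
Qed.

Let F_r0 : F r0 = G0.
Proof. by rewrite FE// rho_r0 one_powR mulr1. Qed.

(** Here dv/v = 2a dr/r and v^(2/a) = G0^(2/a) w^2, which accounts for the constant. *)
Let GF (r : R) : 0 < r -> G (F r) * F' r = 2 * a * G0 `^ (2 / a) * tail r.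
Proof.
move=> r_gt0; have F_gt0 : 0 < F r by rewrite mulr_gt0 ?powR_gt0.
have F'E : F' r = 2 * a * F r / r.
  rewrite /F' /F powRD ?(gt_eqF r_gt0) ?implybT// powR_inv1 ?ltW//; ring.
have FpE : F r `^ (2 / a) = G0 `^ (2 / a) * (rho ^+ 2 * r ^+ 4).
  rewrite FE// powRM ?powR_ge0 ?ltW//; congr (_ * _).
  rewrite -powRrM [a * _]mulrC divfK ?lt0r_neq0// powR_mulrn ?mulr_ge0 ?exprn_ge0 ?ltW//.
  by ring.
rewrite /G F'E powRD ?(gt_eqF F_gt0) ?implybT// powR_inv1 ?ltW// FpE /tail -FE//.
by field; rewrite !lt0r_neq0.
Qed.

Let F_homo (x y : R) : 0 <= x -> x < y -> F x < F y.
Proof.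
move=> x0 xy; rewrite /F ltr_pM2l// gt0_ltr_powR ?mulr_gt0// nnegrE//.
by rewrite ltW// (le_lt_trans x0).
Qed.

Let integrable_tail (m : R) : r0 <= m -> mu.-integrable `[r0, m] (EFin \o tail).
Proof.
move=> r0m.
have ct : {within `[r0, m], continuous tail}.
  apply: continuous_in_subspaceT => x; rewrite inE/= in_itv/= => /andP[x1 _].
  have x0 : 0 < x := lt_le_trans r00 x1.
  have cx2 : {for x, continuous (fun r : R => rho * r ^+ 2)}.
    by apply: cvgM; [exact: cvg_cst|exact: exprn_continuous].
  apply: cvgM; first by apply: cvgM; [exact: cvg_cst|exact: exprn_continuous].
  apply: (@continuous_comp _ _ _ (fun r : R => - (G0 * (rho * r ^+ 2) `^ a))); last exact: continuous_expR.
  apply: cvgN; apply: cvgM; first exact: cvg_cst.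
  apply: (@continuous_comp _ _ _ (fun r : R => rho * r ^+ 2) (@powR R ^~ a)) => //.
  by apply: powR_continuous_pos; rewrite mulr_gt0// exprn_gt0.
by apply: continuous_compact_integrable => //; exact: segment_compact.
Qed.

(** The substitution is made on a bounded interval; extending the resulting nonnegative integrand to
    the whole ray gives the inequality. *)
Lemma Rintegral_tail_le (m : R) : r0 <= m ->
  \int[mu]_(r in `[r0, m]) tail r <=
  (2 * a * G0 `^ (2 / a))^-1 * upper_gamma (2 / a) G0.
Proof.
move=> r0m; have m0 : 0 < m := lt_le_trans r00 r0m.
have K0 : 0 < 2 * a * G0 `^ (2 / a) by rewrite !mulr_gt0// powR_gt0.
have it := integrable_tail r0m.
rewrite ler_pdivlMl// -RintegralZl//.
have subst : (\int[mu]_(x in `[F r0, F m]) (G x)%:E =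
    \int[mu]_(x in `[r0, m]) (((G \o F) * (derive1 F)) x)%:E)%E.
  apply: integration_by_substitution_increasing => //.
  - move=> x y; rewrite !in_itv/= => /andP[x1 _] _; apply: F_homo.
    by rewrite (le_trans (ltW r00)).
  - move=> x; rewrite in_itv/= => /andP[x1 _].
    by apply: continuous_derive1_F; rewrite (lt_trans r00).
  - apply/cvg_ex; exists (derive1 F r0); apply: cvg_at_right_filter.
    exact: continuous_derive1_F.
  - apply/cvg_ex; exists (derive1 F m); apply: cvg_at_left_filter.
    exact: continuous_derive1_F.
  - split.
    + move=> x; rewrite in_itv/= => /andP[x1 _].
      by have h := is_derive_F (lt_trans r00 x1); exact: ex_derive.
    + by apply: cvg_at_right_filter; exact: continuous_F.
    + by apply: cvg_at_left_filter; exact: continuous_F.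
  - apply: continuous_in_subspaceT => x; rewrite inE/= in_itv/= => /andP[x1 _].
    by apply: continuous_G; rewrite (lt_le_trans _ x1)// F_r0.
rewrite /Rintegral.
have -> : (\int[mu]_(x in `[r0, m]) (2 * a * G0 `^ (2 / a) * tail x)%:E =
    \int[mu]_(x in `[F r0, F m]) (G x)%:E)%E.
  rewrite subst; apply: eq_integral => x; rewrite inE/= in_itv/= => /andP[x1 _].
  have x0 : 0 < x := lt_le_trans r00 x1.
  by congr EFin; rewrite -GF// -derive1_F.
have iG : mu.-integrable `[G0, +oo[ (EFin \o G).
  by apply: integrable_upper_gamma => //; rewrite divr_gt0.
rewrite /upper_gamma /Rintegral -/G fine_le//.
- apply: integrable_fin_num => //; apply: integrableS iG => //.
  by rewrite F_r0; apply: subset_itvl; rewrite bnd_simp.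
- by apply: integrable_fin_num.
rewrite F_r0; apply: ge0_subset_integral => //.
- by have := measurable_int _ iG.
- by move=> x _; rewrite lee_fin mulr_ge0 ?powR_ge0 ?expR_ge0.
- by apply: subset_itvl; rewrite bnd_simp.
Qed.

Let A := (c - 1) * (1 - expR (- 1)).

Let J := (b ^+ 2)^-1 + (b^-1 - (b ^+ 2)^-1) * expR b +
  expR A / (a * G0 `^ (2 / a)) * upper_gamma (2 / a) G0.

Lemma Rintegral_majorant_le (C : R) (g : R -> R) : 0 <= C ->
  mu.-integrable `]0, +oo[ (EFin \o g) ->
  (forall r, 0 < r -> g r <= C * ((rho * r ^+ 2) ^+ 2 * expPsi_ub a c (rho * r ^+ 2)) / r) ->
  \int[mu]_(r in `]0, +oo[) g r <= C * J / 2.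
Proof.
move=> C0 ig g_ub.
have m0y := measurable_itv_lebesgue (`]0, +oo[ : interval R).
(* The tail estimate is uniform over bounded intervals, so the half-line is exhausted by intervals
   reaching beyond [r0]. *)
have cv : \int[mu]_(r in `]0, r0 + n%:R]) g r @[n --> \oo] --> \int[mu]_(r in `]0, +oo[) g r.
  apply: (cvg_Rintegral_bigcup m0y) => // [n|x /=].
  - by apply: subset_itvl; rewrite bnd_simp.
  - rewrite in_itv/= andbT => x0; near=> n; rewrite /= in_itv/= x0/=.
    rewrite (@le_trans _ _ n%:R)// ?lerDr ?(ltW r00)//.
    by near: n; exact: nbhs_infty_ger.
rewrite -(cvg_lim _ cv)//; apply: limr_le; first by apply/cvg_ex; exists (\int[mu]_(r in `]0, +oo[) g r).
apply: nearW => n; set m := r0 + n%:R.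
have r0m : r0 <= m by rewrite lerDl ler0n.
have im : mu.-integrable `]0, m] (EFin \o g).
  by apply: integrableS ig => //; apply: subset_itvl; rewrite bnd_simp.
have -> : \int[mu]_(r in `]0, m]) g r =
    \int[mu]_(r in `]0, r0]) g r + \int[mu]_(r in `]r0, m]) g r.
  by apply/eqP; rewrite addrC -subr_eq (Rintegral_itvB im)// bnd_simp ltW.
have -> : C * J / 2 = C * (((b ^+ 2)^-1 + (b^-1 - (b ^+ 2)^-1) * expR b) / 2) +
    C * expR A * ((2 * a * G0 `^ (2 / a))^-1 * upper_gamma (2 / a) G0).
  have Gp : G0 `^ (2 / a) != 0 by rewrite gt_eqF// powR_gt0.
  have ane : a != 0 by rewrite gt_eqF.
  by rewrite /J; field; rewrite ?b0 ?ane ?Gp.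
apply: lerD.
- rewrite -Rintegral_head.
  have ih : mu.-integrable `[0, r0] (EFin \o head) by exact: integrable_itv_continuous.
  have ih' : mu.-integrable `]0, r0] (EFin \o head).
    by apply: integrableS ih => //; apply: subset_itvr; rewrite bnd_simp.
  rewrite -Rintegral_itv_obnd_cbnd// -RintegralZl//.
  apply: le_Rintegral => //.
  + by apply: integrableS im => //; apply: subset_itvl; rewrite bnd_simp.
  + exact: (integrable_EFinZl _ C ih').
  move=> r /=; rewrite in_itv/= => /andP[r_gt0 rr0].
  apply: le_trans (g_ub _ r_gt0) _; rewrite /expPsi_ub ifT; last first.
    by rewrite -rho_r0 ler_pM2l// ler_sqr ?nnegrE ?(ltW r_gt0) ?(ltW r00).
  rewrite le_eqVlt; apply/orP; left; apply/eqP.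
  by rewrite /head; field; rewrite lt0r_neq0.
- apply: le_trans (_ : C * expR A * \int[mu]_(r in `[r0, m]) tail r <= _); last first.
    by apply: ler_wpM2l; [rewrite mulr_ge0 ?expR_ge0|exact: Rintegral_tail_le].
  have it := integrable_tail r0m.
  have it' : mu.-integrable `]r0, m] (EFin \o tail).
    by apply: integrableS it => //; apply: subset_itvr; rewrite bnd_simp.
  rewrite -Rintegral_itv_obnd_cbnd// -RintegralZl//.
  apply: le_Rintegral => //.
  + by apply: integrableS im => //; apply: subset_itvr; rewrite bnd_simp ltW.
  + exact: (integrable_EFinZl _ (C * expR A) it').
  move=> r /=; rewrite in_itv/= => /andP[r_gt _]; have r_gt0 := lt_trans r00 r_gt.
  apply: le_trans (g_ub _ r_gt0) _; rewrite /expPsi_ub ifF; last first.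
    by apply/negbTE; rewrite -ltNge -rho_r0 ltr_pM2l// ltr_sqr ?nnegrE ?(ltW r_gt0) ?(ltW r00).
  rewrite le_eqVlt; apply/orP; left; apply/eqP.
  by rewrite /tail -/A -/G0; field; rewrite lt0r_neq0.
Unshelve. all: by end_near. Qed.

Lemma majorant_constant_le_B1 (alpha : R) : alpha / 2 = a ->
  pi^-1 * (c * (a / (2 * (2 - a))) * J / 2) <= B1 c alpha.
Proof.
move=> aE; have J0 : 0 <= J.
  rewrite /J addr_ge0//.
    (* The closed form mixes signs because [b] is negative; its sign is read off the integral it
       came from. *)
    rewrite -(@pmulr_lge0 _ 2^-1)// -Rintegral_head.
    apply: Rintegral_ge0 => r /=; rewrite in_itv/= => /andP[r_ge0 _].
    by rewrite !mulr_ge0 ?expR_ge0 ?exprn_ge0// ltW.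
  rewrite mulr_ge0 ?divr_ge0 ?mulr_ge0 ?expR_ge0 ?powR_ge0 ?(ltW a0)//.
  by apply: Rintegral_ge0 => v _; rewrite mulr_ge0 ?powR_ge0 ?expR_ge0.
have g0 : g_bar a != 0 by rewrite (lt_eqF (g_bar_lt0 a0 a1 c0)).
(* [J] is the bracket of [B1] divided by [c - 1]. *)
have -> : B1 c alpha = c * Kconst a * J.
  rewrite /B1 aE -/b -/G0 -/A /J /b.
  have Gp : G0 `^ (2 / a) != 0 by rewrite gt_eqF// powR_gt0.
  have ane : a != 0 by rewrite gt_eqF.
  have cne : c - 1 != 0 by rewrite gt_eqF.
  by field; rewrite ?g0 ?ane ?Gp ?cne.
have pi0 := @pi_gt0 R.
have a2 : 0 < 2 - a by rewrite subr_gt0 (lt_trans a1)// ltr1n.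
rewrite /Kconst; set k := a / _.
have k0 : 0 <= k by rewrite divr_ge0 ?mulr_ge0 ?ltW.
rewrite (_ : pi^-1 * _ = c * (pi^-1 * (k / 2)) * J); last by ring.
apply: ler_wpM2r => //; apply: ler_wpM2l; first exact: ltW.
apply: ler_wpM2l; first by rewrite invr_ge0 ltW.
by have : 0 <= (eta a ^+ 2)^-1; [rewrite invr_ge0 sqr_ge0|lra].
Qed.

End majorant_integral.

(** * Distribution functions *)

Section cdf_facts.
Context {R : realType}.

Lemma fin_num_cdf d (T : measurableType d) (P : probability T R) (X : {RV P >-> R}) x :
  (cdf X x \is a fin_num)%E.
Proof. by rewrite fin_num_measure. Qed.

Lemma fine_cdf_homo d (T : measurableType d) (P : probability T R) (X : {RV P >-> R}) :
  {homo (fine \o cdf X) : x y / x <= y}.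
Proof. by move=> x y xy /=; rewrite fine_le ?fin_num_cdf// cdf_nondecreasing. Qed.

Lemma fine_cdfE d (T : measurableType d) (P : probability T R) (X : {RV P >-> R}) x :
  fine (cdf X x) = \int[P]_w \1_(X @^-1` `]-oo, x]) w.
Proof.
rewrite /Rintegral integral_indic//; first by rewrite setIT.
by rewrite -[X in measurable X]setTI; exact: measurable_funP.
Qed.

Lemma cdf_scale d (T : measurableType d) (P : probability T R) (X : {RV P >-> R}) k x :
  0 < k -> cdf (scale_mfun k X : {RV P >-> R}) x = cdf X (x / k).
Proof.
move=> k0; rewrite /cdf /distribution /pushforward; congr (P _).
apply/seteqP; split => w /=; rewrite !in_itv/= ler_pdivlMr//.
Qed.

(** Since the variables become pointwise stationary, the indicators converge at every [x], including
    discontinuity points of the limit. *)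
Lemma cvg_cdf_stable d (T : measurableType d) (P : probability T R)
    (X_ : nat -> {RV P >-> R}) (X : {RV P >-> R}) x :
  (forall w, \forall n \near \oo, X_ n w = X w) ->
  fine (cdf (X_ n) x) @[n --> \oo] --> fine (cdf X x).
Proof.
move=> X_X; rewrite fine_cdfE; under eq_fun do rewrite fine_cdfE.
apply: (@dominated_cvg_Rintegral _ _ _ _ _ _ _ _ (cst 1)) => //.
- move=> n; apply: measurable_indic.
  by rewrite -[X in measurable X]setTI; exact: measurable_funP.
- by apply: (@bounded_integrable _ _ _ _ _ 1) => // w; rewrite normr1.
- move=> w _; apply: cvg_near_cst; have := X_X w.
  apply: filterS => n Xn; rewrite !indicE; congr (nat_of_bool _)%:R.
  by apply/idP/idP => /set_mem h; apply/mem_set; move: h; rewrite /= Xn.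
- by move=> n w _; rewrite ger0_norm ?indicE//; case: (_ \in _).
Qed.

Lemma le_cdf_right d (T : measurableType d) (P : probability T R) (X : {RV P >-> R})
    (x u v : R) :
  (forall e, 0 < e -> u <= fine (cdf X (x + e)) + v) -> u <= fine (cdf X x) + v.
Proof.
move=> h; apply/ler_addgt0Pr => e e0.
have cv : fine (cdf X y) @[y --> x^'+] --> fine (cdf X x).
  apply: fine_cvg; rewrite fineK ?fin_num_cdf//; exact: cdf_right_continuous.
have lt : \forall y \near x^'+, fine (cdf X y) < fine (cdf X x) + e.
  by apply: (cvgr_lt _ cv); rewrite ltrDl.
near x^'+ => y.
have ye : fine (cdf X y) < fine (cdf X x) + e by near: y.
have xy : x < y by near: y; exact: nbhs_right_gt.
have := h (y - x); rewrite subr_gt0 subrKC => /(_ xy); lra.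
Unshelve. all: by end_near. Qed.

(** A monotone function has countably many discontinuities, too few to fill an interval of positive
    measure. *)
Lemma exists_cdf_continuous d (T : measurableType d) (P : probability T R)
    (X : {RV P >-> R}) (a b : R) : a < b ->
  exists2 y, a < y < b & {for y, continuous (cdf X)}.
Proof.
move=> ab; pose F := fine \o cdf X.
have nd : {in `[a, b] &, nondecreasing_fun F} by move=> x y _ _; exact: fine_cdf_homo.
have cD := discontinuity_countable nd.
have [y /= [yab yD]] : exists y, (y \in `]a, b[) /\ ~ discontinuity F y.
  apply/not_existsP => h.
  have sub : `]a, b[%classic `<=` [set x | (x \in `]a, b[) /\ discontinuity F x].
    move=> y /= yab; split => //; apply: contrapT => nD.
    by apply: (h y).
  have := countable_lebesgue_measure0 (sub_countable (subset_card_le sub) cD).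
  rewrite lebesgue_measure_itv/= lte_fin ab => /eqP.
  by rewrite -EFinB eqe subr_eq0 gt_eqF.
exists y; first by move: yab; rewrite in_itv.
have Fr : F z @[z --> y^'+] --> F y.
  by apply: fine_cvg; rewrite fineK ?fin_num_cdf//; exact: cdf_right_continuous.
have Fl : cvg (F z @[z --> y^'-]).
  apply: (@nondecreasing_at_left_is_cvgr _ F y).
    by near=> z => s t _ _; exact: fine_cdf_homo.
  by near=> z; exists (F y) => _ [s + <-]; rewrite /= in_itv/= => /andP[_ /ltW]; exact: fine_cdf_homo.
have FlE : lim (F z @[z --> y^'-]) = F y.
  rewrite -(cvg_lim _ Fr)//; apply/eqP/negP => /negP h; apply: yD; split => //.
  by apply/cvg_ex; exists (F y).
have cF : {for y, continuous F}.
  apply/left_right_continuousP; split => //.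
  by rewrite -[X in _ --> X]FlE.
have -> : cdf X = EFin \o F by apply/funext => z /=; rewrite fineK ?fin_num_cdf.
by apply: continuous_comp => //; exact: cvg_EFin.
Unshelve. all: by end_near. Qed.

End cdf_facts.

(** * Laplace transform of the Poisson shot noise *)

Section laplace_bounds.
Context d (T : measurableType d) (R : realType) (P : probability T R).
Local Notation mu := (@lebesgue_measure R).
Variable N : R -> {RV P >-> nat}.
Hypothesis hN : is_poisson_process 1 N.
Variable Gam : nat -> {RV P >-> R}.
Hypothesis hGam : forall j w, Gam j w = arrival_time N j w.
Variables a c : R.
Hypothesis a0 : 0 < a.
Hypothesis a1 : a < 1.
Hypothesis c0 : 0 < c.
Variable l : R.
Hypothesis l0 : 0 <= l.

Let c_ge0 : 0 <= c. Proof. exact: ltW. Qed.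

Let decay_c x y : c <= x -> x <= y -> decay a y <= decay a x.
Proof. by move=> cx; apply: decay_noninc => //; exact: lt_le_trans cx. Qed.

Let dissip_c x y : c <= x -> x <= y -> dissip a l y <= dissip a l x.
Proof. by move=> cx; apply: dissip_noninc => //; exact: lt_le_trans cx. Qed.

Let dissip_le1 x : dissip a l x <= 1.
Proof. by rewrite gerBl expR_ge0. Qed.

Let integrable_dissip_itv b : mu.-integrable `]c, b] (EFin \o dissip a l).
Proof.
apply: integrableS (integrable_dissip a0 a1 c0 l0) => //.
by apply: subset_itvl; rewrite bnd_simp.
Qed.

Let Rintegral_dissip_le b : \int[mu]_(x in `]c, b]) dissip a l x <= Psi a c l.
Proof.
rewrite /Psi /Rintegral fine_le//.
- exact: integrable_fin_num.
- by apply: integrable_fin_num => //; exact: integrable_dissip.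
apply: ge0_subset_integral => //.
- by apply/measurable_EFinP; apply: measurable_funTS; exact: measurable_dissip.
- by move=> x _; rewrite lee_fin dissip_ge0.
- by apply: subset_itvl; rewrite bnd_simp.
Qed.

Local Notation laplace D n := (\int[P]_w expR (- (l * shot Gam (decay a) c D n w))).
Local Notation laplace_all D := (\int[P]_w expR (- (l * shot_all N Gam (decay a) c D w))).

Lemma laplace_decay_ge D n : expR (- Psi a c l) <= laplace D n.
Proof.
apply/ler_addgt0Pr => e e0.
(* Enough slices of width [e] to cover the window; the Riemann error is then at most [e]. *)
pose m := (Num.truncn ((D - c) / e)).+1.
have Dm : D <= c + m%:R * e.
  rewrite -lerBlDl -ler_pdivrMr// ltW//; exact: Num.Theory.truncnS_gt.
have := laplace_shot_ge hN hGam c_ge0 (decay_ge0 a) decay_c (measurable_decay a) l0 n e0 Dm.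
set s := \sum_(_ <= _ < _) _ => h.
have sP : s <= Psi a c l + e.
  have -> : s = _ := riemann_shift (dissip a l) c e m.
  apply: lerD.
    apply: le_trans (Rintegral_dissip_le (c + m%:R * e)).
    exact: (riemann_lower e0 dissip_c integrable_dissip_itv).
  rewrite ler_piMr ?(ltW e0)//.
  by have := dissip_le1 c; have := dissip_ge0 a (c + m%:R * e) l0; lra.
(* As exp(-Psi) <= 1, the factor exp(-e) costs at most an additive [e]. *)
have : expR (- Psi a c l) * expR (- e) <= laplace D n.
  by apply: le_trans h; rewrite -expRD ler_expR; lra.
have E1 : expR (- Psi a c l) <= 1 by rewrite -expR0 ler_expR oppr_le0 Psi_ge0.
have E0 := expR_ge0 (- Psi a c l).
have : 1 - e <= expR (- e) by have := expR_ge1Dx (- e); lra.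
move=> e1 E; rewrite -lerBlDr; apply: le_trans E.
apply: le_trans (ler_wpM2l E0 e1).
by rewrite mulrBr mulr1 lerB// ler_piMl// ltW.
Qed.

Lemma laplace_decay_all_ge D : expR (- Psi a c l) <= laplace_all D.
Proof.
have cv := cvg_laplace_shot hN hGam c_ge0 (decay_ge0 a) (measurable_decay a) l0 (D := D).
rewrite -(cvg_lim _ cv)//; apply: limr_ge; first by apply/cvg_ex; exists (laplace_all D).
by apply: nearW => n; exact: laplace_decay_ge.
Qed.

Lemma cvg_laplace_decay_all :
  laplace_all (c + m.+2%:R) @[m --> \oo] --> expR (- Psi a c l).
Proof.
pose lo m := \int[mu]_(x in `]c, c + m.+1%:R]) dissip a l x.
have lo_cvg : lo m @[m --> \oo] --> Psi a c l.
  apply: (cvg_Rintegral_bigcup (measurable_itv_lebesgue (`]c, +oo[ : interval R))) => //.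
  - by move=> m; apply: subset_itvl; rewrite bnd_simp.
  - move=> x /=; rewrite in_itv/= andbT => cx; near=> m; rewrite /= in_itv/= cx/=.
    rewrite -lerBlDl (@le_trans _ _ m%:R) ?ler_nat//.
    by near: m; exact: nbhs_infty_ger.
  - exact: integrable_dissip.
(* (m+1)^2 slices of width 1/(m+1) end at c + m + 1, strictly before the window closes; the range
   grows while the mesh error vanishes. *)
have up m : laplace_all (c + m.+2%:R) <= expR (- (lo m - m.+1%:R^-1)).
  have e0 : 0 < (m.+1%:R^-1 : R) by rewrite invr_gt0.
  have tm : c + (m.+1 * m.+1)%:R * m.+1%:R^-1 = c + m.+1%:R :> R.
    by rewrite natrM mulfK// pnatr_eq0.
  have lt : c + (m.+1 * m.+1)%:R * m.+1%:R^-1 < c + m.+2%:R by rewrite tm ltrD2l ltr_nat.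
  have := laplace_shot_all_le hN hGam c_ge0 (decay_ge0 a) decay_c (measurable_decay a) l0 e0 lt.
  move=> /le_trans; apply; rewrite ler_expR lerN2.
  have := riemann_shift (dissip a l) c m.+1%:R^-1 (m.+1 * m.+1).
  have := riemann_upper e0 dissip_c integrable_dissip_itv (m.+1 * m.+1).
  rewrite tm -/(lo m) => h1 h2.
  have h3 : m.+1%:R^-1 * (dissip a l c - dissip a l (c + m.+1%:R)) <= m.+1%:R^-1.
    rewrite ler_piMr ?(ltW e0)//.
    by rewrite lerBlDr (le_trans (dissip_le1 c))// lerDl dissip_ge0.
  by rewrite lerBlDr; apply: le_trans h1 _; rewrite h2; exact: lerD.
apply: (squeeze_cvgr _ (cvg_cst _) (_ : expR (- (lo m - m.+1%:R^-1)) @[m --> \oo] --> expR (- Psi a c l))).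
  by apply: nearW => m; rewrite up laplace_decay_all_ge.
apply: continuous_cvg; first exact: continuous_expR.
apply: cvgN; rewrite -[X in _ --> X]subr0; apply: cvgB => //.
exact: cvg_harmonic.
Unshelve. all: by end_near. Qed.

End laplace_bounds.

(** * Truncated sums and their limit *)

Section characteristic_gap.
Context {R : realType}.
Local Notation mu := (@lebesgue_measure R).

(* [L] stands for the characteristic function of a normalised truncated sum, [gap]
   for the integrand comparing it with the standard normal one. *)
Definition gap_profile (L : R -> R) := [/\ (forall u, expR (- (u ^+ 2 / 2)) <= L u),
  (forall u, L u <= 1) & (forall u v, 0 <= u -> u <= v -> L v <= L u)].

Definition gap (L : R -> R) e r := (L (r / e) - expR (- ((r / e) ^+ 2 / 2))) / r * gauss 1 r.

Variable e : R.
Hypothesis e0 : 0 < e.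

Lemma gap_ge0 L r : gap_profile L -> 0 < r -> 0 <= gap L e r.
Proof.
by move=> [L1 _ _] r0; rewrite mulr_ge0 ?gauss_ge0// divr_ge0 ?(ltW r0)// subr_ge0.
Qed.

Lemma measurable_gap L : gap_profile L -> measurable_fun (`]0, +oo[%classic : set R) (gap L e).
Proof.
move=> [_ _ L3]; apply: measurable_funM; last first.
  by apply: measurable_funTS; exact: measurable_gauss.
apply: measurable_funM; last first.
  apply: open_continuous_measurable_fun; first exact: interval_open.
  move=> r; rewrite inE/= in_itv/= andbT => r0.
  by apply: inv_continuous; rewrite gt_eqF.
apply: measurable_funB.
  (* [L] is known to be monotone only on nonnegative arguments; the maximum extends monotonicity to
     the whole line. *)
  apply: (eq_measurable_fun (fun r : R => L (Num.max 0 r / e))).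
    by move=> r; rewrite inE/= in_itv/= andbT => r0; rewrite max_r// ltW.
  apply: nonincreasing_measurable => // r s rs.
  apply: L3; first by rewrite divr_ge0 ?(ltW e0)// le_max lexx.
  rewrite ler_pM2r ?invr_gt0// ge_max le_max lexx/= le_max rs orbT//.
apply: measurable_funTS; do 2 apply: measurableT_comp => //.
apply: measurable_funM => //; apply: measurable_funX; exact: measurable_funM.
Qed.

(** The difference of transforms at u = r / e is at most u: by the quadratic expansion for u <= 1,
    trivially beyond. This cancels the division by [r] and gives a domination independent of [L]. *)
Lemma gap_le L r : gap_profile L -> 0 < r -> gap L e r <= e^-1 * gauss 1 r.
Proof.
move=> [L1 L2 _] r0; rewrite ler_wpM2r ?gauss_ge0// ler_pdivrMr// [e^-1 * r]mulrC.
set u := r / e; have u0 : 0 < u by rewrite divr_gt0.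
have h1 := L1 u; have h2 := L2 u.
have [u1|u1] := leP 1 u; first by have := expR_gt0 (- (u ^+ 2 / 2)); lra.
have := expR_ge1Dx (- (u ^+ 2 / 2)).
have : u ^+ 2 <= u by rewrite expr2 ger_pMr// ltW.
by lra.
Qed.

Let m0y := measurable_itv_lebesgue (`]0, +oo[ : interval R).

Let integrable_dom : mu.-integrable `]0, +oo[ (EFin \o (fun r => e^-1 * gauss 1 r)).
Proof.
apply: integrable_EFinZl => //; apply: integrableS (integrable_gauss ltr01) => //.
Qed.

Lemma integrable_gap L : gap_profile L -> mu.-integrable `]0, +oo[ (EFin \o gap L e).
Proof.
move=> hL; apply: (dominated_integrable_EFin m0y _ integrable_dom).
  exact: measurable_gap.
by move=> r /=; rewrite in_itv/= andbT => r0; rewrite ger0_norm ?gap_le ?gap_ge0.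
Qed.

Lemma cvg_Rintegral_gap (L_ : nat -> R -> R) L :
  (forall n, gap_profile (L_ n)) -> (forall u, L_ n u @[n --> \oo] --> L u) ->
  \int[mu]_(r in `]0, +oo[) gap (L_ n) e r @[n --> \oo] -->
  \int[mu]_(r in `]0, +oo[) gap L e r.
Proof.
move=> hL L_L; apply: (dominated_cvg_Rintegral m0y _ integrable_dom).
- by move=> n; exact: measurable_gap.
- move=> r _; apply: cvgMr_tmp; apply: cvgMr_tmp; apply: cvgB; [exact: L_L|exact: cvg_cst].
- by move=> n r /=; rewrite in_itv/= andbT => r0; rewrite ger0_norm ?gap_le ?gap_ge0.
Qed.

End characteristic_gap.

Section tail_sum.
Context d (T : measurableType d) (R : realType) (P : probability T R).
Context d' (T' : measurableType d') (Q : probability T' R).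
Local Notation mu := (@lebesgue_measure R).
Variables (alpha sigma c : R) (N : R -> {RV P >-> nat}) (Gam W : nat -> {RV P >-> R}).
Variable Z : {RV Q >-> R}.
Hypothesis halpha0 : 0 < alpha.
Hypothesis halpha2 : alpha < 2.
Hypothesis hsigma : 0 < sigma.
Hypothesis hN : is_poisson_process 1 N.
Hypothesis hGam : forall j w, Gam j w = arrival_time N j w.
Hypothesis hWlaw : forall j, distribution P (W j) = normal_prob 0 sigma.
Hypothesis hWind : mutual_independence P (fun j => W j : T -> R).
Hypothesis hWGam : independent_families P (fun j => Gam j : T -> R) (fun j => W j : T -> R).
Hypothesis hc : 1 < c.
Hypothesis hZ : distribution Q Z = normal_prob 0 1.

Let a := alpha / 2.
Let a0 : 0 < a. Proof. by rewrite divr_gt0. Qed.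
Let a1 : a < 1. Proof. by rewrite ltr_pdivrMr// mul1r. Qed.
Let c0 : 0 < c. Proof. exact: lt_trans hc. Qed.
Let aE : a^-1 = 2 / alpha. Proof. by rewrite invf_div. Qed.

Let jump D := window (fun x => x `^ (- alpha^-1)) c D.

Let measurable_jump D : measurable_fun setT (jump D).
Proof. by apply: measurable_window; exact: measurable_powR. Qed.

Let jump_le1 D x : `|jump D x| <= 1.
Proof.
rewrite /jump /window; case: ifPn => [/andP[cx _]|_]; last by rewrite normr0.
have x1 : 1 <= x by rewrite ltW// (lt_trans hc).
rewrite ger0_norm ?powR_ge0// powRN invf_le1 ?powR_gt0 ?(lt_le_trans ltr01)//.
rewrite -[leLHS](one_powR alpha^-1); apply: ge0_ler_powR => //.
- by rewrite invr_ge0 ltW.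
- by rewrite nnegrE.
- by rewrite nnegrE (le_trans ler01).
Qed.

Let jump_sq D x : jump D x ^+ 2 = window (decay a) c D x.
Proof.
rewrite /jump /window; case: ifPn => [_|_]; last by rewrite expr0n.
by rewrite /decay -powR_mulrn ?powR_ge0// -powRrM aE mulNr mulrC.
Qed.

Let gvarE D n w : gvar Gam (jump D) n w = shot Gam (decay a) c D n w.
Proof. by apply: eq_bigr => j _; rewrite jump_sq. Qed.

Let pathN w s u : 0 <= s -> s <= u -> (N s w <= N u w)%N.
Proof. exact: (poisson_nondecreasing hN). Qed.

Let pathrc w u : 0 <= u -> \forall s \near u^'+, N s w = N u w.
Proof. exact: (poisson_right_continuous hN). Qed.

(** Every arrival inside the window has index below [N D w], so a long enough partial sum is the
    whole sum. *)
Lemma gsum_Rsum D n w : (N D w <= n)%N ->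
  gsum Gam W (jump D) n w = Rsum alpha c D Gam W w.
Proof.
move=> Dn; rewrite /Rsum fsbig_mkcond.
rewrite (@fsbigE _ _ _ _ setT (index_iota 0 n)) ?iota_uniq//.
  rewrite /gsum; apply: eq_big => [j|j _]; first by rewrite in_setT.
  rewrite patchE /jump /window; case: ifPn => [h|h]; case: ifPn => // h'.
  - by move: h'; rewrite mem_set.
  - by move: h' => /set_mem/= h'; rewrite h' in h.
  - by rewrite mulr0.
move=> j _; rewrite mem_index_iota/= -leqNgt => nj; rewrite patchE.
case: ifPn => // /set_mem/= /andP[cG GD].
have GE : Gam j w = arrival (N ^~ w) j by exact: hGam.
have := @arrival_lt _ (N ^~ w) (@pathN w) (@pathrc w) j D.
rewrite -GE => /(_ (lt_trans c0 cG) GD) jN.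
by have := leq_trans (leq_trans jN Dn) nj; rewrite ltnn.
Qed.

(** The integral of [decay a] beyond [c], that is the mean of the shot noise; hence S^2 = sigma^2
    M. *)
Let M := c `^ (1 - a^-1) / (a^-1 - 1).
Let S := S_tail sigma alpha c.

Let ai1 : 0 < a^-1 - 1. Proof. by rewrite subr_gt0 invf_gt1. Qed.
Let M0 : 0 < M. Proof. by rewrite divr_gt0// powR_gt0. Qed.

Let S_sq : S ^+ 2 = sigma ^+ 2 * M.
Proof.
have ane : alpha != 0 by rewrite gt_eqF.
have e1 : (alpha - 2) / alpha = 1 - a^-1 by rewrite aE; field.
have e2 : alpha / (2 - alpha) = (a^-1 - 1)^-1.
  rewrite aE (_ : 2 / alpha - 1 = (2 - alpha) / alpha) ?invf_div//.
  by field.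
rewrite /S /S_tail e1 e2 -mulrA [_^-1 * _]mulrC sqr_sqrtr// mulr_ge0 ?sqr_ge0// ltW//.
Qed.

Let S0 : 0 < S.
Proof.
have : 0 < S ^+ 2 by rewrite S_sq mulr_gt0// exprn_gt0.
by rewrite exprn_even_gt0//= => h; rewrite lt_neqAle eq_sym h sqrtr_ge0.
Qed.

(** The factor in front of [shot] is sigma^2 (u / S)^2 / 2, so this is the transform of the [n]-term
    sum divided by [S]. *)
Let Lsum D n u := \int[P]_w expR (- (u ^+ 2 / (2 * M) * shot Gam (decay a) c D n w)).
Let Lall D u := \int[P]_w expR (- (u ^+ 2 / (2 * M) * shot_all N Gam (decay a) c D w)).
Let Llim u := expR (- Psi a c (u ^+ 2 / (2 * M))).

Let lam_ge0 u : 0 <= u ^+ 2 / (2 * M).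
Proof. by rewrite divr_ge0 ?sqr_ge0// mulr_ge0// ltW. Qed.

Let Llim_ge u : expR (- (u ^+ 2 / 2)) <= Llim u.
Proof.
rewrite ler_expR lerN2; apply: le_trans (Psi_le a0 a1 c0 (lam_ge0 u)) _.
rewrite -/M le_eqVlt; apply/orP; left; apply/eqP.
by field; rewrite gt_eqF.
Qed.

Let lam_homo u v : 0 <= u -> u <= v -> u ^+ 2 / (2 * M) <= v ^+ 2 / (2 * M).
Proof.
move=> u0 uv; have m0 : 0 < (2 * M)^-1 by rewrite invr_gt0 mulr_gt0.
rewrite ler_pM2r//.
by rewrite ler_sqr// nnegrE ?(le_trans u0).
Qed.

Let shot0 D n w : 0 <= shot Gam (decay a) c D n w.
Proof. exact: (shot_ge0 _ _ (decay_ge0 a)). Qed.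

Let integrable_laplace l D n : 0 <= l ->
  P.-integrable setT (EFin \o (fun w => expR (- (l * shot Gam (decay a) c D n w)))).
Proof.
move=> l0; apply: (@bounded_integrable _ _ _ _ _ 1).
  exact: (measurable_expR_shot Gam c (measurable_decay a) D _ n).
by move=> w; exact: (expR_shot_norm Gam c (decay_ge0 a)).
Qed.

Lemma gap_profile_sum D n : gap_profile (Lsum D n).
Proof.
split.
- by move=> u; apply: le_trans (Llim_ge u) _; exact: (laplace_decay_ge hN hGam).
- move=> u; apply: le_trans (ler_norm _) _; apply: le_norm_bounded_Rintegral.
    exact: (measurable_expR_shot Gam c (measurable_decay a) D _ n).
  by move=> w; exact: (expR_shot_norm Gam c (decay_ge0 a)).
- move=> u v u0 uv; apply: le_Rintegral => //; [exact: integrable_laplace..|].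
  by move=> w _; rewrite ler_expR lerN2 ler_wpM2r// lam_homo.
Qed.

Lemma cvg_Lsum D u : Lsum D n u @[n --> \oo] --> Lall D u.
Proof.
exact: (cvg_laplace_shot hN hGam (ltW c0) (decay_ge0 a) (measurable_decay a) (lam_ge0 u)).
Qed.

Lemma gap_profile_all D : gap_profile (Lall D).
Proof.
have h := gap_profile_sum D.
split.
- move=> u; apply: (ler_cvg_to (cvg_cst _) (@cvg_Lsum D u)).
  by apply: nearW => n; case: (h n).
- move=> u; apply: (ler_cvg_to (@cvg_Lsum D u) (cvg_cst _)).
  by apply: nearW => n; case: (h n).
- move=> u v u0 uv; apply: (ler_cvg_to (@cvg_Lsum D v) (@cvg_Lsum D u)).
  by apply: nearW => n; case: (h n) => _ _; apply.
Qed.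

Lemma cvg_Lall u : Lall (c + m.+2%:R) u @[m --> \oo] --> Llim u.
Proof. exact: cvg_laplace_decay_all. Qed.

Lemma gap_profile_lim : gap_profile Llim.
Proof.
have h m := gap_profile_all (c + m.+2%:R).
split.
- by move=> u; exact: Llim_ge.
- move=> u; apply: (ler_cvg_to (@cvg_Lall u) (cvg_cst _)).
  by apply: nearW => n; case: (h n).
- move=> u v u0 uv; apply: (ler_cvg_to (@cvg_Lall v) (@cvg_Lall u)).
  by apply: nearW => n; case: (h n) => _ _; apply.
Qed.

(** The bound is uniform in [e], which is what later allows [e] to tend to 0 at no cost. *)
Lemma Rintegral_gap_lim_le e : 0 < e ->
  pi^-1 * \int[mu]_(r in `]0, +oo[) gap Llim e r <= B1 c alpha.
Proof.
(* Chosen so that w = rho r^2 satisfies w c^(1/a) = (r / e)^2 / (2 M), the argument of [Psi] in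
   [Llim (r / e)]. *)
move=> e0; pose rho := c `^ (- a^-1) / (2 * M * e ^+ 2).
have rho0 : 0 < rho by rewrite divr_gt0 ?powR_gt0// mulr_gt0 ?exprn_gt0// mulr_gt0.
have k0 : 0 <= c * (a / (2 * (2 - a))).
  rewrite mulr_ge0 ?(ltW c0)// divr_ge0 ?(ltW a0)// mulr_ge0//.
  by rewrite subr_ge0 ltW// (lt_trans a1)// ltr1n.
apply: le_trans (majorant_constant_le_B1 a0 a1 hc rho0 (erefl : alpha / 2 = a)).
apply: ler_wpM2l; first by rewrite invr_ge0 ltW// pi_gt0.
apply: (Rintegral_majorant_le a0 a1 hc rho0 k0 (integrable_gap e0 gap_profile_lim)).
move=> r r0; rewrite /gap.
have w0 : 0 < rho * r ^+ 2 by rewrite mulr_gt0// exprn_gt0.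
have lE : rho * r ^+ 2 * c `^ a^-1 = (r / e) ^+ 2 / (2 * M).
  rewrite /rho powRN; field.
  by rewrite !gt_eqF// powR_gt0.
have := expPsi_defect a0 a1 c0 hc w0.
rewrite lE -/M.
have -> : (r / e) ^+ 2 / (2 * M) * M = (r / e) ^+ 2 / 2 by field; rewrite !gt_eqF.
rewrite -/(Llim (r / e)) => h.
have d0 : 0 <= (Llim (r / e) - expR (- ((r / e) ^+ 2 / 2))) / r.
  by rewrite divr_ge0 ?(ltW r0)// subr_ge0.
apply: le_trans (_ : (Llim (r / e) - expR (- ((r / e) ^+ 2 / 2))) / r <= _).
  by rewrite ler_piMr ?gauss_le1.
by rewrite ler_pM2r ?invr_gt0.
Qed.

Let Sinv0 : 0 < S^-1. Proof. by rewrite invr_gt0. Qed.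

Let gsum_rv D n : {RV P >-> R} := mfun_Sub (mem_set (measurable_gsum Gam W (measurable_jump D) n)).

Let X D n : {RV P >-> R} := scale_mfun S^-1 (gsum_rv D n).

Let XD D : {RV P >-> R} := scale_mfun S^-1 (Rsum alpha c D Gam W : {RV P >-> R}).

Let integrable_X D n : P.-integrable setT (EFin \o X D n).
Proof.
have ig := integrable_gsum Gam (lt0r_neq0 hsigma) hWlaw (measurable_jump D) n (jump_le1 D).
apply: eq_integrable (integrable_EFinZl measurableT S^-1 ig) => // w _ /=.
by rewrite mulrC.
Qed.

Let Rintegral_sin_X D n y u : \int[P]_w sin (y - u * X D n w) = sin y * Lsum D n u.
Proof.
have := Rintegral_sin_gsum (lt0r_neq0 hsigma) hWlaw hWind hWGam (measurable_jump D) n y (u / S).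
rewrite (_ : \int[P]_w sin (y - u / S * gsum Gam W (jump D) n w) =
  \int[P]_w sin (y - u * X D n w)); last first.
  by apply: eq_Rintegral => w _ /=; rewrite mulrAC -mulrA.
move=> ->; congr (_ * _); apply: eq_Rintegral => w _.
rewrite gvarE; congr expR; rewrite -[RHS]mulNr; congr (_ * _).
rewrite !exprMn exprVn S_sq; field.
by rewrite !gt_eqF.
Qed.

Let integrable_Z : Q.-integrable setT (EFin \o Z).
Proof.
apply/integrableP; split; first by apply/measurable_EFinP.
have /integrableP[_] := integrable_normal_id (oner_neq0 R).
rewrite -(ge0_integral_normal_law hZ)//.
have : measurable_fun setT (EFin \o (fun y : R => `|y|)).
  by apply/measurable_EFinP; exact: normr_measurable.
by [].
Qed.

Let Rintegral_sin_Z y u : \int[Q]_w sin (y - u * Z w) = sin y * expR (- (u ^+ 2 / 2)).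
Proof.
have := Rintegral_normal_sin y u (oner_neq0 R).
rewrite mulr1 mulNr => <-; rewrite /Rintegral; congr fine.
apply: (integral_normal_law hZ (f := fun z => (sin (y - u * z))%:E)).
  apply/measurable_EFinP; apply: (measurableT_comp (@measurable_sin R)).
  by apply: measurable_funB => //; exact: measurable_funM.
apply: (@bounded_integrable _ _ _ _ (fun w => sin (y - u * Z w)) 1).
  apply: (measurableT_comp (@measurable_sin R)).
  by apply: measurable_funB => //; exact: measurable_funM.
by move=> w; rewrite ler_norml sin_geN1 sin_le1.
Qed.

Section smoothing.
Variables (e delta tau : R).
Hypothesis e0 : 0 < e.
Hypothesis tau_tail : forall z, delta / e <= z -> 2^-1 - tau <= sinint z.
Hypothesis tau0 : 0 <= tau.

Let gap_norm D n r : 0 < r ->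
  `|Lsum D n (r / e) - expR (- ((r / e) ^+ 2 / 2))| / r * gauss 1 r = gap (Lsum D n) e r.
Proof.
by move=> r0; rewrite ger0_norm// subr_ge0; case: (gap_profile_sum D n).
Qed.

Lemma smoothing_sum D n x :
  fine (cdf (X D n) x) <= fine (cdf Z (x + 2 * delta)) + 2 * tau +
    pi^-1 * \int[mu]_(r in `]0, +oo[) gap (Lsum D n) e r /\
  fine (cdf Z x) <= fine (cdf (X D n) (x + 2 * delta)) + 2 * tau +
    pi^-1 * \int[mu]_(r in `]0, +oo[) gap (Lsum D n) e r.
Proof.
have ig := integrable_gap e0 (gap_profile_sum D n).
split.
- apply: (smoothing_inequality (integrable_X D n) integrable_Z (Rintegral_sin_X D n)
    Rintegral_sin_Z e0 tau_tail tau0 ig) => r r0.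
  by rewrite gap_norm.
- apply: (smoothing_inequality integrable_Z (integrable_X D n) Rintegral_sin_Z
    (Rintegral_sin_X D n) e0 tau_tail tau0 ig) => r r0.
  by rewrite distrC gap_norm.
Qed.

Let cvg_cdf_X D x : fine (cdf (X D n) x) @[n --> \oo] --> fine (cdf (XD D) x).
Proof.
apply: cvg_cdf_stable => w; near=> n; rewrite /= gsum_Rsum//.
by near: n; exact: nbhs_infty_ge.
Unshelve. all: by end_near. Qed.

Lemma smoothing_sum_all D x :
  fine (cdf (XD D) x) <= fine (cdf Z (x + 2 * delta)) + 2 * tau +
    pi^-1 * \int[mu]_(r in `]0, +oo[) gap (Lall D) e r /\
  fine (cdf Z x) <= fine (cdf (XD D) (x + 2 * delta)) + 2 * tau +
    pi^-1 * \int[mu]_(r in `]0, +oo[) gap (Lall D) e r.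
Proof.
have cg := cvg_Rintegral_gap e0 (gap_profile_sum D) (@cvg_Lsum D).
have cp : pi^-1 * \int[mu]_(r in `]0, +oo[) gap (Lsum D n) e r @[n --> \oo] -->
  pi^-1 * \int[mu]_(r in `]0, +oo[) gap (Lall D) e r by exact: cvgMl_tmp.
split.
- apply: (ler_cvg_to (@cvg_cdf_X D x) (cvgD (cvg_cst _) cp)).
  by apply: nearW => n; case: (smoothing_sum D n x).
- apply: (ler_cvg_to (cvg_cst _) (cvgD (cvgD (@cvg_cdf_X D _) (cvg_cst _)) cp)).
  by apply: nearW => n; case: (smoothing_sum D n x).
Qed.

End smoothing.

Context d'' (T'' : measurableType d'') (Q' : probability T'' R).
Variable Rinf : {RV Q' >-> R}.
Hypothesis hRinf : cvg_in_distribution +oo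
    (fun D : R => Rsum alpha c D Gam W : {RV P >-> R}) Rinf.

Let Xinf : {RV Q' >-> R} := scale_mfun S^-1 Rinf.

Let cvg_cdf_XD x : {for x, continuous (cdf Xinf)} ->
  fine (cdf (XD (c + m.+2%:R)) x) @[m --> \oo] --> fine (cdf Xinf x).
Proof.
move=> cx; apply: fine_cvg; rewrite fineK ?fin_num_cdf//.
have xE : x / S^-1 = x * S by rewrite invrK.
have cR : {for x * S, continuous (cdf Rinf)}.
  rewrite (_ : cdf Rinf = fun y => cdf Xinf (y / S)).
    apply: (@continuous_comp _ _ _ (fun y : R => y / S) (cdf Xinf)).
      by apply: cvgM; [exact: cvg_id|exact: cvg_cst].
    by rewrite mulfK// gt_eqF.
  by apply/funext => y; rewrite cdf_scale// invrK divfK// gt_eqF.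
rewrite cdf_scale// xE; under eq_fun do rewrite cdf_scale// xE.
apply: (cvg_comp _ _ _ (hRinf cR)).
apply/cvgryPge => A; near=> m.
rewrite (@le_trans _ _ m%:R)//; first by near: m; exact: nbhs_infty_ger.
by rewrite (@le_trans _ _ m.+2%:R) ?ler_nat ?lerDr ?(ltW c0)// -addn2 leq_addr.
Unshelve. all: by end_near. Qed.

Lemma smoothing_tail e delta tau x : 0 < e ->
  (forall z, delta / e <= z -> 2^-1 - tau <= sinint z) -> 0 <= tau ->
  ({for x, continuous (cdf Xinf)} ->
    fine (cdf Xinf x) <= fine (cdf Z (x + 2 * delta)) + 2 * tau + B1 c alpha) /\
  ({for x + 2 * delta, continuous (cdf Xinf)} ->
    fine (cdf Z x) <= fine (cdf Xinf (x + 2 * delta)) + 2 * tau + B1 c alpha).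
Proof.
move=> e0 tau_tail tau0.
have cg := cvg_Rintegral_gap e0 (fun m => gap_profile_all (c + m.+2%:R)) cvg_Lall.
have cp : pi^-1 * \int[mu]_(r in `]0, +oo[) gap (Lall (c + m.+2%:R)) e r @[m --> \oo] -->
  pi^-1 * \int[mu]_(r in `]0, +oo[) gap Llim e r by exact: cvgMl_tmp.
have hB := Rintegral_gap_lim_le e0.
have h m := smoothing_sum_all e0 tau_tail tau0 (c + m.+2%:R) x.
split => cx.
- apply: le_trans (_ : fine (cdf Z (x + 2 * delta)) + 2 * tau +
    pi^-1 * \int[mu]_(r in `]0, +oo[) gap Llim e r <= _); last by rewrite lerD2l.
  apply: (ler_cvg_to (cvg_cdf_XD cx) (cvgD (cvg_cst _) cp)).
  by apply: nearW => m; case: (h m).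
- apply: le_trans (_ : fine (cdf Xinf (x + 2 * delta)) + 2 * tau +
    pi^-1 * \int[mu]_(r in `]0, +oo[) gap Llim e r <= _); last by rewrite lerD2l.
  apply: (ler_cvg_to (cvg_cst _) (cvgD (cvgD (cvg_cdf_XD cx) (cvg_cst _)) cp)).
  by apply: nearW => m; case: (h m).
Qed.

Let smoothing_tail0 delta x : 0 < delta ->
  ({for x, continuous (cdf Xinf)} ->
    fine (cdf Xinf x) <= fine (cdf Z (x + 2 * delta)) + B1 c alpha) /\
  ({for x + 2 * delta, continuous (cdf Xinf)} ->
    fine (cdf Z x) <= fine (cdf Xinf (x + 2 * delta)) + B1 c alpha).
Proof.
move=> delta0.
have h t : 0 < t -> exists2 e : R, 0 < e & forall z, delta / e <= z -> 2^-1 - t / 2 <= sinint z.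
  move=> t0; have t20 : 0 < t / 2 by rewrite divr_gt0.
  have [y y0 hy] := @sinint_near_half R (t / 2) t20.
  (* With this [e] the threshold [delta / e] equals [y], beyond which the normal tail is below
     [t / 2]. *)
  exists (delta / y); first by rewrite divr_gt0.
  by move=> z; rewrite invf_div mulrC divfK ?gt_eqF//; exact: hy.
split => cx; apply/ler_addgt0Pr => t t0; have [e e0 he] := h t t0.
- have [h1 _] := smoothing_tail x e0 he (divr_ge0 (ltW t0) (ler0n R 2)).
  by have := h1 cx; lra.
- have [_ h2] := smoothing_tail x e0 he (divr_ge0 (ltW t0) (ler0n R 2)).
  by have := h2 cx; lra.
Qed.

Lemma cdf_tail_le x : fine (cdf Xinf x) <= fine (cdf Z x) + B1 c alpha.
Proof.
apply: le_cdf_right => e e0.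
have xe : x < x + e / 2 by rewrite ltrDl divr_gt0.
have [y /andP[xy ye] cy] := exists_cdf_continuous Xinf xe.
(* As y < x + e/2, the smoothing shift 2 (e/4) keeps the argument below x + e. *)
have e4 : 0 < e / 4 by rewrite divr_gt0.
apply: le_trans (fine_cdf_homo Xinf (ltW xy)) _.
apply: le_trans ((smoothing_tail0 y e4).1 cy) _.
by rewrite lerD2r; apply: fine_cdf_homo; lra.
Qed.

(** In this direction the shifted argument must be the continuity point, so the shift is taken to be
    exactly [y - x]. *)
Lemma cdf_tail_ge x : fine (cdf Z x) <= fine (cdf Xinf x) + B1 c alpha.
Proof.
apply: le_cdf_right => e e0.
have xe : x < x + e by rewrite ltrDl.
have [y /andP[xy ye] cy] := exists_cdf_continuous Xinf xe.
have e2 : 0 < (y - x) / 2 by rewrite divr_gt0// subr_gt0.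
have yE : x + 2 * ((y - x) / 2) = y by field.
have [_] := smoothing_tail0 x e2; rewrite yE => /(_ cy) h.
by apply: le_trans h _; rewrite lerD2r; apply: fine_cdf_homo; exact: ltW.
Qed.

Lemma kolmogorov_tail_le : (kolmogorov_distance Xinf Z <= (B1 c alpha)%:E)%E.
Proof.
apply: ge_ereal_sup => _ [x _ <-].
rewrite -[cdf Xinf x]fineK ?fin_num_cdf// -[cdf Z x]fineK ?fin_num_cdf//.
rewrite -EFinB lee_fin ler_norml.
by have := cdf_tail_le x; have := cdf_tail_ge x; lra.
Qed.

End tail_sum.

Unset Implicit Arguments.

Theorem theorem2 (R : realType) (alpha sigma c : R)
  (d : measure_display) (T : measurableType d) (P : probability T R)
  (N : R -> {RV P >-> nat}) (Gam W : nat -> {RV P >-> R})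
  (d' : measure_display) (T' : measurableType d') (Q : probability T' R)
  (Rinf : {RV Q >-> R})
  (d'' : measure_display) (T'' : measurableType d'') (Q' : probability T'' R)
  (Z : {RV Q' >-> R})
  (halpha0 : 0 < alpha) (halpha2 : alpha < 2) (halpha1 : alpha != 1)
  (hsigma : 0 < sigma)
  (hN : is_poisson_process 1 N)
  (hGam : forall j w, Gam j w = arrival_time N j w)
  (hWlaw : forall j, distribution P (W j) = normal_prob 0 sigma)
  (hWind : mutual_independence P W)
  (hWGam : independent_families P Gam W)
  (hc : 1 < c)
  (hRinf : cvg_in_distribution +oo
    (fun D : R => Rsum alpha c D Gam W : {RV P >-> R}) Rinf)
  (hZ : distribution Q' Z = normal_prob 0 1) :
  (kolmogorov_distance (scale_mfun (S_tail sigma alpha c)^-1 Rinf : {RV Q >-> R}) Z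
    <= (B1 c alpha)%:E)%E.
Proof.
exact: (kolmogorov_tail_le halpha0 halpha2 hsigma hN hGam hWlaw hWind hWGam hc hZ hRinf).
Qed.
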